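(* Let $(M,\omega)$ be a compact simply connected pseudo-Einstein symplectic manifold, with $c_1(K^{-1})=k[\omega]$, and let $S\subset M$ be an orientable Bohr–Sommerfeld Lagrangian submanifold with universal Maslov class $m_S\in H^1(S,\mathbb Z)$. Then for every smooth loop $\gamma$ in $S$ and every smooth disc $D$ in $M$ with $\partial D=\gamma$, $$\mu([\gamma,D])-m_S([\gamma])=k\int_D\omega ,$$ where $\mu([\gamma,D])$ is the Maslov index.
   Context: Let $(M,\omega)$ be a symplectic manifold of dimension $2n$. For an $\omega$-compatible almost complex structure $I$, let $G$ be the corresponding Riemannian metric; $(\omega,G,I)$ gives a Hermitian structure on the complex bundle $(TM,I)\cong T^{1,0}M$. The anticanonical line bundle is $K^{-1}=\Lambda^n_{\mathbb C}(TM,I)$ with the induced Hermitian structure $h$; $\mathcal A_h(\cdot)$ denotes the space of Hermitian ($U(1)$-) connections. The class $c_1(K^{-1})$ is independent of $I$. $(M,\omega)$ is pseudo-Einstein if $c_1(K^{-1})=k[\omega]$ (in real cohomology) for some real constant $k$. Curvature convention: a Hermitian connection is locally $d+A$ with $A$ an $i\mathbb R$-valued 1-form, and its curvature is $F=dA$, so $c_1=[\tfrac{i}{2\pi}F]$. A reference connection for $I$ is $a\in\mathcal A_h(K^{-1})$ with $F_a=-2\pi i k\,\omega$. As $M$ is simply connected, for a given $I$ such connections exist and form a single orbit of the gauge group $\mathrm{Map}(M,U(1))$. A smooth embedded Lagrangian submanifold $S\subset M$ is Bohr–Sommerfeld (with respect to the anticanonical bundle) if the flat connection $a|_S$ on $K^{-1}|_S$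 has trivial holonomy character on $\pi_1(S)$, where $a$ is a reference connection. This condition does not depend on the choice of $I$ and $a$. For an orientable Lagrangian $S$, the canonical trivial connection $A_0\in\mathcal A_h(K^{-1}|_S)$ induced by $I$ is the flat connection for which the unit section $e_1\wedge\dots\wedge e_n$ of $K^{-1}|_S$ is parallel, where $(e_1,\dots,e_n)$ is any local oriented $G$-orthonormal frame of $TS$ (independent of the orientation). If $S$ is orientable Bohr–Sommerfeld, there is a gauge transformation $g_S:S\to U(1)$ (unique up to a constant on each component) with $a|_S-A_0=g_S^{-1}dg_S$. The universal Maslov class is $m_S=g_S^*\mathbf h\in H^1(S,\mathbb Z)$, with $\mathbf h\in H^1(U(1),\mathbb Z)$ the positive generator; equivalently $m_S([\gamma])=\frac1{2\pi i}\int_\gamma(a|_S-A_0)$ for loops $\gamma\subset S$. It does not depend on the choice of $I$ and $a$. Discs $D$ in $M$ with boundary loop $\gamma\subset S$ are smooth maps of the closed oriented 2-disc into $M$ whose boundary restriction is $\gamma$; bundles, connections and forms restricted to $D$ or $\gamma$ are pulled back. $(\gamma,D)$ represents an element $[\gamma,D]\in\pi_2(M,S)$. The Maslov index is $$\mu([\gamma,D])=\frac1{2\pi i}\int_\gamma\big(A_f|_\gamma-A_0|_\gamma\big)\in\mathbb Z,$$ where $A_f\in\mathcal A_h(K^{-1}|_D)$ is any flat Hermitian connection over $D$ (it is unique up to gauge). It depends only on the class in $\pi_2(M,S)$, not on $I$ or $A_f$; it is the degree of the $A_0$-parallel trivialization of $K^{-1}|_\gamma$ relative to a trivialization extending over $D$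 (half of the Maslov index as usually normalized for the Lagrangian Grassmannian). *)

(* Defs.v *)
From HB Require Import structures.
From mathcomp Require Import all_boot all_order all_algebra.
From mathcomp Require Import all_classical all_reals all_analysis.
From mathcomp Require Import complex.

Set Implicit Arguments.
Unset Strict Implicit.
Unset Printing Implicit Defensive.

Import Order.TTheory GRing.Theory Num.Theory.
Import numFieldNormedType.Exports.

Local Open Scope classical_set_scope.
Local Open Scope ring_scope.
Local Open Scope complex_scope.

(* [U] is always meant to be open; smooth = C^k for every k. *)
Fixpoint Ck (R : realType) (d : nat) (W : normedModType R) (k : nat)
    (U : set 'rV[R]_d) (f : 'rV[R]_d -> W) : Prop :=
  if k is k'.+1 then
    (forall x, U x -> differentiable f x) /\
    (forall v, Ck k' U (fun x => 'D_v f x))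
  else forall x, U x -> {for x, continuous f}.

Definition smooth_on (R : realType) (d : nat) (W : normedModType R)
    (U : set 'rV[R]_d) (f : 'rV[R]_d -> W) : Prop :=
  forall k, Ck k U f.

(* A manifold modelled on R^d, given by an atlas (not necessarily maximal).
   [coord i] and [param i] are mutually inverse homeomorphisms between the open
   sets [dom i] and [coord i @` dom i]; outside of these sets their values are
   irrelevant. [at_chart p] is a preferred chart at p, used to identify T_p
   with 'rV_d; all tensor fields below are given pointwise in these
   identifications, and smoothness is always tested in the charts.
   Second countability is not an axiom: it follows from compactness for the
   ambient manifold, and is then inherited by its submanifolds. *)
Record manifold (R : realType) (d : nat) := Manifold {
  pt :> topologicalType;
  chart : Type;
  dom : chart -> set pt;
  coord : chart -> pt -> 'rV[R]_d;
  param : chart -> 'rV[R]_d -> pt;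
  at_chart : pt -> chart;
  mfd_hausdorff : hausdorff_space pt;
  at_chartP : forall p, dom (at_chart p) p;
  dom_open : forall i, open (dom i);
  codom_open : forall i, open (coord i @` dom i);
  coordK : forall i p, dom i p -> param i (coord i p) = p;
  coord_continuous : forall i p, dom i p -> {for p, continuous (coord i)};
  param_continuous : forall i x, (coord i @` dom i) x ->
    {for x, continuous (param i)};
  transition_smooth : forall i j,
    smooth_on (coord i @` (dom i `&` dom j)) (coord j \o param i)
}.

Lemma smooth_on_cst (R : realType) (d : nat) (W : normedModType R)
  (U : set 'rV[R]_d) (w : W) : smooth_on U (fun _ => w).
Proof.
move=> k; elim: k w => [|k IH] w /=.
  by move=> x _; exact: cst_continuous.
split; first by move=> x _; exact: differentiable_cst.
move=> v; suff -> : (fun x => 'D_v (fun=> w) x) = (fun=> 0) by exact: IH.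
by apply/funext => x; rewrite -[fun=> w]/(cst w) derive_cst.
Qed.

Lemma smooth_on_id (R : realType) (d : nat) (U : set 'rV[R]_d) :
  smooth_on U (fun x => x).
Proof.
case=> [|k] /=; first by move=> x _; exact: cvg_id.
split.
  move=> x _; exact: (@linear_differentiable _ _ _ idfun x (fun=> cvg_id)).
move=> v; suff -> : (fun x : 'rV[R]_d => 'D_v (fun y => y) x) = (fun=> v)
  by exact: smooth_on_cst.
by apply/funext => x; exact: derive_id.
Qed.

Lemma euclid_smooth (R : realType) (d : nat) (U : set 'rV[R]_d) :
  smooth_on U ((fun x => x) \o (fun x => x)).
Proof. exact: smooth_on_id. Qed.

Lemma euclid_codom (R : realType) (d : nat) :
  open [set x | x in @setT 'rV[R]_d].
Proof. by rewrite image_id; exact: openT. Qed.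

Definition euclid (R : realType) (d : nat) : manifold R d :=
  @Manifold R d 'rV[R]_d unit (fun _ => setT) (fun _ x => x) (fun _ x => x)
    (fun _ => tt)
    (@norm_hausdorff _ _)
    (fun _ => I)
    (fun _ => openT)
    (fun _ => @euclid_codom R d)
    (fun _ _ _ => erefl)
    (fun _ _ _ => cvg_id)
    (fun _ _ _ => cvg_id)
    (fun _ _ => @euclid_smooth R d _).

(* The differential T_x X -> T_(f x) Y, acting on row vectors on the right. *)
Definition mdiff (R : realType) (d e : nat) (X : manifold R d)
    (Y : manifold R e) (f : X -> Y) (x : X) : 'M[R]_(d, e) :=
  jacobian (coord (at_chart (f x)) \o f \o param (at_chart x))
           (coord (at_chart x) x).

Definition dparam (R : realType) (d : nat) (X : manifold R d) (i : chart X)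
    (y : 'rV[R]_d) : 'M[R]_d := @mdiff R d d (euclid R d) X (@param R d X i) y.

Definition dcoord (R : realType) (d : nat) (X : manifold R d) (i : chart X)
    (x : X) : 'M[R]_d := @mdiff R d d X (euclid R d) (@coord R d X i) x.

Definition smooth_map (R : realType) (d e : nat) (X : manifold R d)
    (Y : manifold R e) (V : set X) (f : X -> Y) : Prop :=
  (forall x, V x -> {for x, continuous f}) /\
  (forall (i : chart X) (j : chart Y),
     smooth_on (coord i @` (dom i `&` V `&` f @^-1` dom j))
               (coord j \o f \o param i)).

Definition smooth_fun (R : realType) (d : nat) (X : manifold R d)
    (W : normedModType R) (V : set X) (g : X -> W) : Prop :=
  forall i : chart X, smooth_on (coord i @` (dom i `&` V)) (g \o param i).

Definition smooth_cfun (R : realType) (d : nat) (X : manifold R d)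
    (V : set X) (g : X -> R[i]) : Prop :=
  smooth_fun V (fun x => (complex.Re (g x) : R^o)) /\
  smooth_fun V (fun x => (complex.Im (g x) : R^o)).

(* The rows of [E] are smooth sections of f^*TY over V. *)
Definition smooth_along (R : realType) (d e r : nat) (X : manifold R d)
    (Y : manifold R e) (f : X -> Y) (V : set X) (E : X -> 'M[R]_(r, e)) :
    Prop :=
  forall (i : chart X) (j : chart Y),
    smooth_on (coord i @` (dom i `&` V `&` f @^-1` dom j))
              (fun y => E (param i y) *m dcoord j (f (param i y))).

(* A 1-form b evaluates on v in T_x as v *m b x; a 2-form w evaluates on
   (v, v') as v *m w x *m v'^T. *)

Definition pull1 (R : realType) (d e : nat) (X : manifold R d)
    (Y : manifold R e) (f : X -> Y) (b : Y -> 'cV[R]_e) (x : X) : 'cV[R]_d :=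
  mdiff f x *m b (f x).

Definition pull2 (R : realType) (d e : nat) (X : manifold R d)
    (Y : manifold R e) (f : X -> Y) (w : Y -> 'M[R]_e) (x : X) : 'M[R]_d :=
  mdiff f x *m w (f x) *m (mdiff f x)^T.

Definition chart1 (R : realType) (d : nat) (X : manifold R d) (i : chart X)
    (b : X -> 'cV[R]_d) : 'rV[R]_d -> 'cV[R]_d :=
  @pull1 R d d (euclid R d) X (@param R d X i) b.

Definition chart2 (R : realType) (d : nat) (X : manifold R d) (i : chart X)
    (w : X -> 'M[R]_d) : 'rV[R]_d -> 'M[R]_d :=
  @pull2 R d d (euclid R d) X (@param R d X i) w.

Definition smooth_form1 (R : realType) (d : nat) (X : manifold R d)
    (V : set X) (b : X -> 'cV[R]_d) : Prop :=
  forall i : chart X, smooth_on (coord i @` (dom i `&` V)) (chart1 i b).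

Definition smooth_form2 (R : realType) (d : nat) (X : manifold R d)
    (V : set X) (w : X -> 'M[R]_d) : Prop :=
  forall i : chart X, smooth_on (coord i @` (dom i `&` V)) (chart2 i w).

Definition partial (R : realType) (d : nat) (a : 'I_d) (f : 'rV[R]_d -> R)
    (y : 'rV[R]_d) : R := 'D_(delta_mx 0 a) (f : 'rV[R]_d -> R^o) y.

Definition dfun (R : realType) (d : nat) (X : manifold R d) (g : X -> R)
    (x : X) : 'cV[R]_d :=
  \col_a partial a (g \o param (at_chart x)) (coord (at_chart x) x).

Definition dform (R : realType) (d : nat) (X : manifold R d)
    (b : X -> 'cV[R]_d) (x : X) : 'M[R]_d :=
  let B := chart1 (at_chart x) b in
  let y := coord (at_chart x) x in
  \matrix_(a, c) (partial a (fun z => B z c 0) y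
                  - partial c (fun z => B z a 0) y).

Definition closed_form2 (R : realType) (d : nat) (X : manifold R d)
    (w : X -> 'M[R]_d) : Prop :=
  forall (x : X) (a b c : 'I_d),
    let B := chart2 (at_chart x) w in
    let y := coord (at_chart x) x in
    partial a (fun z => B z b c) y + partial b (fun z => B z c a) y
      + partial c (fun z => B z a b) y = 0.

(* g^{-1} dg = i * dlog g for a U(1)-valued function g. *)
Definition dlog (R : realType) (d : nat) (X : manifold R d) (g : X -> R[i])
    (x : X) : 'cV[R]_d :=
  complex.Re (g x) *: dfun (fun z => complex.Im (g z)) x
  - complex.Im (g x) *: dfun (fun z => complex.Re (g z)) x.

Definition smooth_U1 (R : realType) (d : nat) (X : manifold R d)
    (V : set X) (g : X -> R[i]) : Prop :=
  smooth_cfun V g /\ forall x, V x -> `|g x| = 1.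

Definition simply_connected (R : realType) (T : topologicalType) : Prop :=
  [set: T] !=set0 /\
  (forall x y : T, exists c : R -> T,
     [/\ continuous c, c 0 = x & c 1 = y]) /\
  (forall c : R -> T, continuous c -> c 0 = c 1 ->
     exists H : R * R -> T,
       [/\ continuous H,
           (forall t, 0 <= t <= 1 -> H (0, t) = c t),
           (forall t, 0 <= t <= 1 -> H (1, t) = c 0) &
           (forall s, 0 <= s <= 1 -> H (s, 0) = c 0 /\ H (s, 1) = c 0)]).

Definition symplectic (R : realType) (m : nat) (M : manifold R m)
    (om : M -> 'M[R]_m) : Prop :=
  [/\ smooth_form2 setT om,
      (forall p, (om p)^T = - om p),
      (forall p, om p \in unitmx) &
      closed_form2 om].

(* An almost complex structure acts on row vectors: I v = v *m J p. *)
Definition smooth_endo (R : realType) (m : nat) (M : manifold R m)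
    (J : M -> 'M[R]_m) : Prop :=
  forall i : chart M, smooth_on (coord i @` dom i)
    (fun y => dparam i y *m J (param i y) *m invmx (dparam i y)).

Definition metric (R : realType) (m : nat) (M : manifold R m)
    (om J : M -> 'M[R]_m) (p : M) : 'M[R]_m := om p *m (J p)^T.

Definition compatible (R : realType) (m : nat) (M : manifold R m)
    (om J : M -> 'M[R]_m) : Prop :=
  [/\ smooth_endo J,
      (forall p, J p *m J p = - 1%:M),
      (forall p, J p *m om p *m (J p)^T = om p) &
      (forall p (v : 'rV[R]_m), v != 0 ->
         0 < (v *m metric om J p *m v^T) 0 0)].

Definition embedding (R : realType) (d e : nat) (S : manifold R d)
    (M : manifold R e) (iota : S -> M) : Prop :=
  [/\ smooth_map setT iota,
      (forall s, row_free (mdiff iota s)),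
      injective iota &
      (forall U : set S, open U ->
         exists2 W : set M, open W & U = iota @^-1` W)].

Definition lagrangian (R : realType) (n : nat) (M : manifold R n.*2)
    (om : M -> 'M[R]_(n.*2)) (S : manifold R n) (iota : S -> M) : Prop :=
  embedding iota /\ forall s, pull2 iota om s = 0.

(* o s = ±1 is the sign of the basis of T_sS given by the preferred chart at s;
   the sign of the coordinate basis of any chart is then locally constant. *)
Definition orientation (R : realType) (d : nat) (S : manifold R d)
    (o : S -> R) : Prop :=
  (forall s, o s = 1 \/ o s = -1) /\
  (forall (i : chart S) s, dom i s ->
     \forall s' \near s, o s' * Num.sg (\det (dcoord i s'))
                         = o s * Num.sg (\det (dcoord i s))).

(* Ambient space of the fibres: n-tensors of T_pM ⊗ C. *)
Definition multivec (R : realType) (n : nat) : Type :=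
  {ffun {ffun 'I_n -> 'I_(n.*2)} -> R[i]}.

Definition realmx (R : realType) (a b : nat) (A : 'M[R]_(a, b)) :
    'M[R[i]]_(a, b) := map_mx (fun x : R => x%:C) A.

(* v |-> (v - i I v) / 2, the isomorphism (T_pM, I) -> T^{1,0}_pM. *)
Definition type10 (R : realType) (r m : nat) (Jp : 'M[R]_m) (E : 'M[R]_(r, m)) :
    'M[R[i]]_(r, m) := 2^-1 *: (realmx E - 'i *: realmx (E *m Jp)).

(* v_1 ∧ ... ∧ v_n, for v_1, ..., v_n the rows of E, as the antisymmetric
   tensor of its n x n minors in Λ^n T^{1,0}_pM. *)
Definition wedge (R : realType) (n : nat) (Jp : 'M[R]_(n.*2))
    (E : 'M[R]_(n, n.*2)) : multivec R n :=
  [ffun L : {ffun 'I_n -> 'I_(n.*2)} =>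
     \det (\matrix_(a, b) type10 Jp E a (L b))].

(* H = G - i ω, complex linear in its first argument. *)
Definition hermitian (R : realType) (m : nat) (M : manifold R m)
    (om J : M -> 'M[R]_m) (p : M) : 'M[R[i]]_m :=
  realmx (metric om J p) - 'i *: realmx (om p).

(* Unit vectors of K^{-1}_p, for h(v_1 ∧ ... ∧ v_n) = det (H(v_a, v_b)). *)
Definition unit_vector (R : realType) (n : nat) (M : manifold R n.*2)
    (om J : M -> 'M[R]_(n.*2)) (p : M) (s : multivec R n) : Prop :=
  exists (c : R[i]) (E : 'M[R]_(n, n.*2)),
    s = [ffun L => c * wedge (J p) E L] /\
    `|c| ^+ 2 * \det (realmx E *m hermitian om J p *m (realmx E)^T) = 1.

(* Smooth unit sections of f^*K^{-1} over the open set W of X; only the values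
   of [s] on W matter. *)
Definition unit_section (R : realType) (n d : nat) (M : manifold R n.*2)
    (om J : M -> 'M[R]_(n.*2)) (X : manifold R d) (f : X -> M) (W : set X)
    (s : X -> multivec R n) : Prop :=
  [/\ open W,
      (forall x, W x -> unit_vector om J (f x) (s x)) &
      (forall x, W x -> exists (V : set X) (c : X -> R[i])
                               (E : X -> 'M[R]_(n, n.*2)),
         [/\ open V, V x, smooth_cfun V c, smooth_along f V E &
             forall y, V y -> s y = [ffun L => c y * wedge (J (f y)) (E y) L]])].

(* A Hermitian connection ∇ on f^*K^{-1} over the open set V of X is encoded by
   its connection forms in all local unit sections: ∇ s = i * A s ⊗ s with
   A s a real 1-form. The u(1)-valued forms of the theory are thus i times
   the real forms used here. *)
Definition connection (R : realType) (n d : nat) (X : Type) : Type :=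
  (X -> multivec R n) -> X -> 'cV[R]_d.

Definition hermitian_connection (R : realType) (n d : nat)
    (M : manifold R n.*2) (om J : M -> 'M[R]_(n.*2)) (X : manifold R d)
    (f : X -> M) (V : set X) (A : connection R n d X) : Prop :=
  forall (W : set X) (s : X -> multivec R n),
    W `<=` V -> unit_section om J f W s ->
    smooth_form1 W (A s) /\
    (forall (g : X -> R[i]) (t : X -> multivec R n), smooth_U1 W g ->
       (forall x, W x -> t x = [ffun L => g x * s x L]) ->
       forall x, W x -> A t x = A s x + dlog g x).

(* The curvature of A is i * F on Z. *)
Definition has_curvature (R : realType) (n d : nat)
    (M : manifold R n.*2) (om J : M -> 'M[R]_(n.*2)) (X : manifold R d)
    (f : X -> M) (V Z : set X) (A : connection R n d X) (F : X -> 'M[R]_d) :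
    Prop :=
  forall (W : set X) (s : X -> multivec R n),
    W `<=` V -> unit_section om J f W s ->
    forall x, W x -> Z x -> dform (A s) x = F x.

(* The pullback by phi of a connection A on f^*K^{-1}: the unique connection on
   (f \o phi)^*K^{-1} with (phi^*∇)(s \o phi) = phi^*(∇ s). *)
Definition pullback (R : realType) (n d e : nat)
    (M : manifold R n.*2) (om J : M -> 'M[R]_(n.*2)) (X : manifold R d)
    (f : X -> M) (Y : manifold R e) (phi : Y -> X) (A : connection R n d X) :
    connection R n e Y :=
  fun (t : Y -> multivec R n) (y : Y) =>
    xget 0 [set b : 'cV[R]_e |
      exists (W : set X) (s : X -> multivec R n) (V : set Y) (g : Y -> R[i]),
        [/\ unit_section om J f W s, W (phi y),
            open V /\ V y, smooth_U1 V g &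
            (forall z, V z -> W (phi z) ->
               t z = [ffun L => g z * s (phi z) L]) /\
            b = pull1 phi (A s) y + dlog g y]].

(* i * connection_diff A B = A - B, the global difference form of two
   connections on f^*K^{-1}. *)
Definition connection_diff (R : realType) (n d : nat)
    (M : manifold R n.*2) (om J : M -> 'M[R]_(n.*2)) (X : manifold R d)
    (f : X -> M) (A B : connection R n d X) (x : X) : 'cV[R]_d :=
  xget 0 [set b : 'cV[R]_d |
    exists (W : set X) (s : X -> multivec R n),
      [/\ unit_section om J f W s, W x & b = A s x - B s x]].

(* c_1(K^{-1}) = [i F / 2π] in de Rham cohomology, for the curvature F of any
   Hermitian connection A; so c_1 = k [ω] iff i F / 2π = k ω + db for some b,
   that is F = i * (- 2π (k ω + db)). *)
Definition pseudo_einstein (R : realType) (n : nat) (M : manifold R n.*2)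
    (om : M -> 'M[R]_(n.*2)) (k : R) : Prop :=
  exists (J : M -> 'M[R]_(n.*2)) (A : connection R n n.*2 M)
         (b : M -> 'cV[R]_(n.*2)),
    [/\ compatible om J,
        hermitian_connection om J idfun setT A,
        smooth_form1 setT b &
        has_curvature om J idfun setT setT A
          (fun p => - (2 * pi) *: (k *: om p + dform b p))].

(* F_a = - 2π i k ω. *)
Definition reference_connection (R : realType) (n : nat) (M : manifold R n.*2)
    (om J : M -> 'M[R]_(n.*2)) (k : R) (a : connection R n n.*2 M) : Prop :=
  hermitian_connection om J idfun setT a /\
  has_curvature om J idfun setT setT a (fun p => - (2 * pi * k) *: om p).

Definition restrict (R : realType) (n : nat) (M : manifold R n.*2)
    (om J : M -> 'M[R]_(n.*2)) (S : manifold R n) (iota : S -> M)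
    (a : connection R n n.*2 M) : connection R n n S :=
  pullback om J (idfun : M -> M) iota a.

Definition pt1 (R : realType) (t : R) : euclid R 1 := \row_(_ < 1) t.

Definition pt2 (R : realType) (x y : R) : euclid R 2 :=
  \row_(b < 2) (if b == 0 :> nat then x else y).

Definition smooth_loop (R : realType) (d : nat) (S : manifold R d)
    (gamma : euclid R 1 -> S) : Prop :=
  smooth_map setT gamma /\
  forall t : R, gamma (pt1 (t + 2 * pi)) = gamma (pt1 t).

(* The counterclockwise boundary of the closed unit disc. *)
Definition circle (R : realType) (x : euclid R 1) : euclid R 2 :=
  pt2 (cos ((x : 'rV[R]_1) 0 0)) (sin ((x : 'rV[R]_1) 0 0)).

Definition unit_disc (R : realType) : set (R * R) :=
  [set z | z.1 ^+ 2 + z.2 ^+ 2 <= 1].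

Definition closed_disc (R : realType) : set (euclid R 2) :=
  [set pt2 z.1 z.2 | z in @unit_disc R].

Definition loop_integral (R : realType) (b : euclid R 1 -> 'cV[R]_1) : R :=
  \int[@lebesgue_measure R]_(t in `[0, 2 * pi]) (b (pt1 t) 0 0).

Definition disc_integral (R : realType) (w : euclid R 2 -> 'M[R]_2) : R :=
  \int[(@lebesgue_measure R \x @lebesgue_measure R)%E]_(z in @unit_disc R)
     (w (pt2 z.1 z.2) 0 1).

(* Smooth maps of the closed disc are those which extend smoothly to an open
   neighbourhood V of it. *)
Definition smooth_disc (R : realType) (m : nat) (M : manifold R m)
    (V : set (euclid R 2)) (u : euclid R 2 -> M) : Prop :=
  [/\ open V, @closed_disc R `<=` V & smooth_map V u].

(* The restriction to S of a reference connection has trivial holonomy: every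
   unit section along a loop which is parallel closes up. *)
Definition bohr_sommerfeld (R : realType) (n : nat) (M : manifold R n.*2)
    (om : M -> 'M[R]_(n.*2)) (k : R) (S : manifold R n) (iota : S -> M) : Prop :=
  exists (J : M -> 'M[R]_(n.*2)) (a : connection R n n.*2 M),
    [/\ compatible om J, reference_connection om J k a &
        forall (gamma : euclid R 1 -> S) (s : euclid R 1 -> multivec R n),
          smooth_loop gamma ->
          unit_section om J (iota \o gamma) setT s ->
          (forall x, pullback om J iota gamma (restrict om J iota a) s x = 0) ->
          s (pt1 (2 * pi)) = s (pt1 0)].

(* e_1 ∧ ... ∧ e_n is parallel for every local oriented G-orthonormal frame
   of TS, here the rows of E. *)
Definition canonical_trivial (R : realType) (n : nat) (M : manifold R n.*2)
    (om J : M -> 'M[R]_(n.*2)) (S : manifold R n) (iota : S -> M) (o : S -> R)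
    (A0 : connection R n n S) : Prop :=
  hermitian_connection om J iota setT A0 /\
  forall (W : set S) (E : S -> 'M[R]_n), open W ->
    smooth_along idfun W E ->
    (forall s, W s ->
       E s *m pull2 iota (metric om J) s *m (E s)^T = 1%:M /\
       0 < o s * \det (E s)) ->
    forall s, W s -> A0 (fun z => wedge (J (iota z)) (E z *m mdiff iota z)) s = 0.

(* a|_S - A_0 = g^{-1} dg. *)
Definition maslov_gauge (R : realType) (n : nat) (M : manifold R n.*2)
    (om J : M -> 'M[R]_(n.*2)) (S : manifold R n) (iota : S -> M)
    (a : connection R n n.*2 M) (A0 : connection R n n S) (g : S -> R[i]) :
    Prop :=
  smooth_U1 setT g /\
  forall s, connection_diff om J iota (restrict om J iota a) A0 s = dlog g s.

(* The degree of a 2π-periodic map R -> U(1). *)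
Definition degree (R : realType) (c : R -> R[i]) : int :=
  xget 0 [set D : int | exists theta : R -> R,
    [/\ continuous theta,
        (forall t, c t = cos (theta t) +i* sin (theta t)) &
        theta (2 * pi) - theta 0 = 2 * pi * D%:~R]].

(* The value on the class of [gamma] of g^* h, with h the positive generator
   of H^1(U(1), Z). *)
Definition maslov_class (R : realType) (d : nat) (S : manifold R d)
    (g : S -> R[i]) (gamma : euclid R 1 -> S) : int :=
  degree (fun t => g (gamma (pt1 t))).

Definition maslov_index (R : realType) (n : nat) (M : manifold R n.*2)
    (om J : M -> 'M[R]_(n.*2)) (S : manifold R n) (iota : S -> M)
    (A0 : connection R n n S) (gamma : euclid R 1 -> S)
    (u : euclid R 2 -> M) (Af : connection R n 2 (euclid R 2)) : R :=
  (2 * pi)^-1 *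
  loop_integral (connection_diff om J (iota \o gamma)
    (pullback om J u (@circle R) Af) (pullback om J iota gamma A0)).

(* Main.v *)
(** Write [i b] for the difference [A_f - u^*a] of the two connections on
    [u^*K^{-1}]; [b] is a global real 1-form near the disc, and the curvature
    hypotheses give [db = 2 pi k u^*om]. On the boundary circle,
    [A_f - A_0 = (A_f - u^*a) + (a - A_0)], and [a - A_0] is [i dlog gS] on [S],
    so the connection difference defining the Maslov index is
    [circle^* b + dlog (gS o gamma)]. The first term integrates to
    [2 pi k] times the area by Stokes' theorem, the second to [2 pi] times the
    degree of [gS o gamma]. All connections are compared in the pullbacks of one
    local unit section of [K^{-1}] over [M]. *)
Require Import Defs.
From HB Require Import structures.
From mathcomp Require Import all_boot all_order all_algebra.
From mathcomp Require Import all_classical all_reals all_analysis.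
From mathcomp Require Import complex.
From mathcomp Require Import ring lra.

(* [coord] is the chart map of [Defs], not the coordinate function of [vector]. *)
Import Defs.

Set Implicit Arguments.
Unset Strict Implicit.
Unset Printing Implicit Defensive.

Import Order.TTheory GRing.Theory Num.Theory.
Import numFieldNormedType.Exports.

Local Open Scope classical_set_scope.
Local Open Scope ring_scope.

(** * Smooth functions on open subsets of R^d *)

Section ck_calculus.
Variable R : realType.

(** [pullback] and [connection_diff] are values picked by [xget] from a set with candidates from
    every local unit section, so they can be computed only once that set is known to be a singleton.
    This rests on one fact: two local unit sections differ by a smooth U(1)-valued function.
    Hermitian linear algebra enters here, because [unit_vector] normalizes only some representation
    of a vector, and the transition function is seen to be smooth by recognizing it as the Hermitian
    product of the two sections, a determinant of smooth Gram entries. The sign in the formula for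
    $db$: the flat [Af] contributes 0, the reference connection contributes $-2\pi k\omega$, and the
    latter is subtracted. Since [Af] is flat only over the closed disc, the formula holds there,
    while $b$ is smooth on the neighbourhood [V]. Stokes' theorem on the disc is obtained from
    one-variable calculus: Fubini cuts the disc into chords, and comparing primitives takes the
    place of a change of variables on the circle. *)

Lemma near_eq_differentiable (V W : normedModType R) (f g : V -> W) (x : V) :
  (\near x, f x = g x) -> differentiable f x -> differentiable g x.
Proof.
move=> fg df.
have -> : g = f + (g - f) by rewrite addrC subrK.
apply: differentiableD => //.
set e := g - f.
have e0 : e x = 0 by rewrite /e !fctE (nbhs_singleton fg) subrr.
(* The difference [e] vanishes near [x], so the zero map serves as its differential. *)
have eq : e \o shift x = cst (e x) + (\0 : {linear V -> W}) +o_ 0 id.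
  apply/eqaddoP => _/posnumP[eps]; rewrite near_simpl.
  have : \forall h \near 0, f (h + x) = g (h + x).
    by move: fg; rewrite (near_shift 0) /=; apply: filterS => h /=; rewrite subr0.
  apply: filterS => h /= fgh.
  rewrite [X in `|X|](_ : _ = 0) ?normr0 ?mulr_ge0 //.
  by rewrite e0 /e !fctE /= fgh !subrr /cst /= addr0 subrr.
have c0 : continuous (\0 : {linear V -> W}) by move=> ?; exact: cst_continuous.
by apply/diff_locallyP; rewrite (diff_unique c0 eq); split.
Qed.

Lemma open_near_eq (T : topologicalType) (Y : Type) (U : set T) (f g : T -> Y) x :
  open U -> (forall y, U y -> f y = g y) -> U x -> \near x, f x = g x.
Proof.
move=> oU fg Ux; have : nbhs x U by exact: open_nbhs_nbhs.
by apply: filterS.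
Qed.

(** Openness of [U] lets equality on [U] pass to continuity and to directional derivatives, which
    see the values near a point. *)
Lemma Ck_ext (d : nat) (W : normedModType R) k (U : set 'rV[R]_d)
    (f g : 'rV[R]_d -> W) :
  open U -> (forall x, U x -> f x = g x) -> Ck k U f -> Ck k U g.
Proof.
move=> oU; elim: k f g => [|k IH] f g fg /=.
  move=> cf x Ux; have nfg := open_near_eq oU fg Ux.
  rewrite /prop_for /continuous_at -(fg _ Ux).
  apply: cvg_trans (cf _ Ux); apply: near_eq_cvg; first exact: (nbhs_filter x).
  exact: nfg.
move=> [df Df]; split=> [x Ux|v].
  exact: near_eq_differentiable (open_near_eq oU fg Ux) (df _ Ux).
apply: (IH _ _ _ (Df v)) => x Ux.
exact: near_eq_derive (open_near_eq oU fg Ux).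
Qed.

Lemma Ck_sub (d : nat) (W : normedModType R) k (U U' : set 'rV[R]_d)
    (f : 'rV[R]_d -> W) : U' `<=` U -> Ck k U f -> Ck k U' f.
Proof.
move=> UU; elim: k f => [|k IH] f /=; first by move=> cf x /UU /cf.
by move=> [df Df]; split=> [x /UU /df //|v]; exact: IH.
Qed.

Lemma Ck_pred (d : nat) (W : normedModType R) k (U : set 'rV[R]_d)
    (f : 'rV[R]_d -> W) : Ck k.+1 U f -> Ck k U f.
Proof.
elim: k f => [|k IH] f [df Df]; first by move=> x /df /differentiable_continuous.
by split => // v; exact: IH.
Qed.

Section scalar.
Variables (d : nat) (U : set 'rV[R]_d).
Hypothesis oU : open U.
Implicit Types f g : 'rV[R]_d -> R^o.

Lemma CkD k f g : Ck k U f -> Ck k U g -> Ck k U (fun x => f x + g x).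
Proof.
elim: k f g => [|k IH] f g /=; first by move=> cf cg x Ux; apply: continuousD;
    [exact: cf|exact: cg].
move=> [df Df] [dg Dg]; split=> [x Ux|v].
  by apply: differentiableD; [exact: df|exact: dg].
apply: (Ck_ext oU _ (IH _ _ (Df v) (Dg v))) => x Ux /=.
by rewrite -deriveD //; apply: diff_derivable; [exact: df|exact: dg].
Qed.

Lemma CkM k f g : Ck k U f -> Ck k U g -> Ck k U (fun x => f x * g x).
Proof.
elim: k f g => [|k IH] f g /=.
  by move=> cf cg x Ux; apply: (@continuousM R); [exact: cf|exact: cg].
move=> [df Df] [dg Dg]; split=> [x Ux|v].
  by apply: differentiableM; [exact: df|exact: dg].
have cf : Ck k U f by exact: Ck_pred.
have cg : Ck k U g by exact: Ck_pred.
apply: (Ck_ext oU _ (CkD (IH _ _ cf (Dg v)) (IH _ _ cg (Df v)))) => x Ux /=.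
by rewrite (@deriveM R _ f g) //; apply: diff_derivable; [exact: df|exact: dg].
Qed.

Lemma Ck_cst k (c : R^o) : Ck k U (fun=> c).
Proof. exact: smooth_on_cst. Qed.

Lemma CkN k f : Ck k U f -> Ck k U (fun x => - f x).
Proof.
move=> cf; apply: (Ck_ext oU _ (CkM (Ck_cst k (-1)) cf)) => x _ /=.
by rewrite mulN1r.
Qed.

Lemma CkB k f g : Ck k U f -> Ck k U g -> Ck k U (fun x => f x - g x).
Proof. by move=> cf cg; apply: CkD => //; exact: CkN. Qed.

Lemma Ck_sum k (I : Type) (r : seq I) (P : pred I) (F : I -> 'rV[R]_d -> R^o) :
  (forall i, P i -> Ck k U (F i)) -> Ck k U (fun x => \sum_(i <- r | P i) F i x).
Proof.
move=> cF; elim: r => [|i r IH].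
  by apply: (Ck_ext oU _ (Ck_cst k 0)) => x _; rewrite big_nil.
case Pi: (P i).
  by apply: (Ck_ext oU _ (CkD (cF _ Pi) IH)) => x _; rewrite big_cons Pi.
by apply: (Ck_ext oU _ IH) => x _; rewrite big_cons Pi.
Qed.

(** The derivative $-(1/f)^2 f'$ involves the inverse only at the lower order, so the induction on
    [k] closes. *)
Lemma CkV k f : (forall x, U x -> f x != 0) -> Ck k U f -> Ck k U (fun x => (f x)^-1).
Proof.
move=> f0; elim: k => [|k IH] /=.
  by move=> cf x Ux; apply: (@continuousV R); [exact: f0|exact: cf].
move=> cf; have [df Df] := cf; split=> [x Ux|v].
  by apply: differentiableV; [exact: df|exact: f0].
have cV := IH (Ck_pred cf).
apply: (Ck_ext oU _ (CkN (CkM (CkM cV cV) (Df v)))) => x Ux /=.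
rewrite (@deriveV R _ f) ?f0 //; last by apply: diff_derivable; exact: df.
by rewrite -exprVn expr2 /GRing.scale /= mulNr.
Qed.

End scalar.

(** Feeds the one-variable derivatives of [sqrt], [cos] and [sin] into directional derivatives: the
    differential of [h] at [f x] is multiplication by [dh]. *)
Lemma differentiable_comp1 (V : normedModType R) (h : R -> R) (f : V -> R^o) x (dh : R) :
  is_derive (f x : R) (1:R) h dh -> differentiable f x ->
  differentiable (fun y => h (f y) : R^o) x /\
  forall v, 'D_v (fun y => h (f y) : R^o) x = dh * 'D_v f x.
Proof.
move=> hd df.
have dh' : differentiable (h : R -> R^o) (f x).
  by apply/derivable1_diffP; exact: ex_derive.
have dc := differentiable_comp df dh'.
split=> // v.
rewrite (deriveE v dc) (diff_comp df dh') /= -(deriveE v df).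
have -> : 'd (h : R -> R^o) (f x) ('D_v f x) = 'D_v f x * 'd (h : R -> R^o) (f x) 1.
  by rewrite -[in LHS](mulr1 ('D_v f x)) -[_ * 1]/(_ *: 1) linearZ.
by rewrite -deriveE // mulrC; congr (_ * _); exact: derive_val.
Qed.

Lemma Ck_sqrt (d : nat) (U : set 'rV[R]_d) k (f : 'rV[R]_d -> R^o) : open U ->
  (forall x, U x -> 0 < f x) -> Ck k U f -> Ck k U (fun x => Num.sqrt (f x) : R^o).
Proof.
move=> oU f0; elim: k => [|k IH] /=.
  move=> cf x Ux; apply: (@continuous_comp _ _ _ f (@Num.sqrt R)); first exact: cf.
  exact: sqrt_continuous.
move=> cf; have [df Df] := cf.
have H x : U x -> _ := fun Ux => differentiable_comp1 (is_derive1_sqrt (f0 x Ux)) (df _ Ux).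
split=> [x Ux|v]; first by case: (H _ Ux).
have cs := IH (Ck_pred cf).
have cV : Ck k U (fun x => (2 * Num.sqrt (f x))^-1 : R^o).
  apply: CkV => //; last by apply: CkM => //; exact: Ck_cst.
  by move=> x Ux; rewrite mulf_neq0 // gt_eqF // sqrtr_gt0 f0.
apply: (Ck_ext oU _ (CkM oU cV (Df v))) => x Ux /=.
by case: (H _ Ux) => _ ->.
Qed.

(** The two are treated together because each occurs in the derivative of the other. *)
Lemma Ck_cos_sin (d : nat) (U : set 'rV[R]_d) k (f : 'rV[R]_d -> R^o) : open U ->
  Ck k U f -> Ck k U (fun x => cos (f x) : R^o) /\ Ck k U (fun x => sin (f x) : R^o).
Proof.
move=> oU; elim: k => [|k IH] /=.
  move=> cf; split => x Ux.
    by apply: (@continuous_comp _ _ _ f (@cos R)); [exact: cf|exact: continuous_cos].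
  by apply: (@continuous_comp _ _ _ f (@sin R)); [exact: cf|exact: continuous_sin].
move=> cf; have [df Df] := cf.
have Hc x : U x -> _ := fun Ux => differentiable_comp1 (is_derive_cos (f x)) (df _ Ux).
have Hs x : U x -> _ := fun Ux => differentiable_comp1 (is_derive_sin (f x)) (df _ Ux).
have [cc cs] := IH (Ck_pred cf).
split; split.
- by move=> x /Hc [].
- move=> v; apply: (Ck_ext oU _ (CkM oU (CkN oU cs) (Df v))) => x Ux /=.
  by case: (Hc _ Ux) => _ ->.
- by move=> x /Hs [].
- move=> v; apply: (Ck_ext oU _ (CkM oU cc (Df v))) => x Ux /=.
  by case: (Hs _ Ux) => _ ->.
Qed.

Lemma differentiable_mxP (V : normedModType R) (r m : nat) (F : V -> 'M[R]_(r, m)) x :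
  differentiable F x <-> forall i j, differentiable (fun y => F y i j : R^o) x.
Proof.
split=> [dF i j|dF].
  apply: (@differentiable_comp _ _ _ _ F (fun N : 'M[R]_(r, m) => N i j : R^o)) => //.
  exact: differentiable_coord.
have -> : F = \sum_(i < r) \sum_(j < m) (fun y => F y i j *: delta_mx i j).
  apply/funext => y; rewrite fct_sumE [LHS]matrix_sum_delta; apply: eq_bigr => i _.
  by rewrite fct_sumE.
apply: (@differentiable_sum _ _ _ r (fun i => \sum_(j < m) (fun y => F y i j *: delta_mx i
    j))) => i.
apply: (@differentiable_sum _ _ _ m (fun j => (fun y => F y i j *: delta_mx i j))) => j.
exact: differentiableZl.
Qed.

(** The base case uses that the matrix norm is the maximum over finitely many entries; derivatives
    are entrywise, which gives the induction step. *)
Lemma Ck_mxP (d r m : nat) (U : set 'rV[R]_d) k (F : 'rV[R]_d -> 'M[R]_(r, m)) : open U ->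
  Ck k U F <-> forall i j, Ck k U (fun x => F x i j : R^o).
Proof.
move=> oU; elim: k F => [|k IH] F /=.
  split=> [cF i j x Ux|cF x Ux].
    apply: (@continuous_comp _ _ _ F (fun N : 'M[R]_(r, m) => N i j)); first exact: cF.
    exact: matrix_normedtype.coord_continuous.
  rewrite /prop_for /continuous_at.
  apply/(@cvgrPdist_le _ _ _ (nbhs x) (nbhs_filter x) F (F x)) => e e0.
  have : \forall y \near x, forall i : 'I_r * 'I_m, `|F x i.1 i.2 - F y i.1 i.2| <= e.
    apply: (@filter_forall _ _ (fun (i : 'I_r * 'I_m) y => `|F x i.1 i.2 - F y i.1 i.2| <=
        e) (nbhs x) (nbhs_filter x)).
    move=> i.
    by have /cvgrPdist_le := cF i.1 i.2 _ Ux; apply.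
  apply: filterS => y H.
  rewrite [leLHS]/Num.Def.normr/= mx_normrE (bigmax_le _ (ltW e0))//= => i _.
  by rewrite !mxE; exact: H.
split=> [[dF DF] i j|cF].
  split=> [x Ux|v]; first by apply: (differentiable_mxP _ _).1; exact: dF.
  have /IH/(_ i j) := DF v.
  apply: Ck_ext => // x Ux; rewrite derive_mx ?mxE //.
  by apply: diff_derivable; exact: dF.
have dF x : U x -> differentiable F x.
  by move=> Ux; apply/differentiable_mxP => i j; case: (cF i j) => + _; apply.
split=> [//|v]; apply/IH => i j.
case: (cF i j) => _ /(_ v); apply: Ck_ext => // x Ux.
by rewrite derive_mx ?mxE //; apply: diff_derivable; exact: dF.
Unshelve. all: by end_near. Qed.

Lemma derive_comp_rV (d e : nat) (W : normedModType R) (f : 'rV[R]_d -> 'rV[R]_e)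
    (g : 'rV[R]_e -> W) x v :
  differentiable f x -> differentiable g (f x) ->
  'D_v (g \o f) x = \sum_(j < e) ('D_v (fun y => f y 0 j : R^o) x) *: 'D_(delta_mx 0 j) g (f x).
Proof.
move=> df dg; rewrite deriveE; last exact: differentiable_comp.
rewrite diff_comp //= -(deriveE _ df) derive_mx; last exact: diff_derivable.
rewrite [X in 'd g (f x) X]row_sum_delta linear_sum /=; apply: eq_bigr => j _.
by rewrite linearZ /= mxE -deriveE.
Qed.

(** By the chain rule a derivative of [g \o f] is a sum of products of a derivative of a coordinate
    of [f] and a partial derivative of [g] composed with [f]; so the induction keeps [f] and varies
    [g]. *)
Lemma Ck_comp_scalar (d e : nat) (U : set 'rV[R]_d) (U' : set 'rV[R]_e) k
    (f : 'rV[R]_d -> 'rV[R]_e) (g : 'rV[R]_e -> R^o) : open U ->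
  (forall x, U x -> U' (f x)) -> Ck k U f -> Ck k U' g -> Ck k U (g \o f).
Proof.
move=> oU UU; elim: k g => [|k IH] g cf cg.
  move=> x Ux; apply: continuous_comp; [exact: cf|exact/cg/UU].
have [df Df] := cf; have [dg Dg] := cg.
split=> [x Ux|v].
  by apply: differentiable_comp; [exact: df|exact/dg/UU].
have /(Ck_ext oU) : forall x, U x ->
   \sum_(j < e) ('D_v (fun y => f y 0 j : R^o) x) * ('D_(delta_mx 0 j) g \o f) x
   = 'D_v (g \o f) x.
  by move=> x Ux; rewrite derive_comp_rV //; [exact: df|exact/dg/UU].
apply; apply: Ck_sum => // j _; apply: CkM => //.
  by have /(Ck_mxP k.+1 f oU)/(_ 0 j) [_] := cf; apply.
by apply: IH => //; [exact: Ck_pred cf|exact: Dg].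
Qed.

Lemma Ck_comp (d e r m : nat) (U : set 'rV[R]_d) (U' : set 'rV[R]_e) k
    (f : 'rV[R]_d -> 'rV[R]_e) (g : 'rV[R]_e -> 'M[R]_(r, m)) : open U -> open U' ->
  (forall x, U x -> U' (f x)) -> Ck k U f -> Ck k U' g -> Ck k U (g \o f).
Proof.
move=> oU oU' UU cf /Ck_mxP cg; apply/Ck_mxP => // i j.
exact: (Ck_comp_scalar (g := fun x => g x i j) oU UU cf (cg oU' i j)).
Qed.

Lemma Ck_mulmx (d r m p : nat) (U : set 'rV[R]_d) k (F : 'rV[R]_d -> 'M[R]_(r, m))
   (G : 'rV[R]_d -> 'M[R]_(m, p)) : open U ->
  Ck k U F -> Ck k U G -> Ck k U (fun x => F x *m G x).
Proof.
move=> oU /Ck_mxP cF /Ck_mxP cG; apply/Ck_mxP => // i j.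
have : Ck k U (fun x => \sum_l F x i l * G x l j : R^o).
  by apply: Ck_sum => // l _; apply: CkM => //; [exact: cF|exact: cG].
by apply: Ck_ext => // x _; rewrite mxE.
Qed.

Lemma Ck_trmx (d r m : nat) (U : set 'rV[R]_d) k (F : 'rV[R]_d -> 'M[R]_(r, m)) : open U ->
  Ck k U F -> Ck k U (fun x => (F x)^T).
Proof.
move=> oU /Ck_mxP cF; apply/Ck_mxP => // i j.
have := cF oU j i.
by apply: Ck_ext => // x _; rewrite mxE.
Qed.

End ck_calculus.

(** * Smooth maps between manifolds *)

Section manifold_calculus.
Variable R : realType.

(** The sets [U'] need not be open: [Ck k U] is a condition on the germs of a total function at the
    points of [U]. *)
Lemma Ck_local (d : nat) (W : normedModType R) k (U : set 'rV[R]_d)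
    (f : 'rV[R]_d -> W) :
  (forall x, U x -> exists2 U' : set 'rV[R]_d, U' x & Ck k U' f) -> Ck k U f.
Proof.
elim: k f => [|k IH] f H /=.
  by move=> x /H [U' U'x]; apply.
split=> [x /H [U' U'x [df _]]|v]; first exact: df.
by apply: IH => x /H [U' U'x [_ Df]]; exists U' => //; exact: Df.
Qed.

Lemma chart_imageP (d : nat) (X : manifold R d) (i : chart X) (V : set X) y :
  (coord i @` (dom i `&` V)) y ->
  [/\ dom i (param i y), V (param i y) & coord i (param i y) = y].
Proof. by move=> [p [ip Vp] <-]; rewrite coordK. Qed.

(** Inside the open codomain of the chart, the image of [V] is its preimage under the continuous
    [param i]. *)
Lemma chart_image_open (d : nat) (X : manifold R d) (i : chart X) (V : set X) :
  open V -> open (coord i @` (dom i `&` V)).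
Proof.
move=> oV; rewrite openE => _ [p [ip Vp] <-].
have cy : (coord i @` dom i) (coord i p) by exists p.
have n1 : nbhs (coord i p) (coord i @` dom i).
  by apply: open_nbhs_nbhs; split => //; exact: codom_open.
have n2 : nbhs (coord i p) (param i @^-1` V).
  apply: (param_continuous cy); rewrite coordK //.
  exact: open_nbhs_nbhs.
apply: filterS (filterI n1 n2) => z [[q iq <-]] /=.
by rewrite /preimage /= coordK // => Vq; exists q.
Qed.

Lemma open_preimage_on (X Y : topologicalType) (f : X -> Y) (V : set X) (W : set Y) :
  open V -> open W -> (forall x, V x -> {for x, continuous f}) ->
  open (V `&` f @^-1` W).
Proof.
move=> oV oW cf; rewrite openE => x [Vx Wx]; apply: filterI.
  exact: open_nbhs_nbhs.
by apply: (cf _ Vx); exact: open_nbhs_nbhs.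
Qed.

Lemma smooth_fun_sub (d : nat) (X : manifold R d) (W : normedModType R)
    (V V' : set X) (g : X -> W) : V' `<=` V -> smooth_fun V g -> smooth_fun V' g.
Proof.
move=> VV sg i k; apply: Ck_sub (sg i k).
by apply: image_subset => x [ix /VV].
Qed.

Lemma smooth_fun_ext (d : nat) (X : manifold R d) (W : normedModType R)
    (V : set X) (g h : X -> W) : open V -> (forall x, V x -> g x = h x) ->
  smooth_fun V g -> smooth_fun V h.
Proof.
move=> oV gh sg i k; apply: Ck_ext (sg i k); first exact: chart_image_open.
by move=> y /chart_imageP [_ Vy _] /=; exact: gh.
Qed.

Lemma smooth_fun_mxP (d : nat) (X : manifold R d) (r m : nat)
    (V : set X) (g : X -> 'M[R]_(r, m)) : open V ->
  smooth_fun V g <-> forall a b, smooth_fun V (fun x => g x a b : R^o).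
Proof.
move=> oV; split=> [sg a b i k|sg i k].
  by have /Ck_mxP := sg i k; apply; exact: chart_image_open.
by apply/Ck_mxP => [|a b]; [exact: chart_image_open|exact: sg].
Qed.

Lemma smooth_fun_comp_scalar (d e : nat) (X : manifold R d) (Y : manifold R e)
    (V : set X) (f : X -> Y) (W : set Y) (g : Y -> R^o) :
  open V -> smooth_map V f -> open W -> smooth_fun W g ->
  smooth_fun (V `&` f @^-1` W) (g \o f).
Proof.
move=> oV [cf sf] oW sg i k; apply: Ck_local => _ [x [ix [Vx Wx]] <-].
set j := at_chart (f x).
(* On this open set [f] stays in the one chart [j], so [g \o f] is the coordinate expression of [g]
   after that of [f]. *)
have oD : open (V `&` f @^-1` (W `&` dom j)).
  by apply: open_preimage_on => //; apply: openI => //; exact: dom_open.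
have jfx : dom j (f x) by exact: at_chartP.
exists (coord i @` (dom i `&` (V `&` f @^-1` (W `&` dom j)))); first by exists x.
have := @Ck_comp_scalar R d e _ _ k (coord j \o f \o param i) (g \o param j)
  (chart_image_open (i := i) oD) _ _ (sg j k).
have oI := chart_image_open (i := i) oD.
move=> H; apply: (Ck_ext oI _ (H _ _)).
- by move=> y /chart_imageP [_ [_ [_ jy]] _] /=; rewrite coordK.
- by move=> y /chart_imageP [_ [_ [Wy jy]] _] /=; exists (f (param i y)).
- apply: Ck_sub (sf i j k); apply: image_subset => z [iz [Vz [_ jz]]].
  by split.
Qed.

Lemma smooth_fun_comp (d e r m : nat) (X : manifold R d) (Y : manifold R e)
    (V : set X) (f : X -> Y) (W : set Y) (g : Y -> 'M[R]_(r, m)) :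
  open V -> smooth_map V f -> open W -> smooth_fun W g ->
  smooth_fun (V `&` f @^-1` W) (g \o f).
Proof.
move=> oV sf oW /smooth_fun_mxP sg; apply/smooth_fun_mxP.
  by apply: open_preimage_on => //; case: sf.
move=> a b; exact: (smooth_fun_comp_scalar oV sf oW (sg oW a b)).
Qed.

(** Separates the charts of the source from those of the target, so that closure under composition
    is inherited from [smooth_fun]. *)
Lemma smooth_mapP (d e : nat) (X : manifold R d) (Y : manifold R e)
    (V : set X) (f : X -> Y) :
  smooth_map V f <-> (forall x, V x -> {for x, continuous f}) /\
    forall j : chart Y, smooth_fun (V `&` f @^-1` dom j) (coord j \o f).
Proof.
split=> -[cf sf]; split=> //.
  by move=> j i k; apply: Ck_sub (sf i j k); rewrite setIA.
by move=> i j k; apply: Ck_sub (sf j i k); rewrite setIA.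
Qed.

Lemma smooth_map_comp (d e h : nat) (X : manifold R d) (Y : manifold R e)
    (Z : manifold R h) (V : set X) (W : set Y) (f : X -> Y) (g : Y -> Z) :
  open V -> open W -> smooth_map V f -> smooth_map W g ->
  smooth_map (V `&` f @^-1` W) (g \o f).
Proof.
move=> oV oW sf /smooth_mapP [cg sg]; apply/smooth_mapP; split.
  move=> x [Vx Wx]; apply: continuous_comp; last exact: cg.
  by case: sf => + _; apply.
move=> j; have oWj : open (W `&` g @^-1` dom j).
  by apply: open_preimage_on => //; exact: dom_open.
have := smooth_fun_comp oV sf oWj (sg j).
by apply: smooth_fun_sub => x [[]].
Qed.

Lemma smooth_map_sub (d e : nat) (X : manifold R d) (Y : manifold R e)
    (V V' : set X) (f : X -> Y) : V' `<=` V -> smooth_map V f -> smooth_map V' f.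
Proof.
move=> VV /smooth_mapP [cf sf]; apply/smooth_mapP; split=> [x /VV|j]; first exact: cf.
by apply: smooth_fun_sub (sf j) => x [/VV].
Qed.

Lemma smooth_alongP (d e r : nat) (X : manifold R d) (Y : manifold R e)
    (V : set X) (f : X -> Y) (E : X -> 'M[R]_(r, e)) :
  smooth_along f V E <-> forall j : chart Y,
    smooth_fun (V `&` f @^-1` dom j) (fun x => E x *m dcoord j (f x)).
Proof.
split=> sE; first by move=> j i k; apply: Ck_sub (sE i j k); rewrite setIA.
by move=> i j k; apply: Ck_sub (sE j i k); rewrite setIA.
Qed.

Lemma smooth_along_comp (d e h r : nat) (X : manifold R d) (Y : manifold R e)
    (Z : manifold R h) (V : set X) (W : set Y) (f : X -> Y) (g : Y -> Z)
    (E : Y -> 'M[R]_(r, h)) :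
  open V -> open W -> smooth_map V f -> (forall y, W y -> {for y, continuous g}) ->
  smooth_along g W E -> smooth_along (g \o f) (V `&` f @^-1` W) (E \o f).
Proof.
move=> oV oW sf cg /smooth_alongP sE; apply/smooth_alongP => j.
have oWj : open (W `&` g @^-1` dom j).
  by apply: open_preimage_on => //; exact: dom_open.
have := smooth_fun_comp oV sf oWj (sE j).
by apply: smooth_fun_sub => x [[]].
Qed.

Lemma smooth_along_sub (d e r : nat) (X : manifold R d) (Y : manifold R e)
    (V V' : set X) (f : X -> Y) (E : X -> 'M[R]_(r, e)) : V' `<=` V ->
  smooth_along f V E -> smooth_along f V' E.
Proof.
move=> VV /smooth_alongP sE; apply/smooth_alongP => j.
by apply: smooth_fun_sub (sE j) => x [/VV].
Qed.

(** Once chart maps are smooth maps from and to [euclid], the matrices [dparam] and [dcoord] obey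
    the same chain rule as any differential. *)
Lemma smooth_param (d : nat) (X : manifold R d) (i : chart X) :
  @smooth_map R d d (euclid R d) X (coord i @` dom i) (@param R d X i).
Proof.
split=> [x|]; first exact: param_continuous.
move=> [] j k; apply: Ck_sub (transition_smooth i j k).
move=> y [z [[_ [p ip <-]] jz] <-]; exists p => //; split => //.
by move: jz; rewrite /preimage /= coordK.
Qed.

Lemma smooth_coord (d : nat) (X : manifold R d) (i : chart X) :
  @smooth_map R d d X (euclid R d) (dom i) (@coord R d X i).
Proof.
split=> [x|]; first exact: coord_continuous.
move=> j [] k; apply: Ck_sub (transition_smooth j i k).
by apply: image_subset => x [].
Qed.

(** Continuity is required separately: it keeps [f] near [x] inside the preferred chart at [f x],
    outside of which [coord] has arbitrary values. *)
Definition mdifferentiable (d e : nat) (X : manifold R d) (Y : manifold R e)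
    (f : X -> Y) (x : X) : Prop :=
  {for x, continuous f} /\
  differentiable (coord (at_chart (f x)) \o f \o param (at_chart x))
    (coord (at_chart x) x).

Lemma smooth_mdifferentiable (d e : nat) (X : manifold R d) (Y : manifold R e)
    (V : set X) (f : X -> Y) x : smooth_map V f -> V x -> mdifferentiable f x.
Proof.
move=> [cf sf] Vx; split; first exact: cf.
have [df _] := sf (at_chart x) (at_chart (f x)) 1%N; apply: df.
by exists x => //; split; [split; [exact: at_chartP|]|exact: at_chartP].
Qed.

Lemma param_coord_cvg (d : nat) (X : manifold R d) (i : chart X) (x : X) :
  dom i x -> param i y @[y --> coord i x] --> x.
Proof.
move=> ix; have := @param_continuous _ _ X i (coord i x).
by rewrite /prop_for /continuous_at coordK //; apply; exists x.
Qed.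

Lemma near_param (d : nat) (X : manifold R d) (i : chart X) (x : X) (P : set X) :
  dom i x -> (\forall z \near x, P z) -> \forall y \near coord i x, P (param i y).
Proof. by move=> ix nP; exact: (param_coord_cvg ix nP). Qed.

Lemma near_eq_jacobian (d e : nat) (f g : 'rV[R]_d -> 'rV[R]_e) x :
  (\near x, f x = g x) -> differentiable f x -> jacobian f x = jacobian g x.
Proof.
move=> fg df; have dg := near_eq_differentiable fg df; apply/row_matrixP => i.
have E (h : 'rV[R]_d -> 'rV[R]_e) : differentiable h x ->
    row i (jacobian h x) = 'D_(delta_mx 0 i) h x.
  by move=> dh; rewrite rowE deriveEjacobian.
transitivity ('D_(delta_mx 0 i) f x); first exact: E.
transitivity ('D_(delta_mx 0 i) g x); first exact: near_eq_derive.
by symmetry; exact: E.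
Qed.

Lemma jacobian_comp (d e h : nat) (f : 'rV[R]_d -> 'rV[R]_e)
    (g : 'rV[R]_e -> 'rV[R]_h) x :
  differentiable f x -> differentiable g (f x) ->
  jacobian (g \o f) x = jacobian f x *m jacobian g (f x).
Proof.
move=> df dg; apply/row_matrixP => i; rewrite !rowE mulmxA.
rewrite -!deriveEjacobian //; last exact: differentiable_comp.
rewrite deriveE; last exact: differentiable_comp.
by rewrite diff_comp //= -(deriveE _ df) -deriveE.
Qed.

(** By continuity [f] stays in the preferred chart at [f x], where the inner [param] cancels
    [coord]. This reduces the chain rule on manifolds to that for Jacobians. *)
Lemma mdiff_factor (d e h : nat) (X : manifold R d) (Y : manifold R e)
    (Z : manifold R h) (f : X -> Y) (g : Y -> Z) x :
  mdifferentiable f x -> mdifferentiable g (f x) ->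
  \forall y \near coord (at_chart x) x,
    ((coord (at_chart (g (f x))) \o g \o param (at_chart (f x))) \o
     (coord (at_chart (f x)) \o f \o param (at_chart x))) y =
    (coord (at_chart ((g \o f) x)) \o (g \o f) \o param (at_chart x)) y.
Proof.
move=> [cf _] _.
have nf : \forall z \near x, dom (at_chart (f x)) (f z).
  by apply: cf; apply: open_nbhs_nbhs; split; [exact: dom_open|exact: at_chartP].
by apply: filterS (near_param (at_chartP x) nf) => y fy; rewrite /comp coordK.
Qed.

Lemma mdiff_comp (d e h : nat) (X : manifold R d) (Y : manifold R e)
    (Z : manifold R h) (f : X -> Y) (g : Y -> Z) x :
  mdifferentiable f x -> mdifferentiable g (f x) ->
  mdiff (g \o f) x = mdiff f x *m mdiff g (f x).
Proof.
move=> df dg; have nfg := mdiff_factor df dg.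
move: df dg => [cf df] [cg dg].
have E : (coord (at_chart (f x)) \o f \o param (at_chart x)) (coord (at_chart x) x)
   = coord (at_chart (f x)) (f x) by rewrite /= coordK //; exact: at_chartP.
rewrite -E in dg.
rewrite /mdiff -(near_eq_jacobian nfg); last exact: differentiable_comp.
rewrite (jacobian_comp df dg); congr (_ *m jacobian _ _); exact: E.
Qed.

Lemma near_eq_mdiff (d e : nat) (X : manifold R d) (Y : manifold R e)
    (f g : X -> Y) x : (\near x, f x = g x) -> mdifferentiable f x ->
  mdiff f x = mdiff g x.
Proof.
move=> fg [cf df]; rewrite /mdiff -(nbhs_singleton fg); apply: near_eq_jacobian => //.
by apply: filterS (near_param (at_chartP x) fg) => y; rewrite /comp => ->.
Qed.

Lemma near_coordK (d : nat) (X : manifold R d) (x : X) :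
  \forall y \near coord (at_chart x) x,
    y = (coord (at_chart x) \o idfun \o param (at_chart x)) y.
Proof.
have : nbhs (coord (at_chart x) x) (coord (at_chart x) @` dom (at_chart x)).
  apply: open_nbhs_nbhs; split; first exact: codom_open.
  by exists x => //; exact: at_chartP.
by apply: filterS => _ [p ip <-]; rewrite /= coordK.
Qed.

Lemma mdiff_id (d : nat) (X : manifold R d) (x : X) : mdiff (idfun : X -> X) x = 1%:M.
Proof.
rewrite /mdiff.
have n := near_coordK x.
have di : differentiable (fun y : 'rV[R]_d => y) (coord (at_chart x) x).
  exact: (@linear_differentiable _ _ _ idfun _ (fun=> cvg_id)).
rewrite -(near_eq_jacobian n di).
apply/row_matrixP => i; rewrite rowE -deriveEjacobian // derive_id.
by rewrite rowE mulmx1.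
Qed.

Lemma mdifferentiable_param (d : nat) (X : manifold R d) (i : chart X) x : dom i x ->
  @mdifferentiable d d (euclid R d) X (@param R d X i) (coord i x).
Proof.
by move=> ix; apply: smooth_mdifferentiable; [exact: smooth_param|exists x].
Qed.

Lemma mdifferentiable_coord (d : nat) (X : manifold R d) (i : chart X) x : dom i x ->
  @mdifferentiable d d X (euclid R d) (@coord R d X i) x.
Proof. by apply: smooth_mdifferentiable; exact: smooth_coord. Qed.

(** Chain rule for [param i \o coord i], which is the identity only on the open set [dom i]; hence
    the comparison near [x]. *)
Lemma dcoord_dparam (d : nat) (X : manifold R d) (i : chart X) x : dom i x ->
  dcoord i x *m dparam i (coord i x) = 1%:M.
Proof.
move=> ix; rewrite -(mdiff_comp (mdifferentiable_coord ix) (mdifferentiable_param ix)).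
rewrite -(mdiff_id x); symmetry; apply: near_eq_mdiff.
  have : nbhs x (dom i) by apply: open_nbhs_nbhs; split => //; exact: dom_open.
  by apply: filterS => z iz; rewrite /= coordK.
split; first exact: cvg_id.
have n := near_coordK x.
apply: near_eq_differentiable n _.
exact: (@linear_differentiable _ _ _ idfun _ (fun=> cvg_id)).
Qed.

Lemma dparam_dcoord (d : nat) (X : manifold R d) (i : chart X) x : dom i x ->
  dparam i (coord i x) *m dcoord i x = 1%:M.
Proof. by move=> ix; apply: mulmx1C; exact: dcoord_dparam. Qed.

Lemma jacobian_entry (d e : nat) (f : 'rV[R]_d -> 'rV[R]_e) x a b :
  differentiable f x ->
  jacobian f x a b = partial a (fun y => f y 0 b) x.
Proof.
move=> df; have : row a (jacobian f x) 0 b = jacobian f x a b by rewrite mxE.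
move=> <-; rewrite rowE -deriveEjacobian // derive_mx ?mxE //.
exact: diff_derivable.
Qed.

Lemma Ck_jacobian (d e : nat) (U : set 'rV[R]_d) k (f : 'rV[R]_d -> 'rV[R]_e) :
  open U -> Ck k.+1 U f -> Ck k U (jacobian f).
Proof.
move=> oU cf; apply/Ck_mxP => // a b.
have /Ck_mxP/(_ 0 b) [//|_ /(_ (delta_mx 0 a))] := cf.
by apply: Ck_ext => // x Ux; rewrite jacobian_entry //; case: cf => + _; apply.
Qed.

Definition mdifferentiable_fun (d : nat) (X : manifold R d) (g : X -> R) (x : X) :=
  differentiable (g \o param (at_chart x) : 'rV[R]_d -> R^o) (coord (at_chart x) x).

Lemma smooth_mdifferentiable_fun (d : nat) (X : manifold R d) (V : set X)
    (g : X -> R^o) x : smooth_fun V g -> V x -> mdifferentiable_fun g x.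
Proof.
move=> sg Vx; have [dg _] := sg (at_chart x) 1%N; apply: dg.
by exists x => //; split => //; exact: at_chartP.
Qed.

Lemma dfun_comp (d e : nat) (X : manifold R d) (Y : manifold R e) (f : X -> Y)
    (g : Y -> R) x : mdifferentiable f x -> mdifferentiable_fun g (f x) ->
  dfun (g \o f) x = mdiff f x *m dfun g (f x).
Proof.
move=> [cf df] dg.
have nf : \forall z \near x, dom (at_chart (f x)) (f z).
  by apply: cf; apply: open_nbhs_nbhs; split; [exact: dom_open|exact: at_chartP].
have {nf} := near_param (at_chartP x) nf => nf.
have E : (coord (at_chart (f x)) \o f \o param (at_chart x)) (coord (at_chart x) x)
   = coord (at_chart (f x)) (f x) by rewrite /= coordK //; exact: at_chartP.
rewrite /mdifferentiable_fun -E in dg.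
apply/matrixP => a b; rewrite !mxE /partial.
transitivity ('D_(delta_mx 0 a) ((g \o param (at_chart (f x)) : 'rV[R]_e -> R^o) \o
   (coord (at_chart (f x)) \o f \o param (at_chart x))) (coord (at_chart x) x)).
  by apply: near_eq_derive; apply: filterS nf => y fy; rewrite /comp coordK.
rewrite derive_comp_rV //; apply: eq_bigr => j _.
by rewrite jacobian_entry // mxE E.
Qed.

End manifold_calculus.

(** * Hermitian linear algebra of a compatible pair *)

(** Used with the metric for [A] and the symplectic form for [B]: conjugation and transposition both
    flip exactly the sign of the second term. *)
Lemma conj_herm (R : realType) (m : nat) (A B : 'M[R]_m) : A^T = A -> B^T = - B ->
  map_mx Num.conj (realmx A - 'i *: realmx B) = (realmx A - 'i *: realmx B)^T.
Proof.
move=> sA sB; apply/matrixP => i j; rewrite !mxE -complexiE -[LHS]/(conjc _).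
have g : A j i = A i j by have := congr1 (fun A : 'M[R]_m => A i j) sA; rewrite !mxE.
have o : B j i = - B i j by have := congr1 (fun A : 'M[R]_m => A i j) sB; rewrite !mxE.
by rewrite g o; apply/eqP; rewrite eq_complex /=; apply/andP; split; apply/eqP; ring.
Qed.

Section hermitian_algebra.
Variables (R : realType) (n : nat) (Om J : 'M[R]_(n.*2)).
Hypothesis OmT : Om^T = - Om.
Hypothesis JJ : J *m J = - 1%:M.
Hypothesis JOmJ : J *m Om *m J^T = Om.
Hypothesis Gpos : forall v : 'rV[R]_(n.*2), v != 0 -> 0 < (v *m (Om *m J^T) *m v^T) 0 0.

Let G := Om *m J^T.
Let H := realmx G - 'i *: realmx Om.
Let C := R[i].

Lemma realmxM (a b c : nat) (A : 'M[R]_(a, b)) (B : 'M[R]_(b, c)) :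
  realmx (A *m B) = realmx A *m realmx B.
Proof. exact: (map_mxM (real_complex R)). Qed.

Lemma realmxD (a b : nat) (A B : 'M[R]_(a, b)) : realmx (A + B) = realmx A + realmx B.
Proof. exact: (map_mxD (real_complex R)). Qed.

Lemma realmxN (a b : nat) (A : 'M[R]_(a, b)) : realmx (- A) = - realmx A.
Proof. exact: (map_mxN (real_complex R)). Qed.

Lemma realmx1 (a : nat) : realmx (1%:M : 'M[R]_a) = 1%:M.
Proof. exact: (map_mx1 (real_complex R)). Qed.

Lemma realmx0 (a b : nat) : realmx (0 : 'M[R]_(a, b)) = 0.
Proof. exact: (map_mx0 (real_complex R)). Qed.

Lemma realmxT (a b : nat) (A : 'M[R]_(a, b)) : realmx A^T = (realmx A)^T.
Proof. by rewrite /realmx map_trmx. Qed.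

Lemma conj_realmx (a b : nat) (A : 'M[R]_(a, b)) : map_mx Num.conj (realmx A) = realmx A.
Proof. by apply/matrixP => i j; rewrite !mxE -[LHS]/(conjc _) /= oppr0. Qed.

Lemma JTJT : J^T *m J^T = - 1%:M.
Proof. by rewrite -trmx_mul JJ linearN /= trmx1. Qed.

Lemma J_G : J *m G = Om.
Proof. by rewrite /G mulmxA JOmJ. Qed.

Lemma J_Om : J *m Om = - G.
Proof.
have := congr1 (mulmx^~ J^T) JOmJ; rewrite -mulmxA JTJT mulmxN mulmx1 /G.
by move=> <-; rewrite opprK.
Qed.

Lemma G_sym : G^T = G.
Proof. by rewrite /G trmx_mul trmxK OmT mulmxN J_Om opprK. Qed.

Lemma mulii : 'i * 'i = -1 :> C.
Proof. by rewrite -expr2 sqrCi. Qed.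

(** Complex linearity of the Hermitian form in its first argument: next to [H], the complex
    structure may be traded for the scalar i. *)
Lemma J_H : realmx J *m H = 'i *: H.
Proof.
rewrite /H mulmxBr -scalemxAr -!realmxM J_G J_Om realmxN scalerN opprK.
by rewrite scalerBr scalerA mulii scaleN1r opprK addrC.
Qed.

Lemma conjH : map_mx Num.conj H = H^T.
Proof. exact: conj_herm G_sym OmT. Qed.

(** By [J_H] the two halves of $(v - iJv)/2$ contribute equally, so [H] does not distinguish a real
    vector from its (1,0) part. *)
Lemma type10_H (r : nat) (E : 'M[R]_(r, n.*2)) : type10 J E *m H = realmx E *m H.
Proof.
rewrite /type10 -scalemxAl mulmxBl -scalemxAl realmxM -mulmxA J_H -scalemxAr scalerA mulii.
by set A := _ *m _; apply/matrixP => i j; rewrite !mxE; field.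
Qed.

Lemma type10_J (r : nat) (E : 'M[R]_(r, n.*2)) :
  type10 J E *m realmx J = 'i *: type10 J E.
Proof.
rewrite /type10 -scalemxAl mulmxBl -scalemxAl -!realmxM -mulmxA JJ mulmxN mulmx1.
rewrite scalerA mulrC -scalerA; congr (_ *: _).
by rewrite scalerBr scalerA mulii scaleN1r opprK realmxN scalerN opprK addrC.
Qed.

(** The matrix of Hermitian products of the rows. The second factor is transposed without
    conjugation because its rows are real. *)
Definition gram_mx (r s : nat) (E : 'M[R]_(r, n.*2)) (E' : 'M[R]_(s, n.*2)) :=
  realmx E *m H *m (realmx E')^T.

Lemma gram_mx_conj (r s : nat) (E : 'M[R]_(r, n.*2)) (E' : 'M[R]_(s, n.*2)) :
  map_mx Num.conj (gram_mx E E') = (gram_mx E' E)^T.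
Proof.
rewrite /gram_mx !map_mxM conjH map_trmx !conj_realmx !trmx_mul trmxK.
by rewrite mulmxA realmxT.
Qed.

Lemma G_unit : G \in unitmx.
Proof.
rewrite -row_free_unit; apply: inj_row_free => v vG.
apply/eqP/negPn/negP => /Gpos.
by rewrite -/G vG mul0mx mxE ltxx.
Qed.

(** A real relation $xE + yEJ = 0$ becomes the complex relation $(x + iy)\,\mathrm{gram} = 0$ after
    pairing with [H], so a nondegenerate frame and its [J]-image together are a real basis. *)
Lemma gram_basis_full (E : 'M[R]_(n, n.*2)) :
  gram_mx E E \in unitmx -> row_full (col_mx E (E *m J)).
Proof.
move=> gu; suff rf : row_free (col_mx E (E *m J)).
  by move: rf; rewrite /row_free /row_full => /eqP ->; rewrite addnn.
apply: inj_row_free => v.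
rewrite -[v]hsubmxK mul_row_col; set x := lsubmx v; set y := rsubmx v => xy0.
have : (realmx x + 'i *: realmx y) *m gram_mx E E = 0.
  have := congr1 (fun A => realmx A *m H) xy0.
  rewrite realmxD mulmxDl !realmxM -!mulmxA J_H realmx0 mul0mx.
  rewrite /gram_mx -!scalemxAr => h.
  by rewrite mulmxA [X in X *m _](_ : _ = 0) ?mul0mx // mulmxDl -scalemxAl.
move=> /(congr1 (mulmx^~ (invmx (gram_mx E E)))); rewrite mulmxK // mul0mx => z0.
have {}z0 i j : x i j = 0 /\ y i j = 0.
  have := congr1 (fun A : 'M[C]_(1, n) => A i j) z0; rewrite !mxE -complexiE.
  by move=> /eqP; rewrite eq_complex /= !mul0r !mul1r subr0 !add0r addr0 => /andP[/eqP ->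
      /eqP ->].
have -> : x = 0 by apply/matrixP => i j; rewrite [RHS]mxE; case: (z0 i j).
have -> : y = 0 by apply/matrixP => i j; rewrite [RHS]mxE; case: (z0 i j).
by rewrite row_mx0.
Qed.

(* The two sides differ by some [X] in the [i]-eigenspace of [J], where
   [X H = 2 X G]; [X] is [H]-orthogonal to [E], hence [G]-orthogonal to the real
   basis [E], [E J]. *)
Lemma type10_span (r : nat) (E : 'M[R]_(n, n.*2)) (E' : 'M[R]_(r, n.*2)) :
  gram_mx E E \in unitmx ->
  type10 J E' = gram_mx E' E *m invmx (gram_mx E E) *m type10 J E.
Proof.
move=> gu; set D := _ *m invmx _.
set X := type10 J E' - D *m type10 J E.
suff : X = 0 by move/eqP; rewrite subr_eq0 => /eqP.
have XJ : X *m realmx J = 'i *: X.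
  by rewrite /X mulmxBl -mulmxA !type10_J -scalemxAr scalerBr.
have XH : X *m H *m (realmx E)^T = 0.
  rewrite /X mulmxBl -(mulmxA D) !type10_H mulmxBl -/(gram_mx E' E) -(mulmxA D) -/(gram_mx E E).
  by rewrite /D mulmxKV // subrr.
have XG : X *m realmx G = - 'i *: (X *m realmx Om).
  have := J_Om => /(congr1 (@realmx R _ _)); rewrite realmxN realmxM => /(congr1 (mulmx X)).
  by rewrite mulmxA XJ -scalemxAl mulmxN scaleNr => ->; rewrite opprK.
have XGE : X *m realmx G *m (realmx E)^T = 0.
  move: XH; rewrite /H mulmxBr -scalemxAr -scaleNr -XG mulmxDl -mulr2n => /eqP.
  by rewrite -scaler_nat scaler_eq0 pnatr_eq0 /= => /eqP.
have XOE : X *m realmx Om *m (realmx E)^T = 0.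
  move: XGE; rewrite XG -scalemxAl => /eqP; rewrite scaler_eq0 => /orP[|/eqP //].
  by rewrite oppr_eq0 -complexiE eq_complex /= oner_eq0 andbF.
have XGEJ : X *m realmx G *m (realmx (E *m J))^T = 0.
  have GJ : realmx G *m realmx J^T = - realmx Om.
    by rewrite -realmxM /G -(mulmxA Om) JTJT mulmxN mulmx1 realmxN.
  have -> : (realmx (E *m J))^T = realmx J^T *m realmx E^T.
    by rewrite -realmxT trmx_mul realmxM.
  by rewrite mulmxA -(mulmxA X (realmx G)) GJ mulmxN mulNmx realmxT XOE oppr0.
have /row_fullP [B BE] := gram_basis_full gu.
have XG0 : X *m realmx G = 0.
  have <- : X *m realmx G *m (realmx (B *m col_mx E (E *m J)))^T = X *m realmx G.
    by rewrite BE realmx1 trmx1 mulmx1.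
  rewrite (realmxM B) trmx_mul mulmxA.
  have -> : realmx (col_mx E (E *m J)) = col_mx (realmx E) (realmx (E *m J)).
    exact: map_col_mx.
  by rewrite tr_col_mx mul_mx_row XGE XGEJ row_mx0 mul0mx.
have : X *m realmx G *m realmx (invmx G) = 0 by rewrite XG0 mul0mx.
by rewrite -mulmxA -realmxM mulmxV ?G_unit // realmx1 mulmx1.
Qed.

Lemma gram_span (r s : nat) (E : 'M[R]_(n, n.*2)) (E' : 'M[R]_(r, n.*2)) (F : 'M[R]_(s, n.*2)) :
  gram_mx E E \in unitmx ->
  gram_mx E' F = gram_mx E' E *m invmx (gram_mx E E) *m gram_mx E F.
Proof.
move=> gu; rewrite {1}/gram_mx -type10_H (type10_span E' gu) -(mulmxA _ (type10 J E)).
by rewrite type10_H -(mulmxA _ (realmx E *m H)).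
Qed.

Lemma wedgeE (E : 'M[R]_(n, n.*2)) (L : {ffun 'I_n -> 'I_(n.*2)}) :
  wedge J E L = \det (\matrix_(a, b) type10 J E a (L b)).
Proof. exact: ffunE. Qed.

(** A top exterior power is one-dimensional: the factor is the determinant of the change of frame in
    [type10_span], the same for every minor [L]. *)
Lemma wedge_span (E E' : 'M[R]_(n, n.*2)) (L : {ffun 'I_n -> 'I_(n.*2)}) : gram_mx E E \in
    unitmx ->
  wedge J E' L = \det (gram_mx E' E) / \det (gram_mx E E) * wedge J E L.
Proof.
move=> gu; apply: (etrans (wedgeE E' L)).
apply: (etrans _ (esym (congr1 (fun z => _ * z) (wedgeE E L)))).
transitivity (\det (gram_mx E' E *m invmx (gram_mx E E) *m
    \matrix_(a, b) type10 J E a (L b))); last by rewrite !det_mulmx det_inv.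
congr (\det _).
apply/matrixP => a b; rewrite mxE (type10_span E' gu) !mxE.
by apply: eq_bigr => j _; rewrite !mxE.
Qed.

Lemma gram_det_real (E : 'M[R]_(n, n.*2)) :
  \det (gram_mx E E) = (complex.Re (\det (gram_mx E E)))%:C%C.
Proof.
have : Num.conj (\det (gram_mx E E)) = \det (gram_mx E E).
  by rewrite -det_map_mx gram_mx_conj det_tr.
case: (\det _) => a b /eqP; rewrite eq_complex /= => /andP[_ /eqP bb].
have -> : b = 0 by lra.
by [].
Qed.

(* [h] is the Hermitian product of the two unit vectors. *)
Lemma unit_transition (E E' : 'M[R]_(n, n.*2)) (c c' : C) :
  `|c| ^+ 2 * \det (gram_mx E E) = 1 -> `|c'| ^+ 2 * \det (gram_mx E' E') = 1 ->
  let h := c' * c^* * \det (gram_mx E' E) in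
  `|h| = 1 /\ forall L : {ffun 'I_n -> 'I_(n.*2)}, c' * wedge J E' L = h * (c * wedge J E L).
Proof.
move=> uE uE' h.
have g0 : \det (gram_mx E E) != 0.
  by apply/eqP => g0; move/eqP: uE; rewrite g0 mulr0 eq_sym oner_eq0.
have gu : gram_mx E E \in unitmx by rewrite unitmxE unitfE.
split.
  have gE : \det (gram_mx E' E') =
     \det (gram_mx E' E) * (\det (gram_mx E' E))^* / \det (gram_mx E E).
    rewrite (gram_span E' E' gu) !det_mulmx det_inv -det_map_mx gram_mx_conj det_tr.
    by rewrite mulrAC.
  apply/eqP; rewrite -(@pexpr_eq1 _ _ 2) // normCK /h !rmorphM /= conjCK.
  move: uE uE'; rewrite !normCK gE => uE uE'.
  apply/eqP; transitivity ((c * c^* * \det (gram_mx E E)) * (c' * c'^* *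
    (\det (gram_mx E' E) * (\det (gram_mx E' E))^* / \det (gram_mx E E)))).
    move: (\det (gram_mx E E)) g0 => g g0.
    by move: (\det (gram_mx E' E)) (\det (gram_mx E' E))^* c^* c'^* => d d' e e'; field.
  by rewrite uE uE' mulr1.
move=> L; apply: (etrans (congr1 (fun z => c' * z) (wedge_span E' L gu))); rewrite /h.
rewrite normCK in uE.
transitivity ((c * c^* * \det (gram_mx E E)) *
  (c' * (\det (gram_mx E' E) / \det (gram_mx E E) * wedge J E L))).
  by rewrite uE mul1r.
move: (\det (gram_mx E E)) g0 => g g0.
by move: (\det (gram_mx E' E)) (wedge J E L) c^* => d w e; field.
Qed.

(** The (1,0) parts of the rows are independent over the complex numbers, so some maximal minor
    survives; [fullrankfun] selects its columns. *)
Lemma wedge_neq0 (E : 'M[R]_(n, n.*2)) : gram_mx E E \in unitmx ->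
  exists L : {ffun 'I_n -> 'I_(n.*2)}, wedge J E L != 0.
Proof.
move=> gu.
have rf : row_free (type10 J E).
  apply: inj_row_free => v vE.
  have : v *m gram_mx E E = 0 by rewrite /gram_mx -type10_H !mulmxA vE !mul0mx.
  by move=> /(congr1 (mulmx^~ (invmx (gram_mx E E)))); rewrite mulmxK // mul0mx.
have rF : row_full (type10 J E)^T by rewrite /row_full mxrank_tr.
exists (fullrankfun rF).
have := fullrowsub_unit rF; rewrite unitmxE unitfE -det_tr wedgeE.
by congr (\det _ != 0); apply/matrixP => a b; rewrite !mxE.
Qed.

(** Gram-Schmidt by dimension count: Hermitian orthogonality to [r] vectors is [2r] real equations
    on a space of real dimension [2n], so a nonzero solution exists while [r < n]. *)
Lemma unitary_frame_le (r : nat) : (r <= n)%N ->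
  exists E : 'M[R]_(r, n.*2), gram_mx E E = 1%:M.
Proof.
elim: r => [|r IH] rn; first by exists 0; apply/matrixP => -[].
have [E EE] := IH (ltnW rn).
(* The two blocks are the real and, up to sign, the imaginary parts of the Hermitian products with
   [E]. *)
pose K := row_mx (G *m E^T) (Om *m E^T).
have : kermx K != 0.
  rewrite kermx_eq0; apply/negP => /eqP rK.
  have := rank_leq_col K; rewrite rK addnn leq_double leqNgt; by rewrite rn.
rewrite -nz_row_eq0; set v := nz_row _ => v0.
have : v *m K = 0 by apply/sub_kermxP; exact: nz_row_sub.
rewrite mul_mx_row => /eqP; rewrite row_mx_eq0 => /andP[/eqP vG /eqP vO].
have p := Gpos v0; rewrite -/G in p.
set g := (v *m G *m v^T) 0 0 in p.
pose w := (Num.sqrt g)^-1 *: v.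
have wE : gram_mx w E = 0.
  rewrite /gram_mx /w /H -realmxT mulmxBr -scalemxAr mulmxBl -scalemxAl -!realmxM -!scalemxAl.
  by rewrite -(mulmxA v G) -(mulmxA v Om) vG vO !scaler0 realmx0 scaler0 subr0.
have ww : gram_mx w w = 1%:M.
  rewrite /gram_mx /H -realmxT mulmxBr -scalemxAr mulmxBl -scalemxAl -!realmxM.
  have -> : w *m Om *m w^T = 0.
    apply/matrixP => i j; rewrite !ord1 [RHS]mxE.
    have : (w *m Om *m w^T)^T = - (w *m Om *m w^T).
      by rewrite !trmx_mul trmxK OmT mulNmx mulmxN mulmxA.
    by move=> /(congr1 (fun A : 'M[R]_1 => A 0 0)); rewrite !mxE; lra.
  rewrite realmx0 scaler0 subr0.
  apply/matrixP => i j; rewrite !ord1 /realmx mxE /w linearZ /= -!scalemxAl -scalemxAr.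
  rewrite mxE mxE -/g mulrA -expr2 exprVn sqr_sqrtr ?(ltW p) // mulVf ?gt_eqF //.
  by rewrite mxE.
have Ew : gram_mx E w = 0.
  by have := gram_mx_conj w E; rewrite wE map_mx0 => /(congr1 trmx); rewrite trmxK trmx0.
suff KE : @gram_mx (1 + r) (1 + r) (col_mx w E) (col_mx w E) = 1%:M by exists (col_mx w E).
rewrite /gram_mx.
have -> : realmx (col_mx w E) = col_mx (realmx w) (realmx E) by exact: map_col_mx.
rewrite mul_col_mx tr_col_mx mul_col_row -!/(gram_mx _ _) ww wE Ew EE.
by rewrite -scalar_mx_block.
Qed.

Lemma unitary_frame : exists E : 'M[R]_(n, n.*2), gram_mx E E = 1%:M.
Proof. exact: unitary_frame_le. Qed.

Lemma gram_mx_entry (r s : nat) (E : 'M[R]_(r, n.*2)) (E' : 'M[R]_(s, n.*2)) a b :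
  gram_mx E E' a b = Complex ((E *m G *m E'^T) a b) (- (E *m Om *m E'^T) a b).
Proof.
rewrite /gram_mx /H -realmxT mulmxBr -scalemxAr mulmxBl -scalemxAl -!realmxM !mxE -complexiE.
by apply/eqP; rewrite eq_complex /=; apply/andP; split; apply/eqP; ring.
Qed.

End hermitian_algebra.

(** * Smooth complex functions and logarithmic derivatives *)

Section sections.
Variable R : realType.

Lemma smooth_fun_local (d : nat) (X : manifold R d) (W : normedModType R)
    (V : set X) (g : X -> W) :
  (forall x, V x -> exists2 V' : set X, V' x & smooth_fun V' g) -> smooth_fun V g.
Proof.
move=> H i k; apply: Ck_local => _ [x [ix Vx] <-].
have [V' V'x sg] := H _ Vx; exists (coord i @` (dom i `&` V')); last exact: sg.
by exists x.
Qed.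

Lemma smooth_cfun_local (d : nat) (X : manifold R d) (V : set X) (g : X -> R[i]) :
  (forall x, V x -> exists2 V' : set X, V' x & smooth_cfun V' g) -> smooth_cfun V g.
Proof.
by move=> H; split; apply: smooth_fun_local => x /H [V' V'x [sr si]]; exists V'.
Qed.

Lemma smooth_fun_continuous (d : nat) (X : manifold R d)
    (V : set X) (g : X -> R^o) x : smooth_fun V g -> V x -> {for x, continuous g}.
Proof.
move=> sg Vx; set i := at_chart x.
have ix : dom i x by exact: at_chartP.
have cg : {for coord i x, continuous (g \o param i)}.
  by apply: (sg i 0%N); exists x.
have cc : {for x, continuous ((g \o param i) \o coord i)}.
  by apply: continuous_comp => //; exact: coord_continuous.
have n : nbhs x (dom i) by apply: open_nbhs_nbhs; split => //; exact: dom_open.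
rewrite /prop_for /continuous_at; move: cc; rewrite /prop_for /continuous_at /= coordK // => cc.
by apply: cvg_trans cc; apply: near_eq_cvg; apply: filterS n => y iy /=; rewrite coordK.
Qed.

Section algebra.
Variables (d : nat) (X : manifold R d) (V : set X).
Hypothesis oV : open V.
Implicit Types g h : X -> R[i].

Lemma smooth_cfun_sub V' g : V' `<=` V -> smooth_cfun V g -> smooth_cfun V' g.
Proof. by move=> VV [sr si]; split;
    [exact: smooth_fun_sub VV sr|exact: smooth_fun_sub VV si]. Qed.

Lemma smooth_cfun_ext g h : (forall x, V x -> g x = h x) -> smooth_cfun V g -> smooth_cfun V h.
Proof.
move=> gh [sr si]; split.
  by apply: smooth_fun_ext sr => // x Vx; rewrite gh.
by apply: smooth_fun_ext si => // x Vx; rewrite gh.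
Qed.

Lemma smooth_funD (g h : X -> R^o) : smooth_fun V g -> smooth_fun V h ->
  smooth_fun V (fun x => g x + h x : R^o).
Proof.
by move=> sg sh i k; apply: (CkD (chart_image_open (i := i) oV) (sg i k) (sh i k)).
Qed.

Lemma smooth_funM (g h : X -> R^o) : smooth_fun V g -> smooth_fun V h ->
  smooth_fun V (fun x => g x * h x : R^o).
Proof.
by move=> sg sh i k; apply: (CkM (chart_image_open (i := i) oV) (sg i k) (sh i k)).
Qed.

Lemma smooth_funN (g : X -> R^o) : smooth_fun V g -> smooth_fun V (fun x => - g x : R^o).
Proof. by move=> sg i k; apply: (CkN (chart_image_open (i := i) oV) (sg i k)). Qed.

Lemma smooth_fun_mulmx (a b c : nat) (F : X -> 'M[R]_(a, b)) (G : X -> 'M[R]_(b, c)) :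
  smooth_fun V F -> smooth_fun V G -> smooth_fun V (fun x => F x *m G x).
Proof.
by move=> sF sG i k; apply: (Ck_mulmx (chart_image_open (i := i) oV) (sF i k) (sG i k)).
Qed.

Lemma smooth_fun_trmx (a b : nat) (F : X -> 'M[R]_(a, b)) :
  smooth_fun V F -> smooth_fun V (fun x => (F x)^T).
Proof. by move=> sF i k; apply: (Ck_trmx (chart_image_open (i := i) oV) (sF i k)). Qed.

Lemma smooth_cfun_cst (z : R[i]) : smooth_cfun V (fun=> z).
Proof. by split=> i; exact: smooth_on_cst. Qed.

Lemma smooth_cfunD g h : smooth_cfun V g -> smooth_cfun V h ->
  smooth_cfun V (fun x => g x + h x).
Proof.
move=> [gr gi] [hr hi]; split.
  by apply: smooth_fun_ext (smooth_funD gr hr) => // x _; case: (g x); case: (h x).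
by apply: smooth_fun_ext (smooth_funD gi hi) => // x _; case: (g x); case: (h x).
Qed.

Lemma smooth_cfunM g h : smooth_cfun V g -> smooth_cfun V h ->
  smooth_cfun V (fun x => g x * h x).
Proof.
move=> [gr gi] [hr hi]; split.
  apply: smooth_fun_ext (smooth_funD (smooth_funM gr hr) (smooth_funN (smooth_funM gi hi)))
      => // x _.
  by case: (g x); case: (h x).
apply: smooth_fun_ext (smooth_funD (smooth_funM gr hi) (smooth_funM gi hr)) => // x _.
by case: (g x); case: (h x).
Qed.

Lemma smooth_cfun_conj g : smooth_cfun V g -> smooth_cfun V (fun x => (g x)^*).
Proof.
move=> [gr gi]; split.
  by apply: smooth_fun_ext gr => // x _; case: (g x).
by apply: smooth_fun_ext (smooth_funN gi) => // x _; case: (g x).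
Qed.

Lemma smooth_cfun_sum (I : Type) (r : seq I) (P : pred I) (F : I -> X -> R[i]) :
  (forall i, smooth_cfun V (F i)) -> smooth_cfun V (fun x => \sum_(i <- r | P i) F i x).
Proof.
move=> sF; elim: r => [|i r IH].
  by apply: smooth_cfun_ext (smooth_cfun_cst 0) => x _; rewrite big_nil.
case Pi: (P i).
  by apply: smooth_cfun_ext (smooth_cfunD (sF i) IH) => x _; rewrite big_cons Pi.
by apply: smooth_cfun_ext IH => x _; rewrite big_cons Pi.
Qed.

Lemma smooth_cfun_prod (I : Type) (r : seq I) (P : pred I) (F : I -> X -> R[i]) :
  (forall i, smooth_cfun V (F i)) -> smooth_cfun V (fun x => \prod_(i <- r | P i) F i x).
Proof.
move=> sF; elim: r => [|i r IH].
  by apply: smooth_cfun_ext (smooth_cfun_cst 1) => x _; rewrite big_nil.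
case Pi: (P i).
  by apply: smooth_cfun_ext (smooth_cfunM (sF i) IH) => x _; rewrite big_cons Pi.
by apply: smooth_cfun_ext IH => x _; rewrite big_cons Pi.
Qed.

Lemma smooth_cfun_det (m : nat) (F : X -> 'M[R[i]]_m) :
  (forall a b, smooth_cfun V (fun x => F x a b)) -> smooth_cfun V (fun x => \det (F x)).
Proof.
move=> sF; apply: smooth_cfun_sum => s; apply: smooth_cfunM; first exact: smooth_cfun_cst.
by apply: smooth_cfun_prod => a; exact: sF.
Qed.

End algebra.

Lemma smooth_cfun_comp (d e : nat) (X : manifold R d) (Y : manifold R e)
    (V : set X) (f : X -> Y) (W : set Y) (g : Y -> R[i]) :
  open V -> smooth_map V f -> open W -> smooth_cfun W g ->
  smooth_cfun (V `&` f @^-1` W) (g \o f).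
Proof.
move=> oV sf oW [gr gi]; split.
  exact: (smooth_fun_comp_scalar oV sf oW gr).
exact: (smooth_fun_comp_scalar oV sf oW gi).
Qed.

Lemma smooth_idfun (d : nat) (X : manifold R d) : smooth_map setT (idfun : X -> X).
Proof.
split=> [x _|i j k]; first exact: cvg_id.
by apply: Ck_sub (transition_smooth i j k); apply: image_subset => x [[]].
Qed.

Lemma smooth_U1_comp (d e : nat) (X : manifold R d) (Y : manifold R e)
    (V : set X) (f : X -> Y) (W : set Y) (g : Y -> R[i]) :
  open V -> smooth_map V f -> open W -> smooth_U1 W g ->
  smooth_U1 (V `&` f @^-1` W) (g \o f).
Proof.
move=> oV sf oW [sg g1]; split; first exact: smooth_cfun_comp.
by move=> x [_ Wx]; exact: g1.
Qed.

Definition mdifferentiable_cfun (d : nat) (X : manifold R d) (g : X -> R[i]) (x : X) :=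
  mdifferentiable_fun (fun z => complex.Re (g z)) x /\
  mdifferentiable_fun (fun z => complex.Im (g z)) x.

Lemma smooth_mdifferentiable_cfun (d : nat) (X : manifold R d) (V : set X)
    (g : X -> R[i]) x : smooth_cfun V g -> V x -> mdifferentiable_cfun g x.
Proof.
by move=> [gr gi] Vx; split;
    [exact: (smooth_mdifferentiable_fun gr)|exact: (smooth_mdifferentiable_fun gi)].
Qed.

Lemma dlog_comp (d e : nat) (X : manifold R d) (Y : manifold R e) (f : X -> Y)
    (g : Y -> R[i]) x : mdifferentiable f x -> mdifferentiable_cfun g (f x) ->
  dlog (g \o f) x = mdiff f x *m dlog g (f x).
Proof.
move=> df [dr di]; rewrite /dlog mulmxBr -!scalemxAr.
by rewrite -(dfun_comp df dr) -(dfun_comp df di).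
Qed.

Lemma near_eq_dfun (d : nat) (X : manifold R d) (g h : X -> R) x :
  (\near x, g x = h x) -> dfun g x = dfun h x.
Proof.
move=> gh; apply/matrixP => a b; rewrite !mxE; apply: near_eq_derive.
by apply: filterS (near_param (at_chartP x) gh) => y.
Qed.

Lemma near_eq_dlog (d : nat) (X : manifold R d) (g h : X -> R[i]) x :
  (\near x, g x = h x) -> dlog g x = dlog h x.
Proof.
move=> gh; rewrite /dlog (nbhs_singleton gh); congr (_ *: _ - _ *: _);
  by apply: near_eq_dfun; apply: filterS gh => y ->.
Qed.

Lemma dfunM (d : nat) (X : manifold R d) (g h : X -> R) x :
  mdifferentiable_fun g x -> mdifferentiable_fun h x ->
  dfun (fun z => g z * h z) x = g x *: dfun h x + h x *: dfun g x.
Proof.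
move=> dg dh; apply/matrixP => a b; rewrite !mxE /partial.
have := @deriveM R _ (g \o param (at_chart x)) (h \o param (at_chart x))
   (coord (at_chart x) x) (delta_mx 0 a) (diff_derivable (v := _) dg) (diff_derivable (v :=
       _) dh).
rewrite /GRing.scale /= coordK; last exact: at_chartP.
by move=> <-.
Qed.

Lemma dfunD (d : nat) (X : manifold R d) (g h : X -> R) x :
  mdifferentiable_fun g x -> mdifferentiable_fun h x ->
  dfun (fun z => g z + h z) x = dfun g x + dfun h x.
Proof.
move=> dg dh; apply/matrixP => a b; rewrite !mxE /partial.
by rewrite -deriveD //; exact: diff_derivable.
Qed.

Lemma dfunB (d : nat) (X : manifold R d) (g h : X -> R) x :
  mdifferentiable_fun g x -> mdifferentiable_fun h x ->
  dfun (fun z => g z - h z) x = dfun g x - dfun h x.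
Proof.
move=> dg dh; apply/matrixP => a b; rewrite !mxE /partial.
by rewrite -deriveB //; exact: diff_derivable.
Qed.

Lemma mdifferentiable_funM (d : nat) (X : manifold R d) (g h : X -> R) x :
  mdifferentiable_fun g x -> mdifferentiable_fun h x ->
  mdifferentiable_fun (fun z => g z * h z) x.
Proof. by move=> dg dh; apply: differentiableM. Qed.

Lemma norm1_ReIm (z : R[i]) : `|z| = 1 -> complex.Re z ^+ 2 + complex.Im z ^+ 2 = 1.
Proof.
rewrite normc_def => /eqP; rewrite eq_complex /= => /andP[/eqP h _].
have p : 0 <= complex.Re z ^+ 2 + complex.Im z ^+ 2 by rewrite addr_ge0 // sqr_ge0.
by rewrite -(sqr_sqrtr p) h expr1n.
Qed.

(** [dlog g] is $|g|^2\,d(\arg g)$, so the product rule yields $|h|^2$ [dlog g] plus $|g|^2$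
    [dlog h]; the norms at [x] remove the two weights. *)
Lemma dlogM (d : nat) (X : manifold R d) (g h : X -> R[i]) x :
  mdifferentiable_cfun g x -> mdifferentiable_cfun h x -> `|g x| = 1 -> `|h x| = 1 ->
  dlog (fun z => g z * h z) x = dlog g x + dlog h x.
Proof.
move=> [gr gi] [hr hi] /norm1_ReIm g1 /norm1_ReIm h1; rewrite /dlog.
have -> : (fun z => complex.Im (g z * h z)) =
   (fun z => complex.Re (g z) * complex.Im (h z) + complex.Im (g z) * complex.Re (h z)).
  by apply/funext => z; case: (g z) => ? ?; case: (h z).
have -> : (fun z => complex.Re (g z * h z)) =
   (fun z => complex.Re (g z) * complex.Re (h z) - complex.Im (g z) * complex.Im (h z)).
  by apply/funext => z; case: (g z) => ? ?; case: (h z).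
rewrite dfunD ?dfunB; try exact: mdifferentiable_funM.
rewrite !dfunM //.
have -> : complex.Re (g x * h x) = complex.Re (g x) * complex.Re (h x) - complex.Im (g x) *
    complex.Im (h x).
  by case: (g x) => ? ?; case: (h x).
have -> : complex.Im (g x * h x) = complex.Re (g x) * complex.Im (h x) + complex.Im (g x) *
    complex.Re (h x).
  by case: (g x) => ? ?; case: (h x).
move: (complex.Re (g x)) (complex.Im (g x)) g1 => p q g1.
move: (complex.Re (h x)) (complex.Im (h x)) h1 => r s h1.
move: (dfun _ x) => ds; move: (dfun _ x) => dp; move: (dfun _ x) => dr; move: (dfun _ x) => dq.
apply/matrixP => a b; rewrite !mxE.
move: (ds a b) (dp a b) (dr a b) (dq a b) => {}ds {}dp {}dr {}dq.
transitivity ((p ^+ 2 + q ^+ 2) * (r * ds - s * dr) + (r ^+ 2 + s ^+ 2) * (p * dq - q * dp)).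
  by ring.
by rewrite g1 h1; ring.
Qed.

End sections.

(** * Unit sections of the anticanonical bundle *)

Section bundle.
Variables (R : realType) (n : nat) (M : manifold R n.*2).
Variables (om J : M -> 'M[R]_(n.*2)).
Hypothesis om_symp : symplectic om.
Hypothesis J_comp : compatible om J.

Let omT p : (om p)^T = - om p. Proof. by case: om_symp. Qed.
Let JJ p : J p *m J p = - 1%:M. Proof. by case: J_comp. Qed.
Let JomJ p : J p *m om p *m (J p)^T = om p. Proof. by case: J_comp. Qed.
Let Gpos p (v : 'rV[R]_(n.*2)) : v != 0 -> 0 < (v *m (om p *m (J p)^T) *m v^T) 0 0.
Proof. by case: J_comp => _ _ _; apply. Qed.

Local Notation gram p E E' := (gram_mx (om p) (J p) E E').

Section along.
Variables (d : nat) (X : manifold R d) (f : X -> M) (V : set X).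
Hypotheses (oV : open V) (sf : smooth_map V f).

(** Inserting [dcoord] times [dparam], which is 1, on both sides of [T] turns the product into
    coordinate expressions that are smooth by hypothesis. *)
Lemma smooth_tensor2 (r s : nat) (T : M -> 'M[R]_(n.*2)) (E : X -> 'M[R]_(r, n.*2))
    (E' : X -> 'M[R]_(s, n.*2)) :
  smooth_form2 setT T -> smooth_along f V E -> smooth_along f V E' ->
  smooth_fun V (fun x => E x *m T (f x) *m (E' x)^T).
Proof.
move=> sT /smooth_alongP sE /smooth_alongP sE'; apply: smooth_fun_local => x Vx.
set j := at_chart (f x).
have oV' : open (V `&` f @^-1` dom j).
  by apply: open_preimage_on => //; [exact: dom_open|case: sf].
exists (V `&` f @^-1` dom j); first by split => //; exact: at_chartP.
have sT' : smooth_fun (V `&` f @^-1` dom j) (chart2 j T \o (coord j \o f)).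
  have oc : @open (euclid R n.*2) (coord j @` dom j) by exact: codom_open.
  have sc : @smooth_fun R n.*2 (euclid R n.*2) _ (coord j @` dom j) (chart2 j T).
    move=> [] k; apply: Ck_sub (sT j k) => y [z [_ [p jp <-]] <-]; exists p => //.
  have scf := smooth_map_comp oV (dom_open j) sf (smooth_coord j).
  have := smooth_fun_comp oV' scf oc sc.
  apply: smooth_fun_sub => y [Vy jy]; split => //; by exists (f y).
have := smooth_fun_mulmx oV' (smooth_fun_mulmx oV' (sE j) sT')
  (smooth_fun_trmx oV' (sE' j)).
apply: smooth_fun_ext => // y [_ jy] /=.
rewrite /chart2 /pull2 -/(dparam j (coord j (f y))) coordK //.
have := dcoord_dparam jy; move: (dcoord _ _) (dparam _ _) => A P AP.
have PA : P^T *m A^T = 1%:M by rewrite -trmx_mul AP trmx1.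
by rewrite trmx_mul !mulmxA -(mulmxA (E y)) AP mulmx1 -(mulmxA _ P^T) PA mulmx1.
Qed.

(** With $P$ for [dparam], the form reads $P\,\omega P^T$ and the endomorphism $PJP^{-1}$;
    transposing the latter cancels $P^T$ and leaves $P\,\omega J^T P^T$. *)
Lemma smooth_metric : smooth_form2 setT (metric om J).
Proof.
move=> i k; have oI := chart_image_open (i := i) (@openT M).
have so : Ck k (coord i @` (dom i `&` setT)) (chart2 i om).
  by case: om_symp => + _ _ _; apply.
have sJ : Ck k (coord i @` (dom i `&` setT))
    (fun y => dparam i y *m J (param i y) *m invmx (dparam i y)).
  by case: J_comp => + _ _ _ => /(_ i k); apply: Ck_sub => y [p [ip _] <-]; exists p.
apply: Ck_ext (Ck_mulmx oI so (Ck_trmx oI sJ)) => // _ [p [ip _] <-].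
rewrite /chart2 /pull2 -/(dparam i (coord i p)) /metric coordK //.
have := dparam_dcoord ip; move: (dcoord _ _) (dparam _ _) => A P PA.
have [Pu _] := mulmx1_unit PA.
have PP : P^T *m (invmx P)^T = 1%:M by rewrite -trmx_mul mulVmx // trmx1.
by rewrite !trmx_mul !mulmxA -(mulmxA _ P^T) PP mulmx1.
Qed.

Lemma smooth_gram (r s : nat) (E : X -> 'M[R]_(r, n.*2)) (E' : X -> 'M[R]_(s, n.*2)) a b :
  smooth_along f V E -> smooth_along f V E' ->
  smooth_cfun V (fun x => gram (f x) (E x) (E' x) a b).
Proof.
move=> sE sE'; have som : smooth_form2 setT om by case: om_symp.
have /smooth_fun_mxP h1 := smooth_tensor2 smooth_metric sE sE'.
have /smooth_fun_mxP h2 := smooth_tensor2 som sE sE'.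
split.
  by apply: smooth_fun_ext (h1 oV a b) => // x _; rewrite gram_mx_entry.
by apply: smooth_fun_ext (smooth_funN oV (h2 oV a b)) => // x _; rewrite gram_mx_entry.
Qed.

End along.

(* [unit_vector] only asserts the normalization of some representation [(c', E')]. *)
Lemma unit_vector_gram (p : M) (c : R[i]) (E : 'M[R]_(n, n.*2)) :
  unit_vector om J p [ffun L => c * wedge (J p) E L] ->
  `|c| ^+ 2 * \det (gram p E E) = 1.
Proof.
move=> [c' [E' [eq u']]].
have gu : gram p E' E' \in unitmx.
  rewrite unitmxE unitfE; apply/eqP => g0; move/eqP: u'.
  by rewrite -/(gram_mx (om p) (J p) E' E') g0 mulr0 eq_sym oner_eq0.
have g0 : \det (gram p E' E') != 0 by rewrite -unitfE -unitmxE.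
have [L wL] := wedge_neq0 (JJ p) (JomJ p) gu.
have eL := etrans (esym (ffunE (fun L => c * wedge (J p) E L) L))
  (etrans (congr1 (fun s : multivec R n => s L) eq) (ffunE (fun L => c' * wedge (J p) E' L) L)).
have := wedge_span (JJ p) (JomJ p) (@Gpos p) E L gu => ew.
have {}eL := etrans (esym (congr1 (fun z => c * z) ew)) eL.
move: wL eL; move: (wedge (J p) E' L) => w w0; rewrite mulrA => /(mulIf w0) eL.
have gE : \det (gram p E E) =
     \det (gram p E E') * (\det (gram p E E'))^* / \det (gram p E' E').
  rewrite (gram_span (JJ p) (JomJ p) (@Gpos p) E E gu) !det_mulmx det_inv.
  by rewrite -det_map_mx (gram_mx_conj (omT p) (JJ p) (JomJ p)) det_tr mulrAC.
have gr : (\det (gram p E' E'))^-1^* = (\det (gram p E' E'))^-1.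
  rewrite fmorphV; congr (_^-1).
  by rewrite -det_map_mx (gram_mx_conj (omT p) (JJ p) (JomJ p)) det_tr.
rewrite gE normCK -u' -/(gram_mx (om p) (J p) E' E') normCK -eL !rmorphM /= gr.
move: (\det (gram p E' E')) g0 => D D0.
by move: (\det (gram p E E')) (\det (gram p E E'))^* c^* => a b e; field.
Qed.

Lemma unit_vector_neq0 (p : M) (s : multivec R n) : unit_vector om J p s ->
  exists L, s L != 0.
Proof.
move=> [c [E [-> u]]].
have gu : gram p E E \in unitmx.
  rewrite unitmxE unitfE; apply/eqP => g0; move/eqP: u.
  by rewrite -/(gram_mx (om p) (J p) E E) g0 mulr0 eq_sym oner_eq0.
have [L wL] := wedge_neq0 (JJ p) (JomJ p) gu.
exists L; rewrite ffunE mulf_neq0 //; apply/eqP => c0; move/eqP: u.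
by rewrite c0 normr0 expr0n mul0r eq_sym oner_eq0.
Qed.

(** This uniqueness of coefficients is what settles the choices made through [xget]. *)
Lemma unit_vector_scaleI (p : M) (s : multivec R n) (z z' : R[i]) :
  unit_vector om J p s ->
  [ffun L => z * s L] = [ffun L => z' * s L] :> multivec R n -> z = z'.
Proof.
move=> /unit_vector_neq0 [L sL] /ffunP /(_ L); rewrite !ffunE.
exact: mulIf.
Qed.

Section transition.
Variables (d : nat) (X : manifold R d) (f : X -> M) (V : set X).
Hypotheses (oV : open V) (sf : smooth_map V f).

Lemma unit_section_sub (W W' : set X) (s : X -> multivec R n) :
  open W' -> W' `<=` W -> unit_section om J f W s -> unit_section om J f W' s.
Proof.
move=> oW' WW [oW u loc]; split => // [x /WW|x /WW]; [exact: u|exact: loc].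
Qed.

(** Locally the factor is the Hermitian product of the two sections, given smoothly by any
    representing frames; uniqueness of the factor glues the local formulas. The result is confined
    to [V], where [f] is known to be smooth. *)
Lemma unit_section_transition (W W' : set X) (s s' : X -> multivec R n) :
  unit_section om J f W s -> unit_section om J f W' s' ->
  exists2 h : X -> R[i], smooth_U1 (V `&` (W `&` W')) h &
    forall x, (V `&` (W `&` W')) x -> s' x = [ffun L => h x * s x L].
Proof.
move=> [oW us ls] [oW' us' ls'].
(* The global factor is defined pointwise by choice and only afterwards identified with a smooth
   formula near each point. *)
pose h x := xget 0 [set z : R[i] | s' x = [ffun L => z * s x L]].
have H x : (V `&` (W `&` W')) x -> exists (V' : set X) (h' : X -> R[i]),
   [/\ open V', V' x, smooth_cfun V' h' & forall y, V' y ->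
      [/\ `|h' y| = 1, s' y = [ffun L => h' y * s y L] & h y = h' y]].
  move=> [Vx [Wx W'x]].
  have [U [c [E [oU Ux sc sE es]]]] := ls _ Wx.
  have [U' [c' [E' [oU' U'x sc' sE' es']]]] := ls' _ W'x.
  pose N := V `&` (W `&` W') `&` (U `&` U').
  have oN : open N by repeat apply: openI.
  (* The Hermitian product of [s' y] with [s y], computed in the frames representing them near
     [x]. *)
  pose h' y := c' y * (c y)^* * \det (gram (f y) (E' y) (E y)).
  have sub1 : N `<=` U by move=> y [_ []].
  have sub2 : N `<=` U' by move=> y [_ []].
  have sub3 : N `<=` V by move=> y [[]].
  exists N, h'; split => //.
    apply: smooth_cfunM => //.
      apply: smooth_cfunM => //; first exact: smooth_cfun_sub sc'.
      by apply: smooth_cfun_conj => //; exact: smooth_cfun_sub sc.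
    apply: smooth_cfun_det => // a b.
    apply: smooth_gram => //; first exact: smooth_map_sub sf.
      exact: smooth_along_sub sE'.
    exact: smooth_along_sub sE.
  move=> y [[Vy [Wy W'y]] [Uy U'y]].
  have u1 := us _ Wy; have u2 := us' _ W'y.
  have u1' := u1; rewrite (es _ Uy) in u1'; have u2' := u2; rewrite (es' _ U'y) in u2'.
  have [h1 hs] := unit_transition (omT _) (JJ _) (JomJ _) (@Gpos _)
    (unit_vector_gram u1') (unit_vector_gram u2').
  have e : s' y = [ffun L => h' y * s y L].
    apply/ffunP => L; rewrite (es' _ U'y) (es _ Uy).
    apply: (etrans (ffunE _ _)); apply: (etrans (hs L)).
    by apply: esym; apply: (etrans (ffunE _ _)); congr (_ * _); exact: ffunE.
  split => //; rewrite /h; apply: xget_unique => // z; rewrite /= e.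
  by move=> ez; apply: (unit_vector_scaleI u1); rewrite ez.
exists h.
  split.
    apply: smooth_cfun_local => x /H [N [h' [oN Nx sh hh]]]; exists N => //.
    by apply: smooth_cfun_ext sh => // y /hh [].
  by move=> x /H [N [h' [oN Nx sh /(_ _ Nx) [h1 _ ->]]]].
by move=> x /H [N [h' [oN Nx sh /(_ _ Nx) [_ + ->]]]].
Qed.

End transition.

Lemma unit_section_comp (d e : nat) (X : manifold R d) (Y : manifold R e)
    (f : X -> M) (V : set X) (phi : Y -> X) (V' : set Y) (W : set X) (s : X -> multivec R n) :
  open V -> smooth_map V f -> open V' -> smooth_map V' phi ->
  unit_section om J f W s ->
  unit_section om J (f \o phi) (V' `&` phi @^-1` (V `&` W)) (s \o phi).
Proof.
move=> oV sf oV' sphi [oW us ls].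
have oP : open (V' `&` phi @^-1` (V `&` W)).
  by apply: open_preimage_on => //; [exact: openI|case: sphi].
split => // [x [_ [_ Wx]]|x [V'x [Vx Wx]]]; first exact: us.
have [U [c [E [oU Ux sc sE es]]]] := ls _ Wx.
have oVU : open (V `&` U) by exact: openI.
exists (V' `&` phi @^-1` (V `&` U)), (c \o phi), (E \o phi); split => //.
- by apply: open_preimage_on => //; case: sphi.
- apply: smooth_cfun_comp => //; apply: smooth_cfun_sub sc; exact: subIsetr.
- apply: smooth_along_comp => //; last by apply: smooth_along_sub sE; exact: subIsetr.
  by move=> y [Vy _]; case: sf => + _; apply.
- by move=> y [_ [_ Uy]]; exact: es.
Qed.

(** A unitary frame at [p] is extended with constant coefficients in a chart. It need not stay
    unitary, but its Gram determinant is 1 at [p], hence positive nearby, and dividing by its square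
    root normalizes the wedge. *)
Lemma unit_section_exists (p : M) : exists (W : set M) (s : M -> multivec R n),
  W p /\ unit_section om J idfun W s.
Proof.
have [E0 E0E0] := unitary_frame (omT p) (JJ p) (JomJ p) (@Gpos p).
set j := at_chart p; have jp : dom j p by exact: at_chartP.
pose E x := E0 *m dcoord j p *m dparam j (coord j x).
have Ep : E p = E0 by rewrite /E -mulmxA dcoord_dparam // mulmx1.
have oD : open (dom j) by exact: dom_open.
have sE : smooth_along (idfun : M -> M) (dom j) E.
  apply/smooth_alongP => l; have oDl : open (dom j `&` dom l) by apply: openI => //;
      exact: dom_open.
  (* In a chart [l] the frame is a constant matrix times the Jacobian of the transition map from [j]
     to [l]. *)
  have st : smooth_fun (dom j `&` (idfun @^-1` dom l))
     ((fun y => E0 *m dcoord j p *m jacobian (coord l \o param j) y) \o coord j).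
    have oc : @open (euclid R n.*2) (coord j @` (dom j `&` dom l)) by exact:
        chart_image_open (@dom_open _ _ _ l).
    have sJ : @smooth_fun R n.*2 (euclid R n.*2) _ (coord j @` (dom j `&` dom l))
       (fun y => E0 *m dcoord j p *m jacobian (coord l \o param j) y).
      move=> [] k; rewrite /= image_id setTI.
      apply: Ck_mulmx => //; first exact: smooth_on_cst.
      by apply: Ck_jacobian => //; exact: transition_smooth.
    have := smooth_fun_comp oD (smooth_coord j) oc sJ.
    by apply: smooth_fun_sub => y [jy ly]; split => //; exists y.
  apply: (smooth_fun_ext oDl _ st) => y [jy ly].
  rewrite [LHS]/comp [idfun y]/=.
  suff key : jacobian (coord l \o param j) (coord j y) = dparam j (coord j y) *m dcoord l y.
    exact: (etrans (congr1 (mulmx (E0 *m dcoord j p)) key) (mulmxA _ _ _)).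
  have -> : dcoord l y = mdiff (coord l : M -> euclid R n.*2) (param j (coord j y)) by
      rewrite coordK.
  rewrite -mdiff_comp //; first exact: mdifferentiable_param.
  by apply: mdifferentiable_coord; rewrite coordK.
pose D x := complex.Re (\det (gram x (E x) (E x))).
have sD : smooth_fun (dom j) (D : M -> R^o).
  have sf := smooth_map_sub (@subsetT _ (dom j)) (smooth_idfun M).
  have [] // := smooth_cfun_det oD (fun a b => smooth_gram oD sf a b sE sE).
have D0 : 0 < D p by rewrite /D Ep E0E0 det1 ltr01.
pose W := dom j `&` D @^-1` [set r | 0 < r].
have oW : open W.
  have oP : open ([set r | 0 < r] : set R) by exact: open_gt.
  apply: (open_preimage_on oD oP).
  by move=> x; exact: smooth_fun_continuous sD.
pose c x : R[i] := ((Num.sqrt (D x))^-1)%:C%C.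
have sc : smooth_cfun W c.
  split; last by move=> i; exact: smooth_on_cst.
  move=> i k; have oI := chart_image_open (i := i) oW.
  apply: (CkV oI).
    by move=> _ [x [ix [_ Dx]] <-] /=; rewrite coordK // gt_eqF // sqrtr_gt0.
  apply: (Ck_sqrt oI).
    by move=> _ [x [ix [_ Dx]] <-] /=; rewrite coordK.
  by apply: Ck_sub (sD i k); apply: image_subset => x [ix []].
exists W, (fun x => [ffun L => c x * wedge (J x) (E x) L]); split; first by split.
split => // [x [jx Dx]|x Wx].
  exists (c x), (E x); split => //.
  rewrite -/(gram_mx (om x) (J x) (E x) (E x)) (gram_det_real (omT x) (JJ x) (JomJ x)).
  rewrite -/(D x) normc_def /= expr0n addr0 sqrtr_sqr ger0_norm ?invr_ge0 ?sqrtr_ge0 //.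
  by rewrite -rmorphXn -rmorphM /= exprVn sqr_sqrtr ?(ltW Dx) // mulVf // gt_eqF.
exists W, c, E; split => //; apply: smooth_along_sub sE; exact: subIsetl.
Qed.

End bundle.

(** * Pullbacks and differences of connections *)

Section connections.
Variables (R : realType) (n : nat) (M : manifold R n.*2).
Variables (om J : M -> 'M[R]_(n.*2)).
Hypothesis om_symp : symplectic om.
Hypothesis J_comp : compatible om J.

Lemma connection_gauge (d : nat) (X : manifold R d) (f : X -> M) (VA W N : set X)
    (A : connection R n d X) (s t : X -> multivec R n) (g : X -> R[i]) x :
  hermitian_connection om J f VA A -> unit_section om J f W s ->
  open N -> N `<=` W -> N `<=` VA -> smooth_U1 N g ->
  (forall z, N z -> t z = [ffun L => g z * s z L]) -> N x ->
  A t x = A s x + dlog g x.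
Proof.
move=> hA us oN NW NV sg ts Nx.
have usN := unit_section_sub oN NW us.
by have [_ H] := hA N s NV usN; exact: H.
Qed.

(* The set in [pullback] is a singleton: two sections [s' = h s] give
   [A s' = A s + dlog h] and [g = g' (h o phi)]. *)
Lemma pullbackE (d e : nat) (X : manifold R d) (Y : manifold R e) (f : X -> M)
    (phi : Y -> X) (VA W : set X) (VY N : set Y) (A : connection R n d X)
    (s : X -> multivec R n) (t : Y -> multivec R n) (g : Y -> R[i]) y :
  open VA -> smooth_map VA f -> hermitian_connection om J f VA A ->
  open VY -> smooth_map VY phi -> VY y -> VA (phi y) ->
  unit_section om J f W s -> W (phi y) -> open N -> N y -> smooth_U1 N g ->
  (forall z, N z -> W (phi z) -> t z = [ffun L => g z * s (phi z) L]) ->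
  pullback om J f phi A t y = pull1 phi (A s) y + dlog g y.
Proof.
move=> oVA sf hA oVY sphi VYy VAy us Wy oN Ny sg ts.
apply: xget_unique; first by exists W, s, N, g; split.
move=> b [W' [s' [N' [g' [us' W'y [oN' N'y] sg' [ts' ->]]]]]].
have [oW us1 _] := us; have [oW' _ _] := us'.
have [h sh hs] := unit_section_transition om_symp J_comp oVA sf us us'.
set Q := VA `&` (W `&` W') in sh hs.
have oQ : open Q by repeat apply: openI.
have Qy : Q (phi y) by [].
have As' : A s' (phi y) = A s (phi y) + dlog h (phi y).
  by apply: (connection_gauge hA us oQ _ _ sh hs Qy) => z [? []].
have dphi := smooth_mdifferentiable sphi VYy.
have dh := smooth_mdifferentiable_cfun sh.1 Qy.
pose Z := N `&` N' `&` (VY `&` phi @^-1` Q).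
have oZ : open Z.
  by apply: openI; [exact: openI|apply: open_preimage_on => //; case: sphi].
have gE z : Z z -> g z = g' z * h (phi z).
  move=> [[Nz N'z] [VYz Qz]]; have [_ [Wz W'z]] := Qz.
  apply: (unit_vector_scaleI J_comp (us1 _ Wz)).
  rewrite -(ts _ Nz Wz) (ts' _ N'z W'z); apply/ffunP => L.
  by rewrite !ffunE (hs _ Qz) ffunE mulrA.
have dg : dlog g y = dlog g' y + mdiff phi y *m dlog h (phi y).
  have Zy : Z y by [].
  rewrite (near_eq_dlog (open_near_eq oZ gE Zy)).
  have dhp := dlog_comp dphi dh.
  have sU : smooth_U1 (VY `&` phi @^-1` Q) (h \o phi) by apply: smooth_U1_comp.
  rewrite -dhp; apply: dlogM.
  - exact: smooth_mdifferentiable_cfun sg'.1 N'y.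
  - by apply: smooth_mdifferentiable_cfun sU.1 _.
  - by case: sg' => _; apply.
  - by case: sU => _; apply.
by rewrite dg /pull1 As' mulmxDr -addrA; congr (_ + _); rewrite addrC.
Qed.

(** One section shows that the candidate set is nonempty; independence of the section, the last
    hypothesis, makes it a singleton. *)
Lemma connection_diffE (d : nat) (X : manifold R d) (f : X -> M)
    (A B : connection R n d X) (W : set X) (s : X -> multivec R n) x b :
  unit_section om J f W s -> W x ->
  (forall W' t, unit_section om J f W' t -> W' x -> A t x - B t x = b) ->
  connection_diff om J f A B x = b.
Proof.
move=> us Wx H; apply: xget_unique.
  by exists W, s; split => //; rewrite (H W).
by move=> y [W' [t [ut W't ->]]]; exact: (H W' t ut W't).
Qed.

(** * Comparison of the connections along the boundary loop *)

Section section_at_boundary.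
Variables (k : R) (S : manifold R n) (iota : S -> M).
Variables (a : connection R n n.*2 M) (A0 : connection R n n S) (gS : S -> R[i]).
Hypothesis siota : smooth_map setT iota.
Hypothesis ha : hermitian_connection om J idfun setT a.
Hypothesis hA0 : hermitian_connection om J iota setT A0.
Hypothesis hgS : maslov_gauge om J iota a A0 gS.

(** The gauge equation defining [gS], read off in the pullback of a section of the bundle over [M];
    it eliminates [A0] in favour of the reference connection. *)
Lemma canonical_trivial_section (W : set M) (s : M -> multivec R n) (x : S) :
  unit_section om J idfun W s -> W (iota x) ->
  A0 (s \o iota) x = mdiff iota x *m a s (iota x) - dlog gS x.
Proof.
move=> us Wx.
have usi : unit_section om J iota (setT `&` iota @^-1` (setT `&` W)) (s \o iota).
  exact: (unit_section_comp openT (smooth_idfun M) openT siota us).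
have [oWi _ _] := usi.
have Wi : (setT `&` iota @^-1` (setT `&` W)) x by [].
case: hgS => _ /(_ x);
    rewrite (connection_diffE (b := pull1 iota (a s) x - A0 (s \o iota) x) usi Wi).
  by move=> <-; rewrite /pull1 subKr.
(* Another section [t = h (s \o iota)] changes both connection forms by the same [dlog h], so the
   difference is unaffected. *)
move=> W' t ut W't; have [oW' _ _] := ut.
have [h sh hs] := unit_section_transition om_symp J_comp openT siota usi ut.
set Q := setT `&` _ in sh hs.
have oQ : open Q by apply: openI; [exact: openT|exact: openI].
have Qx : Q x by [].
rewrite (connection_gauge hA0 usi oQ (fun z q => q.2.1) (@subsetT _ _) sh hs Qx).
rewrite /restrict (pullbackE (A := a) openT (smooth_idfun M) ha openT siota I I us Wx oQ Qx sh).
  by rewrite opprD addrACA subrr addr0.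
by move=> z Qz _; exact: hs.
Qed.

Variables (gamma : euclid R 1 -> S) (V : set (euclid R 2)).
Variables (u : euclid R 2 -> M) (Af : connection R n 2 (euclid R 2)).
Variable bdry : euclid R 1 -> euclid R 2.
Hypothesis sgamma : smooth_map setT gamma.
Hypothesis oV : open V.
Hypothesis su : smooth_map V u.
Hypothesis sbdry : smooth_map setT bdry.
Hypothesis bV : forall x, V (bdry x).
Hypothesis ub : forall x, u (bdry x) = iota (gamma x).
Hypothesis hAf : hermitian_connection om J u V Af.

(* The form [b] of the header. *)
Definition disc_form : euclid R 2 -> 'cV[R]_2 :=
  connection_diff om J u Af (pullback om J idfun u a).

(** In the section [s \o u] the pulled-back reference connection has form [pull1 u (a s)]; any other
    section adds one and the same [dlog h] to both terms. *)
Lemma disc_formE (W : set M) (s : M -> multivec R n) (z : euclid R 2) :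
  unit_section om J idfun W s -> W (u z) -> V z ->
  disc_form z = Af (s \o u) z - pull1 u (a s) z.
Proof.
move=> us Wz Vz.
have usu := unit_section_comp openT (smooth_idfun M) oV su us.
have [oWu _ _] := usu.
have Wu : (V `&` u @^-1` (setT `&` W)) z by [].
apply: (connection_diffE usu Wu) => W' t ut W't; have [oW' _ _] := ut.
have [h sh hs] := unit_section_transition om_symp J_comp oV su usu ut.
set Q := V `&` (_ `&` W') in sh hs.
have oQ : open Q by apply: openI => //; exact: openI.
have Qz : Q z by [].
rewrite (connection_gauge hAf usu oQ (fun z q => q.2.1) (fun z q => q.1) sh hs Qz).
rewrite (pullbackE (A := a) openT (smooth_idfun M) ha oV su Vz I us Wz oQ Qz sh).
  by rewrite opprD addrACA subrr addr0.
by move=> y Qy _; exact: hs.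
Qed.

(** In one section [s] near [iota (gamma x)], the form of [Af] is that of $b$ plus the pullback of
    [a s] by [u], and the form of [A0] is the pullback of [a s] by [iota] minus [dlog gS]. On the
    loop the two pullbacks of [a s] coincide and cancel. *)
Lemma boundary_form x :
  connection_diff om J (iota \o gamma) (pullback om J u bdry Af)
    (pullback om J iota gamma A0) x
  = pull1 bdry disc_form x + dlog (gS \o gamma) x.
Proof.
have [W [s [Wp us]]] := unit_section_exists om_symp J_comp (iota (gamma x)).
have usi : unit_section om J iota (setT `&` iota @^-1` (setT `&` W)) (s \o iota).
  exact: (unit_section_comp openT (smooth_idfun M) openT siota us).
have usu := unit_section_comp openT (smooth_idfun M) oV su us.
have usg := unit_section_comp openT siota openT sgamma usi.
have sig := smooth_map_comp openT openT sgamma siota.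
rewrite preimage_setT setTI in sig.
have Wg : (setT `&` gamma @^-1` (setT `&` (setT `&` iota @^-1` (setT `&` W)))) x by [].
apply: (connection_diffE usg Wg) => W' t ut W't; have [oW' _ _] := ut; have [oWg _ _] := usg.
have [h sh hs] := unit_section_transition om_symp J_comp openT sig usg ut.
set Q := setT `&` (_ `&` W') in sh hs.
have oQ : open Q by apply: openI; [exact: openT|exact: openI].
have Qx : Q x by [].
have Wb : (V `&` u @^-1` (setT `&` W)) (bdry x).
  by split => //; split => //; rewrite /preimage /= ub.
have Wi : (setT `&` iota @^-1` (setT `&` W)) (gamma x) by [].
(* The same factor [h] serves for [Af] and for [A0], since [s \o u] and [s \o iota] agree along the
   loop by [ub]; both terms [dlog h] then cancel. *)
rewrite (pullbackE oV su hAf openT sbdry I (bV x) usu Wb oQ Qx sh); last first.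
  by move=> z Qz _; rewrite (hs _ Qz); apply/ffunP => L; rewrite !ffunE /= ub.
rewrite (pullbackE openT siota hA0 openT sgamma I I usi Wi oQ Qx sh); last first.
  by move=> z Qz _; rewrite (hs _ Qz).
rewrite opprD addrACA subrr addr0 /pull1.
rewrite (canonical_trivial_section us Wp).
have Wb' : W (u (bdry x)) by rewrite ub.
rewrite (disc_formE us Wb' (bV x)) /pull1.
have dg := smooth_mdifferentiable sgamma (I : setT x).
have di := smooth_mdifferentiable siota (I : setT (gamma x)).
have db := smooth_mdifferentiable sbdry (I : setT x).
have du := smooth_mdifferentiable su (bV x).
rewrite (dlog_comp dg); last by case: hgS => -[sg _] _;
    exact: (smooth_mdifferentiable_cfun (V := setT) sg).
(* The chain rule applied to the two factorizations of the loop in [M]. *)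
have E : mdiff bdry x *m mdiff u (bdry x) = mdiff gamma x *m mdiff iota (gamma x).
  by rewrite -(mdiff_comp db du) -(mdiff_comp dg di); congr (mdiff _ x); apply/funext => z;
      exact: ub.
by rewrite !mulmxBr !mulmxA E ub opprB addrA addrAC.
Qed.

End section_at_boundary.
End connections.

(** * The exterior derivative commutes with pullbacks *)

Section exterior_derivative.
Variable R : realType.

(** * Symmetry of second derivatives *)

Section schwarz.
Variables (d : nat) (U : set 'rV[R]_d) (f : 'rV[R]_d -> R^o).
Hypothesis oU : open U.
Hypothesis f2 : Ck 2 U f.

Lemma is_derive_line (g : 'rV[R]_d -> R^o) (p v : 'rV[R]_d) (s : R) :
  differentiable g (p + s *: v) ->
  is_derive s (1 : R) (fun r : R => g (p + r *: v) : R) ('D_v g (p + s *: v)).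
Proof.
move=> dg; have dv := diff_derivable (v := v) dg.
have e : (fun h : R => h^-1 *: (((fun r : R => g (p + r *: v) : R^o) \o shift s) (h *: (1 : R)) -
    g (p + s *: v))) = (fun h : R => h^-1 *: ((g \o shift (p + s *: v)) (h *: v) - g (p + s
        *: v))).
  by apply/funext => h /=; rewrite [h *: 1]mulr1 scalerDl addrCA.
apply: DeriveDef; first by move: dv; rewrite /derivable -e.
by rewrite /derive -e.
Qed.

(* The left-hand side is symmetric in [v] and [w]. *)
Lemma second_difference (x v w : 'rV[R]_d) (h : R) : 0 < h ->
  (forall s t : R, 0 <= s <= h -> 0 <= t <= h -> U (x + s *: v + t *: w)) ->
  exists s t : R, [/\ 0 < s < h, 0 < t < h &
    f (x + h *: v + h *: w) - f (x + h *: v) - f (x + h *: w) + f x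
    = h ^+ 2 * 'D_w ('D_v f) (x + s *: v + t *: w)].
Proof.
move=> h0 Ux; have [df Df] := f2; have [dDf _] := Df v.
have hh : 0 <= h <= h by rewrite lexx ltW.
have h00 : 0 <= (0:R) <= h by rewrite lexx ltW.
pose g (s : R) : R := f ((x + h *: w) + s *: v) - f (x + s *: v).
pose dg (s : R) : R := 'D_v f ((x + h *: w) + s *: v) - 'D_v f (x + s *: v).
have gd s : 0 <= s <= h -> is_derive s (1 : R) g (dg s).
  move=> sh; apply: is_deriveB; apply: is_derive_line; apply: df.
    by rewrite addrAC; exact: Ux.
  by have := Ux s 0 sh h00; rewrite scale0r addr0.
have gc : {within `[0, h], continuous g}.
  apply: derivable_within_continuous => s; rewrite in_itv /= => sh.
  by apply: ex_derive; exact: gd.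
have [|s shi gs] := @MVT R g dg 0 h h0 _ gc.
  by move=> s; rewrite in_itv /= => /andP[s0 sh]; apply: gd; rewrite !ltW.
rewrite in_itv /= in shi.
have sh : 0 <= s <= h by case/andP: shi => ? ?; rewrite !ltW.
pose k (t : R) : R := 'D_v f ((x + s *: v) + t *: w).
pose dk (t : R) : R := 'D_w ('D_v f) ((x + s *: v) + t *: w).
have kd t : 0 <= t <= h -> is_derive t (1 : R) k (dk t).
  by move=> th; apply: is_derive_line; apply: dDf; exact: Ux.
have kc : {within `[0, h], continuous k}.
  apply: derivable_within_continuous => t; rewrite in_itv /= => th.
  by apply: ex_derive; exact: kd.
have [|t thi kt] := @MVT R k dk 0 h h0 _ kc.
  by move=> t; rewrite in_itv /= => /andP[t0 th]; apply: kd; rewrite !ltW.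
rewrite in_itv /= in thi.
exists s, t; split => //.
transitivity (g h - g 0).
  rewrite /g scale0r !addr0 (addrAC x).
  by ring.
rewrite gs; have -> : dg s = k h - k 0.
  by rewrite /dg /k scale0r addr0 (addrAC x).
by rewrite kt /dk !subr0; ring.
Qed.

End schwarz.

(** Both mixed derivatives, at suitable points near [x], equal the same second difference divided by
    $h^2$; continuity brings each within [e / 2] of its value at [x]. *)
Lemma derive_swap (d : nat) (U : set 'rV[R]_d) (f : 'rV[R]_d -> R^o) (x v w : 'rV[R]_d) :
  open U -> Ck 2 U f -> U x -> 'D_w ('D_v f) x = 'D_v ('D_w f) x.
Proof.
move=> oU f2 Ux.
have cwv : {for x, continuous ('D_w ('D_v f))}.
  by have [_ /(_ v) [_ /(_ w) c]] := f2; exact: c.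
have cvw : {for x, continuous ('D_v ('D_w f))}.
  by have [_ /(_ w) [_ /(_ v) c]] := f2; exact: c.
apply/eqP; rewrite -subr_eq0 -normr_le0; apply/ler_addgt0Pr => e e0; rewrite add0r.
have e20 : 0 < e / 2 by rewrite divr_gt0.
have n0 : nbhs x U by exact: open_nbhs_nbhs.
have /cvgrPdist_le/(_ _ e20) n1 := cwv.
have /cvgrPdist_le/(_ _ e20) n2 := cvw.
case: ((nbhs_ballP _ _).1 (filterI n0 (filterI n1 n2))) => r /= r0 rP.
(* The points of the parallelogram lie at distance at most $h(|v|+|w|) < hN = r/2$ from [x]; the
   summand 1 keeps [N] positive when both vectors vanish. *)
pose N := `|v| + `|w| + 1.
have N0 : 0 < N by rewrite ltr_wpDl // addr_ge0.
pose h := r / N / 2.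
have h0 : 0 < h by rewrite !divr_gt0.
have near s t : 0 <= s <= h -> 0 <= t <= h -> ball x r (x + s *: v + t *: w).
  move=> /andP[s0 sh] /andP[t0 th];
      rewrite -ball_normE /ball_ /= -addrA opprD addrA subrr add0r normrN.
  apply: (le_lt_trans (ler_normD _ _)); rewrite !normrZ !ger0_norm //.
  apply: (@le_lt_trans _ _ (h * (`|v| + `|w|))).
    by rewrite mulrDr lerD // ler_wpM2r.
  apply: (@lt_trans _ _ (h * N)); first by rewrite ltr_pM2l // ltrDl.
  rewrite /h -mulrA (mulrC 2^-1) mulrA divfK ?gt_eqF //.
  by rewrite ltr_pdivrMr // ltr_pMr // ltr1n.
have [s [t [/andP[s0 sh] /andP[t0 th] E1]]] :=
  @second_difference d U f f2 x v w h h0 (fun s t a b => (rP _ (near s t a b)).1).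
have near' s1 t1 : 0 <= s1 <= h -> 0 <= t1 <= h -> U (x + s1 *: w + t1 *: v).
  by move=> a b; rewrite addrAC; exact: (rP _ (near t1 s1 b a)).1.
have [s' [t' [/andP[s'0 s'h] /andP[t'0 t'h] E2]]] := @second_difference d U f f2 x w v h h0 near'.
have EE : 'D_w ('D_v f) (x + s *: v + t *: w) = 'D_v ('D_w f) (x + t' *: v + s' *: w).
  have h2 : h ^+ 2 != 0 by rewrite expf_neq0 // gt_eqF.
  have ex : 'D_v ('D_w f) (x + t' *: v + s' *: w) = 'D_v ('D_w f) (x + s' *: w + t' *: v).
    by congr ('D_v ('D_w f) _); exact: addrAC.
  apply: (mulfI h2); apply: (etrans (esym E1)); apply: esym.
  apply: (etrans (congr1 (fun z => h ^+ 2 * z) ex)); apply: (etrans (esym E2)).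
  have -> : x + h *: w + h *: v = x + h *: v + h *: w by exact: addrAC.
  by move: (f _) (f _) (f _) (f _) => p1 p2 p3 p4; ring.
have b1 : `|'D_w ('D_v f) x - 'D_w ('D_v f) (x + s *: v + t *: w)| <= e / 2.
  by apply: (rP _ (near s t _ _)).2.1; rewrite !ltW.
have b2 : `|'D_v ('D_w f) x - 'D_v ('D_w f) (x + t' *: v + s' *: w)| <= e / 2.
  by apply: (rP _ (near t' s' _ _)).2.2; rewrite !ltW.
rewrite -EE in b2.
rewrite (splitr e); apply: (le_trans (ler_distD _ _ _) (lerD b1 _)).
by rewrite distrC.
Qed.

Lemma euclid_chart1 (d : nat) (b : euclid R d -> 'cV[R]_d) (i : chart (euclid R d)) :
  chart1 i b = b.
Proof.
apply/funext => y; rewrite /chart1 /pull1.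
by rewrite [X in X *m _](_ : _ = 1%:M) ?mul1mx // -[RHS](@mdiff_id R d (euclid R d) y).
Qed.

Lemma euclid_dform (d : nat) (b : euclid R d -> 'cV[R]_d) (y : euclid R d) a c :
  dform b y a c = partial a (fun z => b z c 0) y - partial c (fun z => b z a 0) y.
Proof. by rewrite mxE euclid_chart1. Qed.

Lemma pull1_chart (d m : nat) (M : manifold R m) (u : euclid R d -> M)
    (j : chart M) (al : M -> 'cV[R]_m) z :
  mdifferentiable u z -> dom j (u z) ->
  pull1 u al z = jacobian (coord j \o u : 'rV[R]_d -> 'rV[R]_m) z *m
     chart1 j al (coord j (u z)).
Proof.
move=> du ju.
have e1 : chart1 j al (coord j (u z)) = dparam j (coord j (u z)) *m al (u z).
  by rewrite /chart1 /pull1; congr (_ *m al _); exact: coordK.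
have e2 : jacobian (coord j \o u : 'rV[R]_d -> 'rV[R]_m) z = mdiff u z *m dcoord j (u z).
  rewrite -(mdiff_comp du (mdifferentiable_coord ju)).
  by [].
have e3 := dcoord_dparam ju.
apply: (etrans _ (esym (congr2 mulmx e2 e1))); rewrite /pull1.
move: (mdiff u z) (al (u z)) e3 => A b e3.
move: (dcoord j (u z)) (dparam j (coord j (u z))) e3 => C D CD.
by rewrite mulmxA -(mulmxA A) CD mulmx1.
Qed.

Lemma smooth_on_chart (d m : nat) (M : manifold R m) (u : euclid R d -> M)
    (V : set (euclid R d)) (j : chart M) k : open V -> smooth_map V u ->
  Ck k (V `&` u @^-1` dom j) (coord j \o u : 'rV[R]_d -> 'rV[R]_m).
Proof.
move=> oV [_ /(_ tt j k)] /=; rewrite image_id; apply: Ck_sub => z [Vz jz]; by split.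
Qed.

(** * Pullbacks of 1-forms in coordinates *)

Section pullback_form.
Variables (d m : nat) (M : manifold R m) (u : euclid R d -> M).
Variables (V : set (euclid R d)) (W : set M) (al : M -> 'cV[R]_m).
Hypotheses (oV : open V) (su : smooth_map V u) (oW : open W) (sal : smooth_form1 W al).

Lemma smooth_chart1 (j : chart M) k (N : set (euclid R d)) : open N ->
  N `<=` V `&` u @^-1` (dom j `&` W) ->
  Ck k N ((chart1 j al : 'rV[R]_m -> 'cV[R]_m) \o (coord j \o u : 'rV[R]_d -> 'rV[R]_m)).
Proof.
move=> oN NV; have oI := chart_image_open (i := j) oW.
apply: (Ck_comp oN oI _ _ (sal j k)).
  by move=> z /NV [_ [jz Wz]]; exists (u z).
by apply: Ck_sub (smooth_on_chart j k oV su) => z /NV [Vz []].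
Qed.

Lemma smooth_pull1 : smooth_form1 (V `&` u @^-1` W) (pull1 u al).
Proof.
move=> [] k; rewrite euclid_chart1 /= image_id setTI.
apply: Ck_local => z [Vz Wz]; set j := at_chart (u z).
have jz : dom j (u z) by exact: at_chartP.
pose N := V `&` u @^-1` (dom j `&` W).
have oN : open N.
  by apply: open_preimage_on => //; [apply: openI => //; exact: dom_open|case: su].
exists N; first by [].
have c1 := smooth_chart1 (j := j) k oN (fun z x => x).
have cU : Ck k.+1 N (coord j \o u : 'rV[R]_d -> 'rV[R]_m).
  by apply: Ck_sub (smooth_on_chart j _ oV su) => y [Vy []].
apply: (Ck_ext oN _ (Ck_mulmx oN (Ck_jacobian oN cU) c1)) => y [Vy [jy _]].
by rewrite (pull1_chart _ _ jy) //; exact: smooth_mdifferentiable su Vy.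
Qed.

(** The pullback is the Jacobian of [F] times [B \o F]. Its first derivatives contain second
    derivatives of [F], symmetric by [derive_swap], which drop out of the antisymmetrization; the
    rest is $dB$ between two Jacobians. *)
Lemma dform_pull1 z : V z -> W (u z) -> dform (pull1 u al) z = pull2 u (dform al) z.
Proof.
move=> Vz Wz; set j := at_chart (u z).
have jz : dom j (u z) by exact: at_chartP.
pose N := V `&` u @^-1` (dom j `&` W).
have oN : open N.
  by apply: open_preimage_on => //; [apply: openI => //; exact: dom_open|case: su].
have Nz : N z by [].
pose F : 'rV[R]_d -> 'rV[R]_m := coord j \o u.
have cF k : Ck k N F.
  by apply: Ck_sub (smooth_on_chart j _ oV su) => y [Vy []].
have dF : differentiable F z by have [dF _] := cF 1%N; exact: dF.
pose B : 'rV[R]_m -> 'cV[R]_m := chart1 j al.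
have oI := chart_image_open (i := j) oW.
have dB : differentiable B (F z).
  by have [dB _] := sal j 1%N; apply: dB; exists (u z).
have dBi b : differentiable (fun y => B y b 0 : R^o) (F z).
  exact: (differentiable_mxP B (F z)).1.
have dFi b : differentiable (fun y => F y 0 b : R^o) z.
  exact: (differentiable_mxP F z).1.
have D2 a b : differentiable (fun y => 'D_(delta_mx 0 a) (fun y => F y 0 b : R^o) y : R^o) z.
  have /Ck_mxP/(_ 0 b) [//|_ /(_ (delta_mx 0 a)) [dd _]] := cF 2%N.
  exact: dd.
(* Product rule: the first summand differentiates [B \o F] by the chain rule, the second
   differentiates the Jacobian. *)
have E a c : partial a (fun y => pull1 u al y c 0) z =
   \sum_b (partial c (fun y => F y 0 b) z * (\sum_e partial a (fun y => F y 0 e) z *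
       partial e (fun y => B y b 0) (F z)) +
     B (F z) b 0 * 'D_(delta_mx 0 a) (fun y => 'D_(delta_mx 0 c) (fun y => F y 0 b : R^o) y) z).
  rewrite /partial.
  transitivity ('D_(delta_mx 0 a) (\sum_b ((fun y => 'D_(delta_mx 0 c) (fun y => F y 0 b :
      R^o) y : R^o) *
     ((fun y => B y b 0 : R^o) \o F))) z).
    apply: near_eq_derive; apply: (open_near_eq oN) Nz => y [Vy [jy Wy]].
    rewrite (pull1_chart _ (smooth_mdifferentiable su Vy) jy) mxE fct_sumE.
    apply: eq_bigr => b _; rewrite jacobian_entry //.
    by have [dFF _] := cF 1%N; apply: dFF.
  have dcB b : differentiable ((fun y => B y b 0 : R^o) \o F) z by exact: differentiable_comp.
  rewrite derive_sum; last first.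
    by move=> b; apply: derivableM; exact: diff_derivable.
  apply: eq_bigr => b _; rewrite deriveM; try exact: diff_derivable.
  by rewrite derive_comp_rV.
apply/matrixP => a c; rewrite euclid_dform !E -sumrB.
(* Holds by definition because [j] was taken to be the preferred chart at [u z]. *)
have mF : mdiff u z = jacobian F z by [].
have sw b : 'D_(delta_mx 0 a) (fun y => 'D_(delta_mx 0 c) (fun y => F y 0 b : R^o) y) z
  = 'D_(delta_mx 0 c) (fun y => 'D_(delta_mx 0 a) (fun y => F y 0 b : R^o) y) z.
  apply: (derive_swap (U := N)) => //.
  by have /Ck_mxP/(_ 0 b) := cF 2%N; apply.
rewrite /pull2 mF mxE.
pose P (i : 'I_d) (b : 'I_m) := partial i (fun y => F y 0 b) z.
pose Q (e b : 'I_m) := partial e (fun y => B y b 0) (F z).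
transitivity (\sum_b (P c b * (\sum_e P a e * Q e b) - P a b * (\sum_e P c e * Q e b))).
  by apply: eq_bigr => b _; rewrite (sw b) opprD addrACA subrr addr0.
transitivity (\sum_b (\sum_e P a e * (Q e b - Q b e)) * P c b); last first.
  apply: eq_bigr => b _;
      rewrite [X in _ = X * _]mxE [X in _ = _ * X]mxE jacobian_entry // -/(P c b); congr (_ * _).
  by apply: eq_bigr => e _; rewrite jacobian_entry // mxE.
under eq_bigr do rewrite mulr_sumr mulr_sumr -sumrB.
under [RHS]eq_bigr do rewrite mulr_suml.
under eq_bigr do rewrite sumrB.
rewrite sumrB.
under [RHS]eq_bigr => b _.
  under eq_bigr do rewrite mulrBr mulrBl.
  rewrite sumrB; over.
rewrite sumrB; congr (_ - _).
  by apply: eq_bigr => b _; apply: eq_bigr => e _; ring.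
(* The negative halves match after exchanging the names of the summation indices. *)
rewrite exchange_big; apply: eq_bigr => b _; apply: eq_bigr => e _; ring.
Qed.

End pullback_form.
End exterior_derivative.

(** * Primitives and degrees *)

Section one_variable.
Variable R : realType.
Local Notation mu := (@lebesgue_measure R).

Lemma is_derive_continuous (F : R -> R) (x l : R) :
  is_derive x (1 : R) F l -> {for x, continuous F}.
Proof.
by move=> dF; apply/differentiable_continuous/derivable1_diffP; exact: ex_derive.
Qed.

Lemma continuous_itv_integrable (f : R -> R) (a b : R) : continuous f ->
  mu.-integrable `[a, b] (EFin \o f).
Proof.
move=> cf; apply: continuous_compact_integrable; first exact: segment_compact.
exact: continuous_subspaceT.
Qed.

Lemma is_derive_ext (f g : R -> R) (x d e : R) :
  is_derive x (1 : R) f d -> f =1 g -> d = e -> is_derive x (1 : R) g e.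
Proof. by move=> df /funext <- <-. Qed.

(** The case [a = b] is allowed for the sake of the degenerate chords at the top and bottom of the
    disc; the derivative is asked for only inside, since [q] is controlled only near the disc. *)
Lemma integral_FTC2_EFin (f F : R -> R) (a b : R) : a <= b ->
  {within `[a, b], continuous f} -> {within `[a, b], continuous F} ->
  (forall x, a < x < b -> is_derive x (1 : R) F (f x)) ->
  (\int[mu]_(x in `[a, b]) (f x)%:E = (F b - F a)%:E)%E.
Proof.
rewrite le_eqVlt => /predU1P[-> _ _ _|ab cf cF dF].
  by rewrite set_itv1 integral_set1 subrr.
have [_ ra lb] := (continuous_within_itvP F ab).1 cF.
have dl : derivable_oo_LRcontinuous F a b.
  split => // x; rewrite in_itv /= => xab.
  by apply: ex_derive; exact: dF.
have Ff : {in `]a, b[, derive1 F =1 f}.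
  move=> x; rewrite in_itv /= => xab; rewrite derive1E.
  by have := dF _ xab => dFx; exact: derive_val.
by rewrite (continuous_FTC2 ab cf dl Ff) EFinB.
Qed.

Lemma integral_FTC2 (f F : R -> R) (a b : R) : a <= b ->
  {within `[a, b], continuous f} -> {within `[a, b], continuous F} ->
  (forall x, a < x < b -> is_derive x (1 : R) F (f x)) ->
  \int[mu]_(x in `[a, b]) f x = F b - F a.
Proof. by move=> ab cf cF dF; rewrite /Rintegral (integral_FTC2_EFin ab cf cF dF). Qed.

Lemma integral_derive (f F : R -> R) (a b : R) : a <= b -> continuous f ->
  (forall x, is_derive x (1 : R) F (f x)) ->
  \int[mu]_(x in `[a, b]) f x = F b - F a.
Proof.
move=> ab cf dF; apply: integral_FTC2 => //.
  exact: continuous_subspaceT.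
by apply: continuous_subspaceT => x; exact: is_derive_continuous (dF x).
Qed.

Lemma primitive_exists (f : R -> R) : continuous f ->
  exists F : R -> R, forall x, is_derive x (1 : R) F (f x).
Proof.
move=> cf.
(* The oriented integral from 0 to [x]: an integral over an interval with reversed endpoints is 0,
   so one of the two terms is always zero. *)
pose F x := \int[mu]_(t in `[0, x]) f t - \int[mu]_(t in `[x, 0]) f t.
exists F => x; pose a : R := - (`|x| + 1); pose b : R := `|x| + 1.
have ax : a < x by rewrite /a ltrNl; apply: (le_lt_trans (ler_norm _)); rewrite normrN ltrDl.
have xb : x < b by rewrite /b; apply: (le_lt_trans (ler_norm _)); rewrite ltrDl.
have a0 : a < 0 by rewrite /a oppr_lt0 ltr_wpDl.
have [dG Gx] := continuous_FTC1_closed xb (continuous_itv_integrable a b cf) ax (cf x).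
set G := (fun y => \int[mu]_(t in `[a, y]) f t) in dG Gx.
(* To the right of [a], which lies below both 0 and [x], [F] differs by a constant from the integral
   [G] based at [a], to which the fundamental theorem applies. *)
have E y : a < y -> F y = G y - G 0.
  move=> ay; rewrite /F /G; case: (leP 0 y) => y0.
    have -> : \int[mu]_(t in `[y, 0]) f t = 0.
      move: y0; rewrite le_eqVlt => /predU1P[<-|y0]; first by rewrite set_itv1 Rintegral_set1.
      by rewrite set_itv_ge ?Rintegral_set0 // bnd_simp -ltNge.
    rewrite subr0 Rintegral_itvB ?bnd_simp ?(ltW a0) //; last exact: continuous_itv_integrable.
    rewrite Rintegral_itv_obnd_cbnd //.
    apply: integrableS (continuous_itv_integrable 0 y cf) => //.
    by apply: subset_itvr; rewrite bnd_simp.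
  rewrite [X in X - _](_ : _ = 0); last first.
    by rewrite set_itv_ge ?Rintegral_set0 // bnd_simp -ltNge.
  rewrite sub0r -opprB; congr (- _).
  rewrite Rintegral_itvB ?bnd_simp ?(ltW ay) ?(ltW y0) //; last exact: continuous_itv_integrable.
  rewrite Rintegral_itv_obnd_cbnd //.
  apply: integrableS (continuous_itv_integrable y 0 cf) => //.
  by apply: subset_itvr; rewrite bnd_simp.
have dGx : is_derive x (1 : R) (fun y => G y - G 0) (f x).
  rewrite -[f x]subr0; apply: is_deriveB.
  by rewrite -Gx derive1E; exact: derivableP.
apply: near_eq_is_derive dGx.
have : nbhs x [set y | a < y] by apply: open_nbhs_nbhs; split => //; exact: open_gt.
by apply: filterS => y /E.
Qed.

(** The increment over a period has zero derivative. This moves an integral over a period to any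
    other starting point. *)
Lemma primitive_shift (f F : R -> R) (T : R) : (forall x, f (x + T) = f x) ->
  (forall x, is_derive x (1 : R) F (f x)) ->
  forall x y, F (x + T) - F x = F (y + T) - F y.
Proof.
move=> fT dF x y.
apply: (@is_derive_0_is_cst R (fun z => F (z + T) - F z)) => z.
rewrite -[0](subrr (f z)) -{1}fT; apply: is_deriveB.
have := @is_derive1_comp R F (fun z => z + T) z (f (z + T)) 1 (dF _).
rewrite mulr1; apply.
exact: is_derive_shift.
Qed.

Lemma cos_sin_shift (x : R) (m : int) :
  cos (x + 2 * pi * m%:~R) = cos x /\ sin (x + 2 * pi * m%:~R) = sin x.
Proof.
have H (k : nat) (y : R) : cos (y + 2 * pi * k%:R) = cos y /\ sin (y + 2 * pi * k%:R) = sin y.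
  have e : y + 2 * pi * k%:R = y + (pi *+ 2) *+ k by rewrite mulr_natr mulr_natl.
  by rewrite e; split; apply: periodicn; [exact: cosD2pi|exact: sinD2pi].
case: m => k; first by exact: H.
rewrite NegzE mulrNz mulrN; have [<- <-] := H k.+1 (x - 2 * pi * k.+1%:R).
by rewrite subrK.
Qed.

(** Reducing the difference modulo $2\pi$ gives [z] in $[0, 2\pi)$ with cosine 1, so $\sin(z/2) =
    0$, whereas sine is positive on $(0,\pi)$. *)
Lemma cos_sin_inj (x y : R) : cos x = cos y -> sin x = sin y ->
  exists m : int, x - y = 2 * pi * m%:~R.
Proof.
move=> cxy sxy.
have pi2 : 0 < 2 * pi :> R by rewrite mulr_gt0 // pi_gt0.
pose m := Num.floor ((x - y) / (2 * pi)); exists m.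
pose z := x - y - 2 * pi * m%:~R.
have z0 : 0 <= z.
  by rewrite /z subr_ge0 mulrC -ler_pdivlMr //; exact: ge_floor.
have zp : z < 2 * pi.
  have := floorD1_gt ((x - y) / (2 * pi)); rewrite -/m ltr_pdivrMr // intrD => h.
  by rewrite /z; lra.
have cz : cos z = 1.
  have [<- _] := cos_sin_shift z m; rewrite /z subrK cosB cxy sxy -!expr2.
  exact: cos2Dsin2.
have : z = 0.
  move: z0; rewrite le_eqVlt => /predU1P[//|z0].
  have s0 : 0 < sin (z / 2).
    apply: sin_gt0_pi; rewrite divr_gt0 //= ltr_pdivrMr // mulrC //.
  have e : (z / 2) *+ 2 = z by rewrite mulr2n -splitr.
  have := cos_mulr2n (z / 2); rewrite e cz cos2sin2 => h.
  have : sin (z / 2) ^+ 2 = 0 by move: h; rewrite mulr2n; lra.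
  by move/eqP; rewrite expf_eq0 /= gt_eqF.
by rewrite /z => /eqP; rewrite subr_eq0 => /eqP.
Qed.

(** Two distinct integer values would force, by the intermediate value theorem, a half-integer
    value, and twice an integer would equal 1. *)
Lemma integer_valued_constant (f : R -> R) (a b : R) : a <= b -> continuous f ->
  (forall t, exists m : int, f t = m%:~R) -> f a = f b.
Proof.
move=> ab cf fm; apply/eqP/negPn/negP => fab.
have [ma fa] := fm a; have [mb fb] := fm b.
have mab : ma != mb by apply: contraNneq fab => e; rewrite fa fb e.
pose v : R := if ma < mb then ma%:~R + 2^-1 else ma%:~R - 2^-1.
have vb : Num.min (f a) (f b) <= v <= Num.max (f a) (f b).
  rewrite /v fa fb; case: ltP => lab.
    have : (ma + 1)%:~R <= mb%:~R :> R by rewrite ler_int lezD1.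
    rewrite intrD /Order.min /Order.max ltr_int lab => h; apply/andP; split; lra.
  have {}lab : mb < ma by rewrite lt_neqAle eq_sym mab.
  have : (mb + 1)%:~R <= ma%:~R :> R by rewrite ler_int lezD1.
  rewrite intrD /Order.min /Order.max ltr_int ltNge (ltW lab) /= => h; apply/andP; split; lra.
have [c _ fc] := IVT ab (continuous_subspaceT cf) vb.
have [mc fc'] := fm c.
have [j jE] : exists j : int, (j%:~R : R) = 2^-1.
  move: fc; rewrite fc' /v; case: ifP => _ h.
    by exists (mc - ma); rewrite intrB; lra.
  by exists (ma - mc); rewrite intrB; lra.
have : (j + j)%:~R = 1%:~R :> R by rewrite intrD jE; lra.
move/intr_inj => jj.
have : odd `|(j + j)%R|%N by rewrite jj.
by rewrite -mulr2n -mulr_natr abszM oddM andbF.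
Qed.

(* A primitive [th] of [Re c Im c' - Im c Re c'] is an angle function of [c], since
   [c e^{- i th}] has zero derivative. *)
Lemma degree_integral (c : R -> R[i]) (dp dq : R -> R) :
  (forall t, is_derive t (1 : R) (fun t => complex.Re (c t)) (dp t)) ->
  (forall t, is_derive t (1 : R) (fun t => complex.Im (c t)) (dq t)) ->
  continuous dp -> continuous dq ->
  (forall t, complex.Re (c t) ^+ 2 + complex.Im (c t) ^+ 2 = 1) ->
  c (2 * pi) = c 0 ->
  \int[mu]_(t in `[0, 2 * pi]) (complex.Re (c t) * dq t - complex.Im (c t) * dp t)
  = 2 * pi * (degree c)%:~R.
Proof.
set p := fun t => complex.Re (c t); set q := fun t => complex.Im (c t).
move=> hp hq cdp cdq pq1 c2.
pose w t := p t * dq t - q t * dp t.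
have cp : continuous p by move=> t; exact: is_derive_continuous (hp t).
have cq : continuous q by move=> t; exact: is_derive_continuous (hq t).
have cw : continuous w.
  move=> t; have c1 : {for t, continuous (fun t => p t * dq t)}.
    by apply: (@continuousM R); [exact: cp|exact: cdq].
  have c2' : {for t, continuous (fun t => q t * dp t)}.
    by apply: (@continuousM R); [exact: cq|exact: cdp].
  exact: (continuousB c1 c2').
have [F dF] := primitive_exists cw.
have pi2 : 0 < 2 * pi :> R by rewrite mulr_gt0 // pi_gt0.
rewrite (integral_derive (ltW pi2) cw dF).
(* The arccosine gives an angle with the right cosine; its sign is chosen to match the sign of
   [q 0]. *)
have [th0 [c0 s0]] : exists th, cos th = p 0 /\ sin th = q 0.
  have pb : -1 <= p 0 <= 1.
    rewrite -ler_norml -(@ler_pXn2r _ 2) ?nnegrE // expr1n real_normK ?num_real //.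
    by rewrite -(pq1 0) lerDl sqr_ge0.
  have sq : Num.sqrt (1 - p 0 ^+ 2) = `|q 0|.
    have -> : 1 - p 0 ^+ 2 = q 0 ^+ 2 by rewrite -(pq1 0) addrC addKr.
    exact: sqrtr_sqr.
  case: (leP 0 (q 0)) => q0.
    by exists (acos (p 0)); rewrite acosK ?in_itv //= sin_acos // sq ger0_norm.
  exists (- acos (p 0)); rewrite cosN sinN acosK ?in_itv //= sin_acos // sq ltr0_norm //.
  by rewrite opprK.
pose th t := th0 + (F t - F 0).
have dth t : is_derive t (1 : R) th (w t).
  rewrite /th -[w t]add0r; apply: is_deriveD; rewrite -[w t]subr0; apply: is_deriveB.
(* Differentiating $p^2 + q^2 = 1$: [c'] is orthogonal to [c], hence equal to [w] times [c] turned
   by a right angle, as the next two identities say. *)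
have pd t : p t * dp t + q t * dq t = 0.
  have h : is_derive t (1 : R) (fun t => p t ^+ 2 + q t ^+ 2) (2 * (p t * dp t + q t * dq t)).
    apply: (is_derive_ext (is_deriveD (is_deriveM (hp t) (hp t)) (is_deriveM (hq t) (hq
        t)))) => //.
    by rewrite /GRing.scale /= -/(p t) -/(q t); ring.
  have e : (fun t => p t ^+ 2 + q t ^+ 2) = (fun=> 1) by apply/funext => s; exact: pq1.
  rewrite e in h; have := @derive_val _ _ _ _ _ _ _ h; rewrite -[fun=> 1]/(cst 1) derive_cst.
  by lra.
have dpE t : dp t = - (q t * w t).
  have := pq1 t; rewrite -/(p t) -/(q t) => e; rewrite -[LHS]mul1r -e /w.
  transitivity (p t * (p t * dp t + q t * dq t) - q t * (p t * dq t - q t * dp t)); first by ring.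
  by rewrite pd mulr0 sub0r.
have dqE t : dq t = p t * w t.
  have := pq1 t; rewrite -/(p t) -/(q t) => e; rewrite -[LHS]mul1r -e /w.
  transitivity (q t * (p t * dp t + q t * dq t) + p t * (p t * dq t - q t * dp t)); first by ring.
  by rewrite pd mulr0 add0r.
have dc t : is_derive t (1 : R) (fun t => cos (th t)) (- sin (th t) * w t).
  exact: (@is_derive1_comp R (@cos R) th t _ _ (is_derive_cos _) (dth t)).
have ds t : is_derive t (1 : R) (fun t => sin (th t)) (cos (th t) * w t).
  exact: (@is_derive1_comp R (@sin R) th t _ _ (is_derive_sin _) (dth t)).
have th0E : th 0 = th0 by rewrite /th subrr addr0.
(* [A1] and [B0] are the real and imaginary parts of [c] times $e^{-i\,th}$: constant, and equal to
   1 and 0 at the start. *)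
have A1 t : p t * cos (th t) + q t * sin (th t) = 1.
  transitivity (p 0 * cos (th 0) + q 0 * sin (th 0)); last first.
    by rewrite th0E c0 s0 -!expr2; exact: pq1.
  apply: (@is_derive_0_is_cst R (fun t => p t * cos (th t) + q t * sin (th t))) => s.
  apply: (is_derive_ext (is_deriveD (is_deriveM (hp s) (dc s)) (is_deriveM (hq s) (ds s)))) => //.
  by rewrite /GRing.scale /= -/(p s) -/(q s) dpE dqE; ring.
have B0 t : q t * cos (th t) - p t * sin (th t) = 0.
  transitivity (q 0 * cos (th 0) - p 0 * sin (th 0)); last first.
    by rewrite th0E c0 s0 mulrC subrr.
  apply: (@is_derive_0_is_cst R (fun t => q t * cos (th t) - p t * sin (th t))) => s.
  apply: (is_derive_ext (is_deriveB (is_deriveM (hq s) (dc s)) (is_deriveM (hp s) (ds s)))) => //.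
  by rewrite /GRing.scale /= -/(p s) -/(q s) dpE dqE; ring.
have pE t : p t = cos (th t).
  transitivity (p t * (cos (th t) ^+ 2 + sin (th t) ^+ 2)); first by rewrite cos2Dsin2 mulr1.
  transitivity ((p t * cos (th t) + q t * sin (th t)) * cos (th t) -
     (q t * cos (th t) - p t * sin (th t)) * sin (th t)); first by ring.
  by rewrite A1 B0; ring.
have qE t : q t = sin (th t).
  transitivity (q t * (cos (th t) ^+ 2 + sin (th t) ^+ 2)); first by rewrite cos2Dsin2 mulr1.
  transitivity ((p t * cos (th t) + q t * sin (th t)) * sin (th t) +
     (q t * cos (th t) - p t * sin (th t)) * cos (th t)); first by ring.
  by rewrite A1 B0; ring.
have cth : continuous th by move=> t; exact: is_derive_continuous (dth t).
have cE t : c t = (cos (th t) +i* sin (th t))%C.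
  by rewrite -pE -qE /p /q; case: (c t).
have [m mE] : exists m : int, th (2 * pi) - th 0 = 2 * pi * m%:~R.
  by apply: cos_sin_inj; rewrite -?pE -?qE /p /q c2.
have Fth : F (2 * pi) - F 0 = th (2 * pi) - th 0 by rewrite th0E /th addrAC subrr add0r.
rewrite Fth mE; congr (_ * _%:~R); apply: esym; apply: xget_unique.
  by exists th.
move=> D [th' [cth' cE' DE]].
(* [degree] is chosen among all continuous lifts. Two lifts differ at each [t] by an integer
   multiple of $2\pi$, hence by a constant multiple, and so have the same increment. *)
have dm t : exists j : int, (th' t - th t) / (2 * pi) = j%:~R.
  have [j jE] : exists j : int, th' t - th t = 2 * pi * j%:~R.
    by apply: cos_sin_inj; have := cE' t; rewrite cE => -[].
  by exists j; rewrite jE mulrAC divff ?mul1r // gt_eqF.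
have cd : continuous (fun t => (th' t - th t) / (2 * pi)).
  move=> t; have c3 : {for t, continuous (fun t => th' t - th t)}.
    exact: (@continuousB R R^o R th' th t (cth' t) (cth t)).
  exact: (@continuousM R R _ (cst (2 * pi)^-1) t c3 (@cst_continuous _ _ _ t)).
have := integer_valued_constant (ltW pi2) cd dm.
have pi2V : (2 * pi)^-1 != 0 :> R by rewrite invr_eq0 gt_eqF.
move/(mulIf pi2V) => h.
apply: (@intr_inj R); apply: (mulfI (lt0r_neq0 pi2)); rewrite -DE -mE; lra.
Qed.

End one_variable.

(** * Green's theorem on the unit disc *)

Section green.
Variable R : realType.
Local Notation mu := (@lebesgue_measure R).
Local Notation T := (measurableTypeR R * measurableTypeR R)%type.
Local Notation D := (@unit_disc R).

(** An open set is the union of the boxes with rational endpoints that it contains, and these are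
    countably many. *)
Lemma open_measurable_prod (U : set (R * R)) : open U -> measurable (U : set T).
Proof.
move=> oU.
pose box (q : rat * rat * (rat * rat)) : set T :=
  [set` `]ratr q.1.1, ratr q.1.2[] `*` [set` `]ratr q.2.1, ratr q.2.2[].
pose F q := if `[< box q `<=` U >] then box q else set0.
have -> : U = \bigcup_q F q.
  apply/seteqP; split=> [[x y] Uxy|z [q _]]; last first.
    by rewrite /F; case: asboolP => // h /h.
  have [[A B] /= [nA nB] AB] : nbhs (x, y) U by exact: open_nbhs_nbhs.
  have rational (z : R) (C : set R) : nbhs z C -> exists a b : rat,
      ratr a < z < ratr b /\ (forall w, ratr a < w < ratr b -> C w).
    move=> /nbhs_ballP [e /= e0 eC].
    have /rat_in_itvoo[a /[!in_itv]/= /andP[a1 a2]] : z - e < z by rewrite ltrBlDr ltrDl.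
    have /rat_in_itvoo[b /[!in_itv]/= /andP[b1 b2]] : z < z + e by rewrite ltrDl.
    exists a, b; split; first by rewrite a2 b1.
    move=> w /andP[w1 w2]; apply: eC.
    rewrite /ball /= ltr_norml; apply/andP; split; lra.
  have [a [b [xab abA]]] := rational _ _ nA.
  have [c [d [ycd cdB]]] := rational _ _ nB.
  exists ((a, b), (c, d)) => //; rewrite /F; case: asboolP => [_|[]].
    by split; rewrite /= in_itv.
  by move=> [x' y'] []; rewrite /= !in_itv => /abA Ax /cdB By; apply: AB.
apply: countable_bigcupT_measurable; first exact: countableP.
move=> q; rewrite /F; case: asboolP => // _.
by apply: measurableX; exact: measurable_itv.
Qed.

Lemma continuous_pair (X Y Z : topologicalType) (f : X -> Y) (g : X -> Z) x :
  {for x, continuous f} -> {for x, continuous g} ->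
  {for x, continuous (fun x => (f x, g x))}.
Proof. by move=> cf cg; exact: (cvg_pair cf cg). Qed.

Lemma unit_disc_closed : closed D.
Proof.
rewrite -(setCK D); apply: open_closedC.
have -> : ~` D = (fun z : R * R => z.1 ^+ 2 + z.2 ^+ 2) @^-1` [set r | 1 < r].
  by apply/seteqP; split=> z /=; rewrite /unit_disc /= ltNge => /negP.
apply: open_comp; last exact: open_gt.
move=> z _.
have c1 : {for z, continuous (fun z : R * R => z.1 ^+ 2)}.
  exact: (@continuousM R (R * R)%type fst fst z cvg_fst cvg_fst).
have c2 : {for z, continuous (fun z : R * R => z.2 ^+ 2)}.
  exact: (@continuousM R (R * R)%type snd snd z cvg_snd cvg_snd).
exact: (@continuousD R R^o _ _ _ z c1 c2).
Qed.

Lemma unit_disc_box : D `<=` `[-1, 1] `*` `[-1, 1].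
Proof.
move=> [x y]; rewrite /unit_disc /= => h; rewrite !in_itv /= -!ler_norml.
have sq (a b : R) : a ^+ 2 + b ^+ 2 <= 1 -> `|a| <= 1.
  move=> ab; rewrite -(@ler_pXn2r _ 2) ?nnegrE // expr1n real_normK ?num_real //.
  by apply: le_trans ab; rewrite lerDl sqr_ge0.
by split; [exact: sq h|apply: (sq _ x); rewrite addrC].
Qed.

Lemma unit_disc_compact : compact D.
Proof.
apply: subclosed_compact unit_disc_closed _ unit_disc_box.
by apply: compact_setX; exact: segment_compact.
Qed.

Lemma unit_disc_measurable : measurable (D : set T).
Proof.
have := open_measurable_prod (closed_openC unit_disc_closed) => /measurableC.
by rewrite setCK.
Qed.

Lemma disc_integrable (O : set (R * R)) (f : R * R -> R) : open O -> D `<=` O ->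
  (forall z, O z -> {for z, continuous f}) ->
  (mu \x mu)%E.-integrable (D : set T) (EFin \o f).
Proof.
move=> oO DO cf; apply: measurable_bounded_integrable.
- exact: unit_disc_measurable.
- have mI : measurable ([set` `[-1, 1]] : set (measurableTypeR R)) by exact: measurable_itv.
  apply: (@le_lt_trans _ _ ((mu \x mu)%E ([set` `[-1, 1]] `*` [set` `[-1, 1]]))).
    apply: le_measure; rewrite ?inE //; first exact: unit_disc_measurable.
      exact: measurableX.
    exact: unit_disc_box.
  rewrite product_measure1E //.
  have m2 : mu [set` `[(-1 : R), 1]] = (2 : R)%:E.
    by rewrite lebesgue_measure_itv /= lte_fin gtrN // -EFinB opprK.
  rewrite -[ltLHS]/(mu [set` `[(-1 : R)%R, 1%R]] * mu [set` `[(-1 : R)%R, 1%R]])%E m2.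
  by rewrite -EFinM ltry.
- apply: (measurability _ (measurable_realfun.RGenOpens.measurableE R)).
  move=> _ [_ [a [b ->] <-]].
  (* [f] may be discontinuous off [O]; only its preimages within [O] are open. *)
  have -> : D `&` f @^-1` [set` `]a, b[] = D `&` (O `&` f @^-1` [set` `]a, b[]).
    by apply/seteqP; split=> z [Dz]; [move=> ?; split => //; split => //; exact: DO|move=> [_]].
  apply: measurableI; first exact: unit_disc_measurable.
  by apply: open_measurable_prod; apply: open_preimage_on.
- have : compact (f @` D).
    apply: continuous_compact; last exact: unit_disc_compact.
    by apply: continuous_in_subspaceT => z /set_mem /DO; exact: cf.
  move=> /compact_bounded [M [Mr H]]; exists M; split => // x Mx y Dy.
  by apply: H => //; exists y.
Qed.

(* The projection of [R] onto [-1, 1]; it extends functions of the height of a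
   chord of the disc to continuous functions on [R], which have primitives. *)
Definition clamp (y : R) : R := (`|y + 1| - `|y - 1|) / 2.

Lemma clamp_id y : -1 <= y <= 1 -> clamp y = y.
Proof.
move=> /andP[h1 h2]; rewrite /clamp ger0_norm; last by lra.
rewrite ler0_norm; last by lra.
lra.
Qed.

Lemma clamp_le y : `|clamp y| <= 1.
Proof.
rewrite /clamp normrM normfV (ger0_norm (_ : 0 <= 2)) // ler_pdivrMr // mul1r.
apply: (le_trans (ler_dist_dist _ _)).
have -> : y + 1 - (y - 1) = 2 by lra.
by rewrite ger0_norm.
Qed.

Lemma continuous_clamp : continuous clamp.
Proof.
have c (k : R) : continuous (fun y : R => `|y + k|).
  move=> y; apply: (@continuous_comp _ _ _ (fun y : R => y + k) (fun y : R => `|y|)).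
    by apply: (@continuousD R R^o); [exact: cvg_id|exact: cst_continuous].
  exact: (@norm_continuous R R^o).
move=> y; have cB := @continuousB R R^o R _ _ y (c 1 y) (c (-1) y).
exact: (@continuousM R R _ (cst 2^-1) y cB (@cst_continuous _ _ _ y)).
Qed.

Lemma continuous_half_chord : continuous (fun y : R => Num.sqrt (1 - clamp y ^+ 2)).
Proof.
move=> y; apply: (@continuous_comp _ _ _ (fun y => 1 - clamp y ^+ 2) (@Num.sqrt R));
    last exact: sqrt_continuous.
have c2 : {for y, continuous (fun y => clamp y ^+ 2)}.
  by apply: (@continuousM R); exact: continuous_clamp.
exact: (@continuousB R R^o R (cst 1) _ y (@cst_continuous _ _ _ y) c2).
Qed.

Lemma half_chord_sq y : Num.sqrt (1 - clamp y ^+ 2) ^+ 2 + clamp y ^+ 2 = 1.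
Proof.
rewrite sqr_sqrtr ?subrK // subr_ge0 -(real_normK (num_real _)) -(expr1n _ 2).
by rewrite ler_pXn2r ?nnegrE // clamp_le.
Qed.

Lemma chord_in_disc (x y : R) : -1 <= y <= 1 ->
  - Num.sqrt (1 - y ^+ 2) <= x <= Num.sqrt (1 - y ^+ 2) <-> D (x, y).
Proof.
move=> y1; have y2 : 0 <= 1 - y ^+ 2.
  rewrite subr_ge0 -(real_normK (num_real _)) -(expr1n _ 2).
  by rewrite ler_pXn2r ?nnegrE // ler_norml.
rewrite -ler_norml -(@ler_pXn2r _ 2) ?nnegrE ?sqrtr_ge0 // sqr_sqrtr // real_normK ?num_real //.
by rewrite /unit_disc /= lerBrDr.
Qed.

(** * Green's formula for the derivative in [x], by horizontal chords *)

Section green_x.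
Variables (O : set (R * R)) (q q1 : R * R -> R).
Hypotheses (oO : open O) (DO : D `<=` O).
Hypothesis cq : forall z, O z -> {for z, continuous q}.
Hypothesis cq1 : forall z, O z -> {for z, continuous q1}.
Hypothesis dq : forall z, O z -> is_derive z.1 (1 : R) (fun x => q (x, z.2)) (q1 z).

Lemma chord_integral (y : R) : -1 <= y <= 1 ->
  (\int[mu]_x (((EFin \o q1) \_ D) (x, y)) =
   (q (Num.sqrt (1 - y ^+ 2), y) - q (- Num.sqrt (1 - y ^+ 2), y))%:E)%E.
Proof.
move=> y1; set r := Num.sqrt _.
have line (x : R) : x \in `[-r, r] -> O (x, y).
  by rewrite in_itv /= => h; apply: DO; exact: (chord_in_disc x y1).1.
have cl (f : R * R -> R) : (forall z, O z -> {for z, continuous f}) ->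
    {within `[-r, r], continuous (fun x => f (x, y))}.
  move=> cf; apply: continuous_in_subspaceT => x /set_mem /= xr.
  apply: (@continuous_comp _ _ _ (fun x : R => (x, y)) f); last exact/cf/line.
  by apply: continuous_pair; [exact: cvg_id|exact: cst_continuous].
have rr : - r <= r by rewrite ge0_cp ?sqrtr_ge0.
have dd (x : R) : - r < x < r -> is_derive x (1 : R) (fun x => q (x, y)) (q1 (x, y)).
  move=> /andP[x1 x2]; apply: (dq (z := (x, y))).
  by apply: line; rewrite in_itv /= !ltW.
apply: (etrans _ (integral_FTC2_EFin rr (cl _ cq1) (cl _ cq) dd)).
rewrite [RHS]integral_mkcond; apply: eq_integral => x _.
rewrite /patch; case: ifPn => [/set_mem Dx|Dx].
  by rewrite mem_set //= in_itv /=; exact: (chord_in_disc x y1).2.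
rewrite memNset //= in_itv /= => h; move/negP: Dx; apply.
by rewrite inE; exact: (chord_in_disc x y1).1.
Qed.

(** Fubini with [x] integrated first. Slices at heights outside [-1, 1] are empty, and on [-1, 1]
    [clamp] changes nothing. *)
Lemma disc_integral_slices :
  \int[(mu \x mu)%E]_(z in (D : set T)) q1 z =
  \int[mu]_(y in `[-1, 1]) (q (Num.sqrt (1 - clamp y ^+ 2), clamp y)
     - q (- Num.sqrt (1 - clamp y ^+ 2), clamp y)).
Proof.
rewrite /Rintegral; congr fine; rewrite integral_mkcond [RHS]integral_mkcond.
have iq := disc_integrable oO DO cq1.
have iqT := (integrable_mkcond _ unit_disc_measurable).1 iq.
rewrite -(integral21_prod_meas1 iqT); apply: eq_integral => y _.
rewrite [RHS]/patch; case: ifPn => [/set_mem /= | yn].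
  by rewrite in_itv /= => y1; rewrite clamp_id //; exact: chord_integral.
apply: integral0_eq => x _; rewrite /patch; case: ifPn => // /set_mem Dxy.
by have [_ /= yy] := unit_disc_box Dxy; move/negP: yn; case; rewrite inE.
Qed.

Lemma circle_in_disc (t : R) : O (cos t, sin t).
Proof. by apply: DO; rewrite /unit_disc /= cos2Dsin2. Qed.

Lemma continuous_on_circle (f : R * R -> R) : (forall z, O z -> {for z, continuous f}) ->
  continuous (fun t : R => f (cos t, sin t)).
Proof.
move=> cf t; apply: (@continuous_comp _ _ _ (fun t : R => (cos t, sin t)) f).
  by apply: continuous_pair; [exact: continuous_cos|exact: continuous_sin].
exact/cf/circle_in_disc.
Qed.

(** The right and left ends of the chords trace the right half circle upwards and the left half
    circle downwards. With $y = \sin t$, the half chord is $\cos t$ on the right and $-\cos t$ on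
    the left. *)
Lemma green_x : \int[(mu \x mu)%E]_(z in (D : set T)) q1 z =
  \int[mu]_(t in `[0, 2 * pi]) (q (cos t, sin t) * cos t).
Proof.
rewrite disc_integral_slices.
(* The value of [q] at the right end of the chord for [s = 1], at the left end for [s = -1]. *)
pose g (s : R) (y : R) := q (s * Num.sqrt (1 - clamp y ^+ 2), clamp y).
have cg s : s ^+ 2 = 1 -> continuous (g s).
  move=> s2 y; apply: (@continuous_comp _ _ _ (fun y => (s * Num.sqrt (1 - clamp y ^+ 2),
      clamp y)) q).
    apply: continuous_pair; last exact: continuous_clamp.
    exact: (@continuousM R R (cst s) _ y (@cst_continuous _ _ _ y) (@continuous_half_chord y)).
  by apply: cq; apply: DO; rewrite /unit_disc /= exprMn s2 mul1r half_chord_sq.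
have cp := cg 1 (expr1n _ _); have cm : continuous (g (-1)) by apply: cg; rewrite sqrrN expr1n.
have [Gp dGp] := primitive_exists cp.
have [Gm dGm] := primitive_exists cm.
have -> : \int[mu]_(y in `[-1, 1]) (q (Num.sqrt (1 - clamp y ^+ 2), clamp y)
     - q (- Num.sqrt (1 - clamp y ^+ 2), clamp y)) = (Gp 1 - Gm 1) - (Gp (-1) - Gm (-1)).
  transitivity (\int[mu]_(y in `[-1, 1]) (g 1 y - g (-1) y)).
    by apply: eq_Rintegral => y _; rewrite /g mul1r mulN1r.
  apply: (@integral_derive R (fun y => g 1 y - g (-1) y) (fun y => Gp y - Gm y)).
  - by rewrite ge0_cp.
  - by move=> y; exact: (@continuousB R R^o R _ _ y (cp y) (cm y)).
pose h (t : R) := q (cos t, sin t) * cos t.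
have ch : continuous h.
  by move=> t; apply: (@continuousM R); [exact: continuous_on_circle cq t|exact: continuous_cos].
have [H dH] := primitive_exists ch.
have pi0 : 0 < pi :> R := pi_gt0 R.
rewrite (integral_derive _ ch dH); last by rewrite mulr_ge0 // ltW.
have hper t : h (t + 2 * pi) = h t.
  by have [c s] := cos_sin_shift t 1; rewrite mulr1 in c s; rewrite /h c s.
(* Where $s\cos t \ge 0$, $|\cos t| = s\cos t$ turns the integrand into [g s (sin t) * cos t], the
   derivative of [G \o sin]. *)
have half (s : R) (G : R -> R) (a b : R) : a <= b -> s ^+ 2 = 1 ->
    (forall x, is_derive x (1 : R) G (g s x)) ->
    (forall t, a <= t <= b -> 0 <= s * cos t) -> H b - H a = G (sin b) - G (sin a).
  move=> ab s2 dG sc; rewrite -(integral_derive ab ch dH).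
  have cgs := cg s s2.
  transitivity (\int[mu]_(t in `[a, b]) (g s (sin t) * cos t)).
    apply: eq_Rintegral => t /set_mem /=; rewrite in_itv /= => tab; rewrite /h /g.
    rewrite clamp_id ?sin_geN1 ?sin_le1 // -cos2sin2 sqrtr_sqr.
    have -> : `|cos t| = s * cos t.
      rewrite -(ger0_norm (sc _ tab)) normrM.
      have /eqP -> : `|s| == 1 by rewrite -(@pexpr_eq1 _ _ 2) // real_normK ?num_real // s2.
      by rewrite mul1r.
    by rewrite mulrA -expr2 s2 mul1r.
  apply: (@integral_derive R (fun t => g s (sin t) * cos t) (fun t => G (sin t)) a b ab).
    move=> t; have c1 : {for t, continuous (fun t => g s (sin t))}.
      by apply: (@continuous_comp _ _ _ (@sin R) (g s)); [exact: continuous_sin|exact: cgs].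
    exact: (@continuousM R R _ (@cos R) t c1 (@continuous_cos R t)).
have h1 : H (pi / 2) - H (- (pi / 2)) = Gp 1 - Gp (-1).
  rewrite -[X in Gp X - _](@sin_pihalf R) -[X in _ - Gp X](_ : sin (- (pi / 2)) = -1);
      last by rewrite sinN sin_pihalf.
  apply: (half 1) => //; first by rewrite ge0_cp // divr_ge0 // ltW.
    by rewrite expr1n.
  by move=> t tp; rewrite mul1r; exact: cos_ge0_pihalf.
have s3 : sin (pi / 2 + pi) = -1 :> R by rewrite sinDpi sin_pihalf.
have h2 : H (pi / 2 + pi) - H (pi / 2) = Gm (-1) - Gm 1.
  rewrite -[X in _ - Gm X](@sin_pihalf R) -[X in Gm X - _]s3.
  apply: (half (-1)) => //; first by rewrite lerDl ltW.
    by rewrite sqrrN expr1n.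
  move=> t /andP[t1 t2]; rewrite mulN1r.
  have -> : cos t = - cos (t - pi) by rewrite -[in LHS](subrK pi t) cosDpi.
  rewrite opprK; apply: cos_ge0_pihalf; apply/andP; split; lra.
(* By periodicity the integral over $[0, 2\pi]$ is that over $[-\pi/2, 3\pi/2]$, which splits into
   the two half circles. *)
have := primitive_shift hper dH 0 (- (pi / 2)).
have -> : - (pi / 2) + 2 * pi = pi / 2 + pi :> R by field.
rewrite add0r => ->; lra.
Qed.

End green_x.

(** Reflection in the diagonal reduces this to [green_x]; on the circle the reflection is $t \mapsto
    \pi/2 - t$. *)
Lemma green_y (O : set (R * R)) (q q1 : R * R -> R) : open O -> D `<=` O ->
  (forall z, O z -> {for z, continuous q}) ->
  (forall z, O z -> {for z, continuous q1}) ->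
  (forall z, O z -> is_derive z.2 (1 : R) (fun y => q (z.1, y)) (q1 z)) ->
  \int[(mu \x mu)%E]_(z in (D : set T)) q1 z =
  \int[mu]_(t in `[0, 2 * pi]) (q (cos t, sin t) * sin t).
Proof.
move=> oO DO cq cq1 dq.
pose sw (z : R * R) : R * R := (z.2, z.1).
have csw : continuous sw by move=> z; apply: continuous_pair; [exact: cvg_snd|exact: cvg_fst].
have oO' : open (sw @^-1` O) by apply: open_comp => // z _; exact: csw.
have DO' : D `<=` sw @^-1` O by move=> z Dz; apply: DO; rewrite /unit_disc /= addrC.
have csq (f : R * R -> R) : (forall z, O z -> {for z, continuous f}) ->
    forall z, (sw @^-1` O) z -> {for z, continuous (f \o sw)}.
  by move=> cf z Oz; apply: continuous_comp; [exact: csw|exact: cf].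
have := @green_x (sw @^-1` O) (q \o sw) (q1 \o sw) oO' DO' (csq _ cq) (csq _ cq1)
  (fun z Oz => dq _ Oz).
(* The swap preserves the double integral: Fubini is applied in opposite orders on the two sides,
   and the disc is symmetric. *)
have -> : \int[(mu \x mu)%E]_(z in (D : set T)) (q1 \o sw) z =
    \int[(mu \x mu)%E]_(z in (D : set T)) q1 z.
  rewrite /Rintegral; congr fine; rewrite integral_mkcond [RHS]integral_mkcond.
  have i1 := (integrable_mkcond _ unit_disc_measurable).1 (disc_integrable oO DO cq1).
  have i2 := (integrable_mkcond _ unit_disc_measurable).1 (disc_integrable oO' DO' (csq _ cq1)).
  rewrite -(integral12_prod_meas1 i2) -(integral21_prod_meas1 i1).
  apply: eq_integral => x _; apply: eq_integral => y _; rewrite /patch /=.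
  by congr (if _ then _ else _); apply/idP/idP; rewrite !inE /unit_disc /= addrC.
move=> ->.
have pi0 : 0 < pi :> R := pi_gt0 R.
pose h (t : R) := q (cos t, sin t) * sin t.
have ch : continuous h.
  by move=> t; apply: (@continuousM R);
      [exact: (continuous_on_circle DO cq)|exact: continuous_sin].
have [H dH] := primitive_exists ch.
rewrite (integral_derive _ ch dH); last by rewrite mulr_ge0 // ltW.
have hper t : h (t + 2 * pi) = h t.
  by have [c s] := cos_sin_shift t 1; rewrite mulr1 in c s; rewrite /h c s.
have rot t : cos (pi / 2 - t) = sin t /\ sin (pi / 2 - t) = cos t :> R.
  by rewrite addrC cosDpihalf sinDpihalf sinN cosN opprK.
have dK t : is_derive t (1 : R) (fun t => - H (pi / 2 - t)) ((q \o sw) (cos t, sin t) * cos t).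
  have [c s] := rot t.
  have dl : is_derive t (1 : R) (fun t => pi / 2 - t) (0 - 1) by apply: is_deriveB.
  have := is_deriveN (@is_derive1_comp R H (fun t => pi / 2 - t) t _ _ (dH _) dl).
  by move/is_derive_ext; apply => //; rewrite /h c s /sw /= sub0r mulrN1 opprK.
have cK : continuous (fun t => (q \o sw) (cos t, sin t) * cos t).
  move=> t; have c1 := continuous_on_circle DO' (csq _ cq) (x := t).
  exact: (@continuousM R R _ (@cos R) t c1 (@continuous_cos R t)).
have pi20 : 0 <= 2 * pi :> R by rewrite mulr_ge0 // ltW.
apply: (etrans (integral_derive pi20 cK dK)).
(* The substituted primitive runs from $\pi/2$ down to $\pi/2 - 2\pi$ with a minus sign, so it too
   measures one full period of [H]. *)
have := primitive_shift hper dH 0 (pi / 2 - 2 * pi).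
by rewrite subrK add0r subr0 => ->; rewrite opprK addrC.
Qed.

End green.

(** * Stokes' theorem and the Maslov index *)

Section assembly.
Variable R : realType.
Local Notation mu := (@lebesgue_measure R).

Lemma smooth_circle : smooth_map setT (@circle R).
Proof.
have cx k : Ck k setT (fun x : 'rV[R]_1 => x 0 0 : R^o).
  by have /Ck_mxP := @smooth_on_id R 1 setT k; apply; exact: openT.
have cs k := Ck_cos_sin (@openT _) (cx k).
have ck k : Ck k setT (@circle R : 'rV[R]_1 -> 'rV[R]_2).
  apply/Ck_mxP => [|i b]; first exact: openT.
  case bE : (b == 0 :> nat).
    by apply: (Ck_ext (@openT _) _ (cs k).1) => x _; rewrite mxE bE.
  by apply: (Ck_ext (@openT _) _ (cs k).2) => x _; rewrite mxE bE.
split=> [x _|[] [] k]; first exact: (ck 0%N).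
by apply: Ck_sub (ck k).
Qed.

(** Points are rewritten as points of coordinate lines, the form in which [is_derive_line] produces
    one-variable derivatives. *)
Lemma pt1_line (t : R) : pt1 t = 0 + t *: delta_mx 0 0 :> 'rV[R]_1.
Proof. by apply/rowP => i; rewrite !mxE !ord1 eqxx mulr1 add0r. Qed.

Lemma pt2_line0 (x y : R) : pt2 x y = pt2 0 y + x *: delta_mx 0 0 :> 'rV[R]_2.
Proof.
by apply/rowP => -[[|[|//]] h]; rewrite !mxE /= ?mulr1 ?mulr0 ?add0r ?addr0.
Qed.

Lemma pt2_line1 (x y : R) : pt2 x y = pt2 x 0 + y *: delta_mx 0 1 :> 'rV[R]_2.
Proof.
by apply/rowP => -[[|[|//]] h]; rewrite !mxE /= ?mulr1 ?mulr0 ?add0r ?addr0.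
Qed.

Lemma continuous_pt1 : continuous (fun t : R => pt1 t : 'rV[R]_1).
Proof.
move=> t; have -> : (fun t : R => pt1 t : 'rV[R]_1) = (fun t => t *: delta_mx 0 0).
  by apply/funext => s; rewrite pt1_line add0r.
exact: scalel_continuous.
Qed.

Lemma continuous_pt2 : continuous (fun z : R * R => pt2 z.1 z.2 : 'rV[R]_2).
Proof.
move=> z.
have -> : (fun z : R * R => pt2 z.1 z.2 : 'rV[R]_2) =
   (fun z => z.1 *: delta_mx 0 0) + (fun z => z.2 *: delta_mx 0 1).
  apply/funext => s; apply/rowP => -[[|[|//]] h];
    by rewrite !fctE !mxE /= ?mulr1 ?mulr0 ?add0r ?addr0.
apply: continuousD.
  apply: (@continuous_comp _ _ _ fst (fun x : R => x *: delta_mx 0 0)); first exact: cvg_fst.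
  exact: scalel_continuous.
apply: (@continuous_comp _ _ _ snd (fun x : R => x *: delta_mx 0 1)); first exact: cvg_snd.
exact: scalel_continuous.
Qed.

Lemma circle_pt1 (t : R) : circle (pt1 t) = pt2 (cos t) (sin t).
Proof. by rewrite /circle /pt1 mxE. Qed.

Lemma pull1_circle (b : euclid R 2 -> 'cV[R]_2) (t : R) :
  pull1 (@circle R) b (pt1 t) 0 0 =
  b (pt2 (cos t) (sin t)) 1 0 * cos t - b (pt2 (cos t) (sin t)) 0 0 * sin t.
Proof.
have dc := smooth_mdifferentiable smooth_circle (I : setT (pt1 t)).
have {}dc : differentiable (@circle R : 'rV[R]_1 -> 'rV[R]_2) (pt1 t) by case: dc.
rewrite /pull1 mxE big_ord_recl big_ord1 circle_pt1.
have -> : mdiff (@circle R) (pt1 t) = jacobian (@circle R : 'rV[R]_1 -> 'rV[R]_2) (pt1 t) by [].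
rewrite !jacobian_entry // /partial.
have dx : differentiable (fun y : 'rV[R]_1 => y 0 0 : R^o) (pt1 t).
  exact: differentiable_coord.
have D1 : 'D_(delta_mx 0 0) (fun y : 'rV[R]_1 => y 0 0 : R^o) (pt1 t) = 1.
  have := @derive_mx R _ 1 1 (fun y : 'rV[R]_1 => y) (pt1 t) (delta_mx 0 0) (@derivable_id
      _ _ _ _).
  by rewrite derive_id => /matrixP /(_ 0 0); rewrite !mxE.
have t0 : (pt1 t : 'rV[R]_1) 0 0 = t by rewrite mxE.
have E0 : 'D_(delta_mx 0 0) (fun y => (circle y : 'rV[R]_2) 0 0 : R^o) (pt1 t) = - sin t.
  have [_ /(_ (delta_mx 0 0))] := differentiable_comp1 (is_derive_cos _) dx.
  rewrite D1 mulr1 t0 => <-; congr ('D_ _ _ _).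
  by apply/funext => y; rewrite mxE.
have E1 (j : 'I_2) : j = 1%N :> nat ->
    'D_(delta_mx 0 0) (fun y => (circle y : 'rV[R]_2) 0 j : R^o) (pt1 t) = cos t.
  move=> j1; have [_ /(_ (delta_mx 0 0))] := differentiable_comp1 (is_derive_sin _) dx.
  rewrite D1 mulr1 t0 => <-; congr ('D_ _ _ _).
  by apply/funext => y; rewrite mxE j1.
rewrite E0 E1 //.
have -> : lift ord0 ord0 = 1 :> 'I_2 by apply: val_inj.
by rewrite mulNr addrC mulrC (mulrC (sin t)).
Qed.

Lemma smooth_form1_euclid (d : nat) (N : set (euclid R d)) (c : euclid R d -> 'cV[R]_d) :
  smooth_form1 N c <-> forall k, Ck k N (c : 'rV[R]_d -> 'cV[R]_d).
Proof.
have E : [set @Defs.coord R d (euclid R d) tt x | x in @dom R d (euclid R d) tt `&` N] = N.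
  by rewrite -[RHS](image_id N) setTI.
split=> [sc k|sc [] k]; first by have := sc tt k; rewrite euclid_chart1 E.
by rewrite euclid_chart1 E; exact: sc.
Qed.

Section stokes.
Variables (V : set (euclid R 2)) (b : euclid R 2 -> 'cV[R]_2).
Hypotheses (oV : open V) (DV : @closed_disc R `<=` V) (sb : smooth_form1 V b).

Let cb k i : Ck k V (fun y : 'rV[R]_2 => b y i 0 : R^o).
Proof.
by have /Ck_mxP := (smooth_form1_euclid _ _).1 sb k; apply.
Qed.

Let O : set (R * R) := (fun z => pt2 z.1 z.2) @^-1` V.

Let oO : open O.
Proof. by apply: open_comp => // z _; exact: continuous_pt2. Qed.

Let DO : @unit_disc R `<=` O.
Proof. by move=> z Dz; apply: DV; exists z. Qed.

Let cpt2 (f : 'rV[R]_2 -> R^o) : Ck 0 V f ->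
  forall z, O z -> {for z, continuous (fun z : R * R => f (pt2 z.1 z.2) : R)}.
Proof.
move=> cf z Oz; apply: (@continuous_comp _ _ _ (fun z => pt2 z.1 z.2 : 'rV[R]_2) f).
  exact: continuous_pt2.
exact: cf.
Qed.

Let cD i j : Ck 0 V ('D_(delta_mx 0 i) (fun y : 'rV[R]_2 => b y j 0 : R^o)).
Proof. by have [_] := cb 1 j; apply. Qed.

Let dD j z : O z -> differentiable (fun y : 'rV[R]_2 => b y j 0 : R^o) (pt2 z.1 z.2).
Proof. by move=> Oz; have [+ _] := cb 1 j; apply. Qed.

(** [green_x] for the second component of [b] minus [green_y] for the first. Integrability is
    recorded as well, since the final computation splits and rescales these integrals. *)
Lemma stokes_disc :
  [/\ (mu \x mu)%E.-integrable (@unit_disc R : set (measurableTypeR R * measurableTypeR R))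
        (EFin \o (fun z => dform b (pt2 z.1 z.2) 0 1)),
      mu.-integrable `[0, 2 * pi] (EFin \o (fun t => pull1 (@circle R) b (pt1 t) 0 0)) &
      \int[mu]_(t in `[0, 2 * pi]) pull1 (@circle R) b (pt1 t) 0 0 =
      disc_integral (dform b)].
Proof.
pose q (j : 'I_2) (z : R * R) : R := b (pt2 z.1 z.2) j 0.
pose dq (i j : 'I_2) (z : R * R) : R := partial i (fun y => b y j 0) (pt2 z.1 z.2).
have cq j : forall z, O z -> {for z, continuous (q j)} := cpt2 (cb 0 j).
have cdq i j : forall z, O z -> {for z, continuous (dq i j)} := cpt2 (@cD i j).
have i01 := disc_integrable oO DO (cdq 0 1).
have i10 := disc_integrable oO DO (cdq 1 0).
have dE z : dform b (pt2 z.1 z.2) 0 1 = dq 0 1 z - dq 1 0 z by exact: euclid_dform.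
have mD := @unit_disc_measurable R.
have dx z : O z -> is_derive z.1 (1 : R) (fun x => q 1 (x, z.2)) (dq 0 1 z).
  move=> Oz; have := dD 1 Oz; rewrite pt2_line0 => /is_derive_line h.
  apply: (is_derive_ext h) => [x|]; first by rewrite /q /= -pt2_line0.
  by rewrite /dq /partial -pt2_line0.
have dy z : O z -> is_derive z.2 (1 : R) (fun y => q 0 (z.1, y)) (dq 1 0 z).
  move=> Oz; have := dD 0 Oz; rewrite pt2_line1 => /is_derive_line h.
  apply: (is_derive_ext h) => [x|]; first by rewrite /q /= -pt2_line1.
  by rewrite /dq /partial -pt2_line1.
have cc j (f : R -> R) : continuous f -> continuous (fun t => q j (cos t, sin t) * f t).
  move=> cf t; have c1 := continuous_on_circle DO (cq j) (x := t).
  exact: (@continuousM R R _ f t c1 (cf t)).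
have ic : mu.-integrable `[0, 2 * pi] (EFin \o (fun t => q 1 (cos t, sin t) * cos t)).
  by apply: continuous_itv_integrable; apply: cc; exact: continuous_cos.
have is' : mu.-integrable `[0, 2 * pi] (EFin \o (fun t => q 0 (cos t, sin t) * sin t)).
  by apply: continuous_itv_integrable; apply: cc; exact: continuous_sin.
split.
- have := integrableB mD i01 i10.
  apply: eq_integrable => // z _ /=.
  by rewrite dE EFinB.
- have mI : measurable ([set` `[0, 2 * pi]] : set (measurableTypeR R)) by exact: measurable_itv.
  have := integrableB mI ic is'.
  apply: eq_integrable => // t _ /=.
  by rewrite pull1_circle EFinB.
rewrite /disc_integral.
under [RHS]eq_Rintegral do rewrite dE.
rewrite RintegralB // (green_x oO DO (cq 1) (cdq 0 1) dx) (green_y oO DO (cq 0) (cdq 1 0) dy).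
rewrite -RintegralB //.
by apply: eq_Rintegral => t _; rewrite pull1_circle.
Qed.

End stokes.

(** Over the line, [dlog] has the single entry $\mathrm{Re}\,c\,(\mathrm{Im}\,c)' -
    \mathrm{Im}\,c\,(\mathrm{Re}\,c)'$, which is the integrand of [degree_integral]. *)
Lemma loop_dlog (d : nat) (S : manifold R d) (g : S -> R[i]) (gamma : euclid R 1 -> S) :
  smooth_U1 setT g -> smooth_loop gamma ->
  (forall t, {for t, continuous (fun t => dlog (g \o gamma) (pt1 t) 0 0)}) /\
  \int[mu]_(t in `[0, 2 * pi]) dlog (g \o gamma) (pt1 t) 0 0 = 2 * pi * (maslov_class g
      gamma)%:~R.
Proof.
move=> sg [sgam per].
have [sc c1] : smooth_U1 setT (g \o gamma).
  have := smooth_U1_comp openT sgam openT sg; rewrite preimage_setT setTI; exact: id.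
pose c (t : R) := g (gamma (pt1 t)).
have Cr k : Ck k setT (fun x : 'rV[R]_1 => complex.Re (g (gamma x)) : R^o).
  by have := sc.1 tt k; rewrite /= image_id setTI.
have Ci k : Ck k setT (fun x : 'rV[R]_1 => complex.Im (g (gamma x)) : R^o).
  by have := sc.2 tt k; rewrite /= image_id setTI.
have line (f : 'rV[R]_1 -> R^o) : (forall k, Ck k setT f) ->
    let df := fun t : R => partial 0 f (pt1 t) in
    continuous df /\ forall t, is_derive t (1 : R) (fun t => f (pt1 t) : R) (df t).
  move=> Cf df; split=> t.
    have [_ /(_ (delta_mx 0 0)) cD] := Cf 1%N.
    apply: (@continuous_comp _ _ _ (fun t : R => pt1 t : 'rV[R]_1) (partial 0 f)).
      exact: continuous_pt1.
    exact: cD.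
  have [dF _] := Cf 1%N.
  have := dF (pt1 t) I; rewrite pt1_line => /is_derive_line h.
  apply: (is_derive_ext h) => [s|]; first by rewrite -pt1_line.
  by rewrite /df /partial pt1_line.
have [cp dp] := line _ Cr; have [cq dq] := line _ Ci.
have E t : dlog (g \o gamma) (pt1 t) 0 0 =
  complex.Re (c t) * partial 0 (fun x : 'rV[R]_1 => complex.Im (g (gamma x))) (pt1 t)
  - complex.Im (c t) * partial 0 (fun x : 'rV[R]_1 => complex.Re (g (gamma x))) (pt1 t).
  by rewrite /dlog !mxE.
split.
  move=> t; have -> : (fun t => dlog (g \o gamma) (pt1 t) 0 0) =
    (fun t => complex.Re (c t) * partial 0 (fun x : 'rV[R]_1 => complex.Im (g (gamma x))) (pt1 t)
  - complex.Im (c t) * partial 0 (fun x : 'rV[R]_1 => complex.Re (g (gamma x))) (pt1 t)).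
    by apply/funext => s; exact: E.
  have h1 := @continuousM R R _ _ t (is_derive_continuous (dp t)) (cq t).
  have h2 := @continuousM R R _ _ t (is_derive_continuous (dq t)) (cp t).
  exact: (@continuousB R R^o R _ _ t h1 h2).
under eq_Rintegral do rewrite E.
apply: (degree_integral (c := c) dp dq cp cq).
  by move=> t; apply: norm1_ReIm; exact: c1.
by rewrite /c -(per 0) add0r.
Qed.

End assembly.

Lemma near_eq_dform (R : realType) (d : nat) (b b' : euclid R d -> 'cV[R]_d) (z : euclid R d) :
  (\near z, b z = b' z) -> dform b z = dform b' z.
Proof.
move=> bb; apply/matrixP => i j; rewrite !euclid_dform.
by congr (_ - _); apply: near_eq_derive; apply: filterS bb => y ->.
Qed.

Lemma dformB (R : realType) (d : nat) (b b' : euclid R d -> 'cV[R]_d) (N : set (euclid R d)) z :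
  open N -> smooth_form1 N b -> smooth_form1 N b' -> N z ->
  dform (fun y => b y - b' y) z = dform b z - dform b' z.
Proof.
move=> oN sb sb' Nz.
have D (c : euclid R d -> 'cV[R]_d) i j : smooth_form1 N c ->
    derivable (fun y : 'rV[R]_d => c y i 0 : R^o) z (delta_mx 0 j).
  move=> /smooth_form1_euclid /(_ 1%N) [dc _].
  by apply: diff_derivable; apply: (differentiable_mxP c z).1; exact: dc.
apply/matrixP => i j; rewrite [RHS]mxE [X in _ = _ + X]mxE !euclid_dform /partial.
have E c k : 'D_(delta_mx 0 k) (fun y => (b y - b' y) c 0 : R^o) z =
   'D_(delta_mx 0 k) (fun y => b y c 0 : R^o) z - 'D_(delta_mx 0 k) (fun y => b' y c 0 : R^o) z.
  rewrite -deriveB; try exact: D.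
  have e y : (b y - b' y) c 0 = ((fun y => b y c 0 : R^o) - (fun y => b' y c 0 : R^o)) y.
    by rewrite mxE [X in _ + X]mxE.
  by move/funext : e => ->.
by rewrite !E; ring.
Qed.

Lemma smooth_form1B (R : realType) (d : nat) (b b' : euclid R d -> 'cV[R]_d) (N : set
    (euclid R d)) :
  open N -> smooth_form1 N b -> smooth_form1 N b' -> smooth_form1 N (fun y => b y - b' y).
Proof.
move=> oN /smooth_form1_euclid sb /smooth_form1_euclid sb'; apply/smooth_form1_euclid => k.
move: (sb k) (sb' k) => /(Ck_mxP _ _ oN) cb /(Ck_mxP _ _ oN) cb'.
apply/(Ck_mxP _ _ oN) => i j.
by apply: (Ck_ext oN _ (CkB oN (cb i j) (cb' i j))) => y _; rewrite !mxE.
Qed.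

(** * Smoothness and exterior derivative of the difference form on the disc *)

Section disc_form_properties.
Variables (R : realType) (n : nat) (M : manifold R n.*2).
Variables (om J : M -> 'M[R]_(n.*2)) (k : R).
Variable a : connection R n n.*2 M.
Hypothesis om_symp : symplectic om.
Hypothesis J_comp : compatible om J.
Hypothesis ra : reference_connection om J k a.
Variables (V : set (euclid R 2)) (u : euclid R 2 -> M) (Af : connection R n 2 (euclid R 2)).
Hypotheses (oV : open V) (su : smooth_map V u).
Hypothesis hAf : hermitian_connection om J u V Af.
Hypothesis fAf : has_curvature om J u V (@closed_disc R) Af (fun _ => 0).

(** A unit section of the bundle near [u z] pulls back to a neighbourhood on which both connection
    forms are smooth; smoothness and the exterior derivative of $b$ are read off there. *)
Lemma disc_form_local z : V z -> exists (N : set (euclid R 2)) (W : set M) (s : M ->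
    multivec R n),
  [/\ open N, N z, N `<=` V, unit_section om J idfun W s & forall y, N y -> W (u y)] /\
  [/\ unit_section om J u N (s \o u), smooth_form1 N (Af (s \o u)),
      smooth_form1 N (pull1 u (a s)) &
      forall y, N y -> disc_form om J a u Af y = Af (s \o u) y - pull1 u (a s) y].
Proof.
move=> Vz; have [W [s [Wz us]]] := unit_section_exists om_symp J_comp (u z).
have [oW _ _] := us.
have usu := unit_section_comp openT (smooth_idfun M) oV su us.
rewrite setTI in usu; have [oN _ _] := usu.
exists (V `&` u @^-1` W), W, s; split; first by split => // y [].
have [sas _] := ra.1 W s (@subsetT _ _) us.
split => //.
- by have [] := @hAf (V `&` u @^-1` W) (s \o u) (@subIsetl _ V (u @^-1` W)) usu.
- exact: smooth_pull1 oV su oW sas.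
- by move=> y [Vy Wy]; exact: (disc_formE om_symp J_comp ra.1 oV su hAf us Wy Vy).
Qed.

Lemma smooth_disc_form : smooth_form1 V (disc_form om J a u Af).
Proof.
apply/smooth_form1_euclid => l; apply: Ck_local => z Vz.
have [N [W [s [[oN Nz NV us NW] [_ sA sa E]]]]] := disc_form_local Vz.
exists N => //; have /smooth_form1_euclid /(_ l) := smooth_form1B oN sA sa.
by apply: Ck_ext => // y Ny; exact/esym/E.
Qed.

Lemma dform_disc_form z : V z -> closed_disc z ->
  dform (disc_form om J a u Af) z = (2 * pi * k) *: pull2 u om z.
Proof.
move=> Vz Dz; have [N [W [s [[oN Nz NV us NW] [usN sA sa E]]]]] := disc_form_local Vz.
have [oW _ _] := us.
rewrite (near_eq_dform (open_near_eq oN E Nz)) (dformB oN sA sa Nz).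
(* Only here must [z] lie in the closed disc; what remains is minus the pulled-back curvature of
   [a], hence the positive sign. *)
rewrite (fAf NV usN Nz Dz) sub0r.
have [sas _] := ra.1 W s (@subsetT _ _) us.
rewrite (dform_pull1 oV su oW sas Vz (NW _ Nz)) /pull2.
rewrite (ra.2 W s (@subsetT _ _) us _ (NW _ Nz) I).
by rewrite -scalemxAr -scalemxAl scaleNr opprK.
Qed.

End disc_form_properties.

Theorem proposition7 (R : realType) (n : nat) (M : manifold R n.*2)
  (om : M -> 'M[R]_(n.*2)) (k : R)
  (S : manifold R n) (iota : S -> M) (o : S -> R)
  (J : M -> 'M[R]_(n.*2)) (a : connection R n n.*2 M)
  (A0 : connection R n n S) (gS : S -> R[i]) :
  compact [set: M] -> simply_connected R M ->
  symplectic om -> pseudo_einstein om k ->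
  lagrangian om iota -> orientation o -> bohr_sommerfeld om k iota ->
  compatible om J -> reference_connection om J k a ->
  canonical_trivial om J iota o A0 -> maslov_gauge om J iota a A0 gS ->
  forall (gamma : euclid R 1 -> S) (V : set (euclid R 2))
         (u : euclid R 2 -> M) (Af : connection R n 2 (euclid R 2)),
    smooth_loop gamma ->
    smooth_disc V u -> (forall x, u (circle x) = iota (gamma x)) ->
    hermitian_connection om J u V Af ->
    has_curvature om J u V (@closed_disc R) Af (fun _ => 0) ->
    maslov_index om J iota A0 gamma u Af - (maslov_class gS gamma)%:~R
    = k * disc_integral (pull2 u om).
Proof.
move=> _ _ om_symp _ [[siota _ _ _] _] _ _ J_comp ra [hA0 _] hgS.
move=> gamma V u Af lg [oV DV su] ub hAf fAf.
have sb := smooth_disc_form om_symp J_comp ra oV su hAf.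
have db z : closed_disc z -> _ := fun Dz => dform_disc_form om_symp J_comp ra oV su hAf fAf
    (DV z Dz) Dz.
have cV x : V (circle x) by apply: DV; exists (cos (x 0 0), sin (x 0 0)) => //;
    rewrite /unit_disc /= cos2Dsin2.
have [ib il st] := stokes_disc oV DV sb.
have [cl dl] := loop_dlog hgS.1 lg.
set b := disc_form om J a u Af in sb db ib il st.
have pi0 : 2 * pi != 0 :> R by rewrite mulf_neq0 // gt_eqF // pi_gt0.
(* [boundary_form] splits the integrand; Stokes evaluates the first part and the degree formula the
   second. *)
have L : loop_integral (connection_diff om J (iota \o gamma)
    (pullback om J u (@circle R) Af) (pullback om J iota gamma A0)) =
    disc_integral (dform b) + 2 * pi * (maslov_class gS gamma)%:~R.
  rewrite /loop_integral -st -dl -RintegralD //.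
  - apply: eq_Rintegral => t _.
    rewrite (boundary_form om_symp J_comp siota ra.1 hA0 hgS lg.1 oV su (@smooth_circle R)
        cV ub hAf).
    by rewrite mxE.
  - by apply: continuous_itv_integrable => t; exact: cl.
have dk : disc_integral (dform b) = 2 * pi * (k * disc_integral (pull2 u om)).
  (* For [k] nonzero, the pulled-back symplectic form is a multiple of [dform b] on the disc, so its
     integral is computed from the integrability known for [dform b]. This divides by [k], so
     [k = 0], where [dform b] vanishes on the disc, is separate. *)
  have [k0|k0] := eqVneq k 0.
    rewrite k0 mul0r mulr0 /disc_integral.
    transitivity (\int[(@lebesgue_measure R \x @lebesgue_measure R)%E]_(z in @unit_disc R)
        (0 : R)).
      apply: eq_Rintegral => z /set_mem Dz; rewrite db; last by exists z.
      by rewrite k0 mulr0 scale0r mxE.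
    by rewrite Rintegral_cst ?mul0r //; exact: unit_disc_measurable.
  have e : disc_integral (pull2 u om) = (2 * pi * k)^-1 * disc_integral (dform b).
    rewrite /disc_integral -RintegralZl //; last exact: unit_disc_measurable.
    apply: eq_Rintegral => z /set_mem Dz; rewrite db; last by exists z.
    by rewrite [X in _ * X]mxE mulKf // mulf_neq0.
  by rewrite e mulrA mulVKf // mulf_neq0.
by rewrite /maslov_index L dk mulrDr mulKf // mulKf // addrK.
Qed.
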